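(* Let $0\le\underline{\sigma}\le\overline{\sigma}<\infty$ and $G(a)=\frac12(\overline{\sigma}^2a^+-\underline{\sigma}^2a^-)$. Let $\Theta$ be a set of probability measures on $\mathbb{R}$ which is weakly compact and such that $\lim_{N\to\infty}\sup_{\mu\in\Theta}\int_{\mathbb{R}}|x|1_{\{|x|>N\}}\mu(dx)=0$, and let $\mathcal{N}[\varphi]=\max_{\mu\in\Theta}\mu[\varphi]$ for $\varphi\in C_{b,Lip}(\mathbb{R})$. Then $\mathcal{N}=\mathcal{N}_G$ on $C_{b,Lip}(\mathbb{R})$ (i.e. $\mathcal{N}$ is $G$-normal) if and only if for every $\varphi\in C_b^2(\mathbb{R})$, \[\sup_{\mu\in\Theta_\varphi}\int_{\mathbb{R}}\Big[G(\varphi''(x))-\frac{x}{2}\varphi'(x)\Big]\mu(dx)=0,\] where $\Theta_\varphi=\{\mu\in\Theta:\mu[\varphi]=\mathcal{N}[\varphi]\}$.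
   Context: $C_{b,Lip}(\mathbb{R})$: bounded Lipschitz functions on $\mathbb{R}$; $C_b^2(\mathbb{R})$: twice continuously differentiable functions bounded with bounded first and second derivatives; $\mu[\varphi]=\int\varphi\,d\mu$. For $\varphi\in C_{b,Lip}(\mathbb{R})$, let $u^\varphi$ be the viscosity solution of the $G$-heat equation $\partial_tu-G(\partial_x^2u)=0$ on $(0,\infty)\times\mathbb{R}$, $u(0,\cdot)=\varphi$; the $G$-normal distribution is $\mathcal{N}_G[\varphi]:=u^\varphi(1,0)$. *)

(* Defs.v *)
From HB Require Import structures.
From mathcomp Require Import all_boot all_order all_algebra.
From mathcomp Require Import all_classical all_reals all_analysis.
Set Implicit Arguments. Unset Strict Implicit. Unset Printing Implicit Defensive.
Import Order.TTheory GRing.Theory Num.Theory.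
Import numFieldNormedType.Exports.
Local Open Scope classical_set_scope.
Local Open Scope ring_scope.

Section defs.
Variable R : realType.

Definition Gfun (slo sup a : R) : R :=
  (sup ^+ 2 * Num.max a 0 - slo ^+ 2 * Num.max (- a) 0) / 2.

Definition CbLip (f : R -> R) : Prop :=
  (exists M : R, forall x, `|f x| <= M) /\
  (exists L : R, forall x y, `|f x - f y| <= L * `|x - y|).

Definition Cb (f : R -> R) : Prop :=
  continuous f /\ exists M : R, forall x, `|f x| <= M.

Definition Cb2 (f : R -> R) : Prop :=
  (forall x, derivable f x 1) /\ (forall x, derivable (derive1 f) x 1) /\
  continuous (derive1 (derive1 f)) /\
  (exists M : R, forall x, `|f x| <= M /\ `|derive1 f x| <= M /\ `|derive1 (derive1 f) x| <= M).

Definition mint (mu : probability R R) (f : R -> R) : \bar R :=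
  (\int[mu]_x (f x)%:E)%E.

(* Compactness of Theta in the topology of weak convergence of probability
   measures (the coarsest topology making mu |-> mu[f] continuous for all
   f in C_b(R)), stated via proper filters: every proper filter containing
   Theta has a cluster point in Theta.  The basic weak neighbourhoods of mu
   are { nu | |nu[f_i] - mu[f_i]| < eps, i < n } with f_i in C_b(R). *)
Definition weak_nbhs (mu : probability R R) (n : nat) (fs : 'I_n -> R -> R)
  (eps : R) : set (probability R R) :=
  [set nu | forall i, (`| mint nu (fs i) - mint mu (fs i) | < eps%:E)%E].

Definition weakly_compact (Theta : set (probability R R)) : Prop :=
  forall F : set_system (probability R R), ProperFilter F -> F Theta ->
  exists2 mu, Theta mu &
    forall (n : nat) (fs : 'I_n -> R -> R) (eps : R),
      (forall i, Cb (fs i)) -> 0 < eps ->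
      forall A, F A -> A `&` weak_nbhs mu fs eps !=set0.

Definition unif_integrable (Theta : set (probability R R)) : Prop :=
  (fun N : R => ereal_sup [set (\int[mu]_(x in [set y : R | (N < `|y|)%R]) (`|x|)%:E)%E
               | mu in Theta]) @ +oo%R --> 0%E.

(* N[phi] = max_{mu in Theta} mu[phi]  (the sup is attained) *)
Definition sublinN (Theta : set (probability R R)) (f : R -> R) : \bar R :=
  ereal_sup [set mint mu f | mu in Theta].

Definition dt (psi : R -> R -> R) : R -> R -> R :=
  fun t x => derive1 (fun s => psi s x) t.
Definition dx (psi : R -> R -> R) : R -> R -> R :=
  fun t x => derive1 (psi t) x.

Definition C12 (psi : R -> R -> R) : Prop :=
  (forall t x, derivable (fun s => psi s x) t 1) /\
  (forall t x, derivable (psi t) x 1) /\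
  (forall t x, derivable (dx psi t) x 1) /\
  continuous (fun p : R * R => psi p.1 p.2) /\
  continuous (fun p : R * R => dt psi p.1 p.2) /\
  continuous (fun p : R * R => dx psi p.1 p.2) /\
  continuous (fun p : R * R => dx (dx psi) p.1 p.2).

Definition loc_max_at (v : R -> R -> R) (t x : R) : Prop :=
  exists2 r : R, 0 < r & forall s y, 0 < s -> `|s - t| < r -> `|y - x| < r ->
    v s y <= v t x.

Definition is_G_visc_sol (slo sup : R) (phi : R -> R) (u : R -> R -> R) : Prop :=
  (* continuous and bounded on [0,oo) x R (uniqueness class) *)
  {within [set p : R * R | 0 <= p.1], continuous (fun p : R * R => u p.1 p.2)} /\
  (exists M : R, forall t x, 0 <= t -> `|u t x| <= M) /\
  (forall x, u 0 x = phi x) /\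
  (forall psi t x, 0 < t -> C12 psi ->
     loc_max_at (fun s y => u s y - psi s y) t x ->
     dt psi t x - Gfun slo sup (dx (dx psi) t x) <= 0) /\
  (forall psi t x, 0 < t -> C12 psi ->
     loc_max_at (fun s y => psi s y - u s y) t x ->
     dt psi t x - Gfun slo sup (dx (dx psi) t x) >= 0).

(* the viscosity solution u^phi (chosen; it exists and is unique) *)
Definition uG (slo sup : R) (phi : R -> R) : R -> R -> R :=
  get [set u | is_G_visc_sol slo sup phi u].

Definition NG (slo sup : R) (phi : R -> R) : R := uG slo sup phi 1 0.

End defs.

(* Main.v *)
(** The G-heat equation is approximated by the implicit Euler scheme
    [v_{k+1} - h (G (v_{k+1}'') + e v_{k+1}'') = v_k], all of whose steps are
    bounded C^2 functions.  Doubling the time variable only shows that the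
    scheme converges to every viscosity solution, and comparing two schemes
    that it has a limit; so [u^phi (1, 0)] exists and is the limit of [v_n 0]
    as [n h = 1].

    Let [N f] be the supremum of [mu f] over Theta.  When [mu] is optimal for
    [V = v (r .)], the slope of [N (v (r .))] in [r] is [E_mu (y v' (r y))] and
    the Stein condition compares it with [2 r E_mu (G (v'' (r y)))].  Hence
    [N (v_k (r .))] is almost constant along [r^2 = 1 - k h], going from
    [N phi] to [v_n 0].  The lower bound comes from touching
    [r |-> N (v_k (r .))] from above by explicit functions; for the upper bound
    the [v_k] are smoothed by a resolvent, so that their second derivatives
    become Lipschitz.

    Conversely, if [N] is G-normal then self-similarity gives
    [N (v (s, sqrt (1 - s) .)) = N phi], while
    [v (s, sqrt (1 - s) y) = phi y + s (G (phi'' y) - y / 2 phi' y) + o(s)].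
    Divide by [s], and use weak compactness for the existence of a
    maximizer. *)
Require Import Defs.
From HB Require Import structures.
From mathcomp Require Import all_boot all_order all_algebra.
From mathcomp Require Import all_classical all_reals all_analysis.
From mathcomp Require Import measurable_realfun ring lra.
Import Order.TTheory GRing.Theory Num.Theory.
Import numFieldNormedType.Exports.
Local Open Scope classical_set_scope.
Local Open Scope ring_scope.
Set Implicit Arguments. Unset Strict Implicit. Unset Printing Implicit Defensive.

(** * Bounded C^2 functions *)

Section Calculus.
Variable R : realType.
Implicit Types f g F : R -> R.

(** The equation may degenerate ([slo = 0]) and its solutions then need not be differentiable, while
    the Stein condition only speaks of bounded C^2 functions; hence the argument runs on the scheme.
    In one dimension [a -> h (G a + e a)] has an explicit piecewise linear inverse for [e > 0], so
    an implicit step is a semilinear equation [v'' = K (v - psi)], solved by a contraction. Each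
    step obeys a comparison principle, through which the bound [M] on the second derivative of the
    datum passes unchanged to all later steps; the regularisation is then a perturbation of size
    [e M]. The second obstacle is integrability: the measures have only uniformly integrable first
    moments, so a quadratic Taylor remainder cannot be integrated and [min (d y^2, |y|)] takes its
    place. Finally, the two bounds are not symmetric. An optimal measure controls the slope of a
    supremum from one side only, which suffices when an explicit function touches from above. In the
    other direction the measure optimal at one step is tested on the next one, whose second
    derivative is taken at another point and at another time: hence the smoothing. *)

Definition C2 (f f1 f2 : R -> R) : Prop :=
  [/\ forall x : R, is_derive x 1 f (f1 x), forall x : R, is_derive x 1 f1 (f2 x) &
      continuous f2].

Lemma is_derive1E f f1 : (forall x : R, is_derive x 1 f (f1 x)) -> derive1 f = f1.
Proof. by move=> df; apply/funext => x; rewrite derive1E; exact: derive_val. Qed.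

Lemma derivable_is_derive f (x : R) : derivable f x 1 -> is_derive x 1 f (derive1 f x).
Proof. by move=> df; rewrite derive1E; exact/derivableP. Qed.

Lemma is_derive_continuous f f1 : (forall x : R, is_derive x 1 f (f1 x)) -> continuous f.
Proof.
move=> df x; apply: differentiable_continuous; apply/derivable1_diffP.
by have [] := df x.
Qed.

Lemma C2E f f1 f2 : C2 f f1 f2 -> derive1 f = f1 /\ derive1 (derive1 f) = f2.
Proof. by case=> d1 d2 _; rewrite (is_derive1E d1) (is_derive1E d2). Qed.

Lemma Cb2_C2 f : Cb2 f -> C2 f (derive1 f) (derive1 (derive1 f)).
Proof.
case=> d1 [d2 [c _]]; split; last exact: c.
  by move=> x; exact/derivable_is_derive/d1.
by move=> x; exact/derivable_is_derive/d2.
Qed.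

Lemma C2_Cb2 f f1 f2 (M : R) : C2 f f1 f2 ->
  (forall x, `|f x| <= M /\ `|f1 x| <= M /\ `|f2 x| <= M) -> Cb2 f.
Proof.
move=> C b; have [E1 E2] := C2E C; have [d1 d2 c] := C; split; [|split; [|split]].
- by move=> x; have [] := d1 x.
- by move=> x; rewrite E1; have [] := d2 x.
- by rewrite E2.
- by exists M => x; rewrite E2 E1.
Qed.

(** Parametrising the segment by [[0, 1]] makes the statement indifferent to the order of [a] and
    [b]. *)
Lemma mvt01 f f1 (a b : R) : (forall x : R, is_derive x 1 f (f1 x)) ->
  exists2 t, 0 <= t <= 1 & f b - f a = f1 (a + t * (b - a)) * (b - a).
Proof.
move=> df; pose F (t : R) := f ((b - a) * t + a).
have dF (t : R) : is_derive t 1 F ((b - a) * f1 ((b - a) * t + a)).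
  have da : is_derive t 1 (fun x => (b - a) * x + a) (b - a).
    have := @is_deriveD _ _ _ (fun x => (b - a) * x) (cst a) t 1 ((b - a) *: 1) 0.
    rewrite addr0 /GRing.scale/= mulr1; apply.
    by have := @is_deriveZ _ _ _ id (b - a) t 1 1 (is_derive_id t 1); rewrite /GRing.scale/= mulr1.
  by rewrite mulrC; exact: (@is_derive1_comp R f (fun x => (b - a) * x + a) t _ _ (df _) da).
have [|c] := @MVT_segment R F _ 0 1 ler01 (fun x _ => dF x).
  exact/continuous_subspaceT/(is_derive_continuous dF).
rewrite in_itv/= => c01 E; exists c => //.
have E1 : (b - a) * 1 + a = b by ring.
have E0 : (b - a) * 0 + a = a by ring.
move: E; rewrite /F E1 E0 => ->; rewrite subr0 mulr1 mulrC; congr (f1 _ * _); ring.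
Qed.

Lemma mvt f f1 (a b : R) : (forall x : R, is_derive x 1 f (f1 x)) ->
  exists c, (`|c - a| <= `|b - a|) /\ f b - f a = f1 c * (b - a).
Proof.
move=> df; have [t /andP[t0 t1] E] := mvt01 a b df; exists (a + t * (b - a)); split=> //.
by rewrite addrAC subrr add0r normrM ger0_norm// ler_piMl.
Qed.

Lemma lipschitz_of_derive f f1 (L : R) : (forall x : R, is_derive x 1 f (f1 x)) ->
  (forall x, `|f1 x| <= L) -> forall x y, `|f x - f y| <= L * `|x - y|.
Proof.
move=> df b x y; have [c [_ ->]] := mvt y x df.
by rewrite normrM ler_wpM2r.
Qed.

(** If [f2] were positive, [f1], which vanishes at the maximum, would be positive just to the right
    of [x], and [f] would increase there. *)
Lemma max_second_derivative f f1 (f2 x r : R) : 0 < r ->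
  (forall y : R, is_derive y 1 f (f1 y)) -> is_derive x 1 f1 f2 ->
  (forall y, `|y - x| < r -> f y <= f x) -> f2 <= 0.
Proof.
move=> r0 df df1 mx.
have f1x : f1 x = 0.
  have : is_derive x 1 f 0.
    apply: (@derive1_at_max R f (x - r) (x + r)).
    - by rewrite lerD2l; lra.
    - by move=> t _; have [] := df t.
    - by rewrite in_itv/=; apply/andP; split; lra.
    - move=> t; rewrite in_itv/= => /andP[a b]; apply: mx.
      by rewrite ltr_norml; apply/andP; split; lra.
  by move=> [_ <-]; have [_ <-] := df x.
rewrite leNgt; apply/negP => f20.
have := df1; case=> /derivable_nbhsP /= dd E.
have : h^-1 *: (f1 (h + x) - f1 x) @[h --> 0^'] --> f2.
  case: df1 => ex <-; have := ex; rewrite /derivable /derive /=.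
  under eq_fun do rewrite /GRing.scale/= mulr1.
  by [].
move=> /cvgrPdist_lt /(_ f2 f20) [e /= e0 He].
pose d := Num.min (e / 2) (r / 2).
have d0 : 0 < d by rewrite lt_min; apply/andP; split; apply: divr_gt0.
have de : d < e by rewrite /d gt_min; apply/orP; left; lra.
have dr : d < r by rewrite /d gt_min; apply/orP; right; lra.
have pos h : 0 < h -> h <= d -> 0 < f1 (h + x).
  move=> h0 hd; have := He h; rewrite /= sub0r normrN gtr0_norm//.
  move=> /(_ (le_lt_trans hd de) (lt0r_neq0 h0)).
  rewrite f1x subr0 /GRing.scale/= ltr_norml => /andP[_ q].
  have {}q : 0 < h^-1 * f1 (h + x) by lra.
  by move: q; rewrite pmulr_rgt0// invr_gt0.
have [||c cin E2] := @MVT R f f1 x (x + d).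
- by rewrite ltrDl.
- exact/continuous_subspaceT/(is_derive_continuous df).
move: cin; rewrite in_itv/= => /andP[xc cd].
have c1 : 0 < f1 c.
  by rewrite -(subrK x c); apply: pos; lra.
have : f (x + d) <= f x.
  by apply: mx; rewrite addrAC subrr add0r gtr0_norm.
rewrite -subr_le0 E2 addrAC subrr add0r => /le_lt_trans /(_ (mulr_gt0 c1 d0)).
by rewrite ltxx.
Qed.

End Calculus.

(** Locked, so that derivatives behave as atoms and are never unfolded into limits. *)
HB.lock Definition D1 (R : realType) (f : R -> R) : R -> R := derive1 f.
HB.lock Definition D2 (R : realType) (f : R -> R) : R -> R := derive1 (derive1 f).

(** * Closure properties and the comparison principle for resolvents *)

Section C2_closure.
Variable R : realType.
Implicit Types f g F H : R -> R.

Lemma C2_cst (c : R) : C2 (fun _ : R => c) (fun=> 0) (fun=> 0).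
Proof. by split; [move=> x; exact: is_derive_cst..|move=> x; exact: cvg_cst]. Qed.

Lemma C2_add f f1 f2 g g1 g2 : C2 f f1 f2 -> C2 g g1 g2 ->
  C2 (fun x => f x + g x) (fun x => f1 x + g1 x) (fun x => f2 x + g2 x).
Proof.
move=> [a b c] [d e i]; split; [move=> x; exact: is_deriveD..|].
by move=> x; apply: cvgD; [exact: c|exact: i].
Qed.

Lemma C2_scale (k : R) f f1 f2 : C2 f f1 f2 ->
  C2 (fun x => k * f x) (fun x => k * f1 x) (fun x => k * f2 x).
Proof.
move=> [a b c]; split; [move=> x; exact: is_deriveZ..|].
by move=> x; apply: cvgM; [exact: cvg_cst|exact: c].
Qed.

Lemma C2_aff (a b : R) f f1 f2 : C2 f f1 f2 ->
  C2 (fun x => f (a * x + b)) (fun x => a * f1 (a * x + b))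
     (fun x => a ^+ 2 * f2 (a * x + b)).
Proof.
have da (x : R) : is_derive x 1 (fun x => a * x + b) a.
  have := @is_deriveD _ _ _ (fun x => a * x) (cst b) x 1 (a *: 1) 0.
  rewrite addr0 /GRing.scale/= mulr1; apply.
  by have := @is_deriveZ _ _ _ id a x 1 1 (is_derive_id x 1); rewrite /GRing.scale/= mulr1.
have dc (f0 f01 : R -> R) (x : R) : (forall x : R, is_derive x 1 f0 (f01 x)) ->
    is_derive x 1 (fun x => f0 (a * x + b)) (a * f01 (a * x + b)).
  move=> d; rewrite mulrC.
    exact: (@is_derive1_comp R f0 (fun x => a * x + b) x _ _ (d _) (da x)).
move=> [d1 d2 c]; split; first by move=> x; exact: dc.
- move=> x; rewrite exprS expr1 -mulrA.
  by apply: (@is_deriveZ _ _ _ (fun x => f1 (a * x + b)) a x 1); exact: dc.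
- move=> x; apply: cvgM; first exact: cvg_cst.
  apply: (@cvg_comp _ _ _ (fun x => a * x + b) f2); last exact: c.
  exact: (is_derive_continuous da).
Qed.

Lemma C2_sqr (x0 : R) : C2 (fun x => (x - x0) ^+ 2) (fun x => 2 * (x - x0)) (fun=> 2).
Proof.
have da (x : R) : is_derive x 1 (fun x => x - x0) 1.
  by have := @is_deriveB _ _ _ id (cst x0) x 1 1 0; rewrite subr0; apply.
split; last by move=> x; exact: cvg_cst.
- move=> x; have -> : 2 * (x - x0) = (x - x0) *: 1 + (x - x0) *: 1.
    by rewrite /GRing.scale/= mulr1; ring.
  exact: (@is_deriveM _ _ (fun x => x - x0) (fun x => x - x0) x 1 1 1 (da x) (da x)).
- move=> x; have := @is_deriveZ _ _ _ (fun x => x - x0) 2 x 1 1 (da x).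
  by rewrite /GRing.scale/= mulr1.
Qed.

Lemma Cb2D f : Cb2 f -> C2 f (D1 f) (D2 f).
Proof. by rewrite D1.unlock D2.unlock; exact: Cb2_C2. Qed.

Lemma C2D f f1 f2 : C2 f f1 f2 -> D1 f = f1 /\ D2 f = f2.
Proof. by rewrite D1.unlock D2.unlock; exact: C2E. Qed.

Lemma Cb2_bound f : Cb2 f -> exists2 M : R, 0 < M &
  forall x, `|f x| <= M /\ `|D1 f x| <= M /\ `|D2 f x| <= M.
Proof.
rewrite D1.unlock D2.unlock; case=> _ [_ [_ [M b]]]; exists (`|M| + 1); first by rewrite ltr_wpDl.
have h : M <= `|M| + 1 by rewrite (le_trans (ler_norm M))// lerDl.
by move=> x; have [? [? ?]] := b x; split; [|split]; apply: le_trans h.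
Qed.

Lemma C2_op f g (k l : R) : Cb2 f -> Cb2 g ->
  [/\ Cb2 (fun x => k * f x + l * g x),
   D1 (fun x => k * f x + l * g x) = (fun x => k * D1 f x + l * D1 g x) &
   D2 (fun x => k * f x + l * g x) = (fun x => k * D2 f x + l * D2 g x)].
Proof.
move=> bf bg; have [M M0 Mf] := Cb2_bound bf; have [N N0 Ng] := Cb2_bound bg.
have C := C2_add (C2_scale k (Cb2D bf)) (C2_scale l (Cb2D bg)).
split; [|by have [-> _] := C2D C|by have [_ ->] := C2D C].
have B a b : `|a| <= M -> `|b| <= N -> `|k * a + l * b| <= `|k| * M + `|l| * N.
  move=> aM bN; rewrite (le_trans (ler_normD _ _))// !normrM lerD// ler_wpM2l//.
apply: (C2_Cb2 C (M := `|k| * M + `|l| * N)) => x.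
by have [? [? ?]] := Mf x; have [? [? ?]] := Ng x; split; [|split]; apply: B.
Qed.

Lemma Cb2_cst (c : R) : Cb2 (fun _ : R => c) /\ D2 (fun _ : R => c) = fun=> 0.
Proof.
split; last by have [_ ->] := C2D (C2_cst c).
by apply: (C2_Cb2 (C2_cst c) (M := `|c|)) => x; rewrite normr0 lexx.
Qed.

Lemma Cb2_sub f g : Cb2 f -> Cb2 g ->
  Cb2 (fun x => f x - g x) /\ D2 (fun x => f x - g x) = (fun x => D2 f x - D2 g x).
Proof.
move=> bf bg; have [a _ b] := C2_op 1 (-1) bf bg.
have E u v : (fun x => 1 * u x + -1 * v x) = (fun x : R => u x - v x :> R).
  by apply/funext => x; rewrite mul1r mulN1r.
by rewrite !E in a b.
Qed.

Lemma Cb2_aff (a b : R) f : Cb2 f ->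
  [/\ Cb2 (fun x => f (a * x + b)),
   D1 (fun x => f (a * x + b)) = (fun x => a * D1 f (a * x + b)) &
   D2 (fun x => f (a * x + b)) = (fun x => a ^+ 2 * D2 f (a * x + b))].
Proof.
move=> bf; have [M M0 Mf] := Cb2_bound bf; have C := C2_aff a b (Cb2D bf).
split; [|by have [-> _] := C2D C|by have [_ ->] := C2D C].
apply: (C2_Cb2 C (M := (1 + `|a| + `|a| ^+ 2) * M)) => x.
have [A [B D]] := Mf (a * x + b).
have a0 := normr_ge0 a; have a2 := sqr_ge0 `|a|.
split; [|split]; rewrite ?normrM ?normrX.
- by rewrite (le_trans A)// ler_peMl ?(ltW M0)//; move: a0 a2; lra.
- by apply: ler_pM => //; lra.
- by apply: ler_pM => //; lra.
Qed.

Lemma Cb2_continuous f : Cb2 f -> continuous f.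
Proof. by move=> bf; apply: (@is_derive_continuous _ _ (D1 f)); case: (Cb2D bf). Qed.

(** A bounded function on the line need not attain its supremum; a small quadratic penalty restores
    a maximum point, at the cost of [2 * b] in the second-order condition. *)
Lemma coercive_max F (b x0 : R) : Cb2 F -> 0 < b -> exists2 y,
  forall z, F z - b * (z - x0) ^+ 2 <= F y - b * (y - x0) ^+ 2 & D2 F y <= 2 * b.
Proof.
move=> bF b0; have [M M0 MF] := Cb2_bound bF.
have C := C2_add (Cb2D bF) (C2_scale (- b) (C2_sqr x0)).
set G := fun x => F x - b * (x - x0) ^+ 2.
have EG : (fun x => F x + - b * (x - x0) ^+ 2) = G.
  by apply/funext => x; rewrite mulNr.
rewrite EG in C; have [c1 c2 _] := C.
(* At distance at least [A >= 1] from [x0] the penalty is at least [b * A = b + 2 * M], more than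
   the oscillation of [F]. *)
pose A := 1 + 2 * M / b.
have A1 : 1 < A by rewrite ltrDl divr_gt0// mulr_gt0.
have [||y yin ymax] := @EVT_max R G (x0 - A) (x0 + A).
- by lra.
- by apply: continuous_subspaceT; exact: (is_derive_continuous c1).
have ymaxT z : G z <= G y.
  have [|Hz] := boolP (z \in `[x0 - A, x0 + A]); first exact: ymax.
  apply: (@le_trans _ _ (G x0)); last first.
    by apply: ymax; rewrite in_itv/=; apply/andP; split; lra.
  have Az : A <= `|z - x0|.
    rewrite leNgt; apply: contra Hz => /ltW; rewrite ler_norml => /andP[u v].
    by rewrite in_itv/=; apply/andP; split; lra.
  have : A <= (z - x0) ^+ 2.
    rewrite -real_normK ?num_real// expr2.
    apply: (le_trans Az); apply: ler_peMr => //; apply: le_trans Az; exact: ltW.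
  move=> /(ler_wpM2l (ltW b0)); rewrite /A mulrDr mulr1 mulrCA mulfV ?gt_eqF// mulr1.
  have [/ler_normlP[u1 u2] _] := MF z; have [/ler_normlP[v1 v2] _] := MF x0.
  by rewrite /G subrr expr0n/= mulr0 => h; lra.
exists y => //.
have := @max_second_derivative R G _ _ y 1 ltr01 c1 (c2 y) (fun z _ => ymaxT z).
by rewrite /=; lra.
Qed.

Definition elliptic H (L : R) :=
  forall a b : R, a <= b -> 0 <= H b - H a /\ H b - H a <= L * (b - a).

(** Maximum principle for [u - h H(u'')]: at a penalised maximum of [f - g] one has
    [D2 f <= D2 g + 2 b], so monotonicity of [H] compares the two equations there up to [2 b h L],
    and [b] tends to [0]. *)
Lemma resolvent_le H L (h c : R) f g : elliptic H L -> 0 <= h -> Cb2 f -> Cb2 g ->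
  (forall x, f x - h * H (D2 f x) <= g x - h * H (D2 g x) + c) ->
  forall x, f x <= g x + c.
Proof.
move=> eH h0 bf bg fg x; have [bF DF] := Cb2_sub bf bg.
have L0 : 0 <= L by have [] := eH 0 1 ler01; lra.
suff main (b : R) : 0 < b -> f x <= g x + c + b * (2 * (h * L)).
  apply/ler_addgt0Pr => e e0; have hL : 0 <= h * L by exact: mulr_ge0.
  apply: (le_trans (main (e / (2 * (h * L) + 1)) _)).
    by rewrite divr_gt0//; lra.
  rewrite lerD2l mulrAC ler_pdivrMr ?ler_wpM2l//; lra.
move=> b0; have [y ymax yD] := coercive_max x bF b0.
have := ymax x; rewrite subrr expr0n/= mulr0 subr0 => fx.
have b1 : 0 <= b * (y - x) ^+ 2 by rewrite mulr_ge0 ?sqr_ge0// ltW.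
have le2 : D2 f y <= D2 g y + 2 * b by move: yD; rewrite DF; lra.
have [H1 _] := eH _ _ le2.
have [|_] := eH (D2 g y) (D2 g y + 2 * b); first by move: b0; lra.
rewrite addrAC subrr add0r => H2.
have H3 : H (D2 f y) <= H (D2 g y) + L * (2 * b) by lra.
have := ler_wpM2l h0 H3; rewrite mulrDr => H4.
have -> : b * (2 * (h * L)) = h * (L * (2 * b)) by ring.
by have := fg y; lra.
Qed.

End C2_closure.

(** * Resolvent equations *)

Section Resolvent.
Variable R : realType.
Implicit Types f g p : R -> R.

Definition bcont g := continuous g /\ exists M : R, forall x, `|g x| <= M.

Lemma uniform_limit_cont g :
  (forall e : R, 0 < e -> exists2 w, continuous w & forall x, `|g x - w x| <= e) ->
  continuous g.
Proof.
move=> H x; apply/cvgrPdist_lt => e e0.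
have e4 : 0 < e / 4 by rewrite divr_gt0.
have [w cw wg] := H _ e4; have := cw x; move=> /cvgrPdist_lt /(_ _ e4).
apply: filterS => y wxy.
have -> : g x - g y = (g x - w x) + (w x - w y) - (g y - w y) by ring.
rewrite (le_lt_trans (ler_normB _ _))//.
have := ler_normD (g x - w x) (w x - w y); have := wg x; have := wg y; lra.
Qed.

(** The witness is the supremum of the lower bounds [a n x - e n x], which every [a m x + e m x]
    bounds from above; the explicit rate comes with it. *)
Lemma cauchy_envelope (T : Type) (a e : nat -> T -> R) :
  (forall n m x, `|a n x - a m x| <= e n x + e m x) ->
  exists v : T -> R, forall n x, `|v x - a n x| <= e n x.
Proof.
move=> H; exists (fun x => sup (range (fun n => a n x - e n x))) => n x.
set S := [set _ | _ in _]; have Sub m : ubound S (a m x + e m x).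
  move=> _ [k _ <-]; have := H k m x; rewrite ler_norml; lra.
have S0 : S !=set0 by exists (a 0 x - e 0 x); exists 0.
rewrite ler_norml; apply/andP; split.
- rewrite lerBrDl; apply: ub_le_sup; first by exists (a 0 x + e 0 x); exact: Sub.
  by exists n.
- by rewrite lerBlDl; apply: ge_sup => //; exact: Sub.
Qed.

Lemma expr_small (q c e : R) : 0 <= q < 1 -> 0 < e -> exists n, c * q ^+ n <= e.
Proof.
move=> /andP[q0 q1] e0.
have : (fun n => c * q ^+ n) @ \oo --> c * 0.
  by apply: cvgM; [exact: cvg_cst|apply: cvg_expr; rewrite ger0_norm].
rewrite mulr0 => /cvgr0Pnorm_le /(_ e e0) [n _ Hn]; exists n.
by apply: (le_trans (ler_norm _)); apply: Hn => /=.
Qed.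

(* With the substitution [s = expR (a y)] the solution
   [expR (- a x) * \int_(-oo)^x expR (a y) g y dy] becomes an integral of a
   bounded function over a bounded interval. *)
Lemma bounded_ode1 (a : R) g : 0 < a -> bcont g ->
  exists p, (forall x : R, is_derive x 1 p (- a * p x + g x)) /\
    exists M : R, forall x, `|p x| <= M.
Proof.
move=> a0 [cg [M gM]].
pose k (s : R) := g (a^-1 * ln s).
have M0 : 0 <= M by apply: le_trans (gM 0).
have mk : measurable_fun [set: R] k.
  apply: (measurableT_comp (f := g)); first exact: continuous_measurable_fun.
  by apply: measurable_funM => //; exact: measurable_ln.
have ik u : lebesgue_measure.-integrable [set` Interval (BLeft 0) (BRight u)] (EFin \o k).
  apply: measurable_bounded_integrable => //.
  - by rewrite /= lebesgue_measure_itv/=; case: ifP => // _; rewrite -EFinD ltry.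
  - exact: measurable_funS mk.
  - by exists M; split; [exact: num_real|move=> x Mx y _; exact: le_trans (gM _) (ltW Mx)].
pose P t := (\int[lebesgue_measure]_(s in [set` Interval (BLeft (0 : R)) (BRight t)]) k s)%R.
have dP (t : R) : 0 < t -> is_derive t 1 P (k t).
  move=> t0; have := @continuous_FTC1 R k (BLeft 0) t (t + 1).
  case; [by rewrite ltrDl|exact: ik|by have := ltW t0| |].
  - apply: (@cvg_comp _ _ _ (fun s => a^-1 * ln s) g); last exact: cg.
    by apply: cvgM; [exact: cvg_cst|exact: continuous_ln].
  - by rewrite derive1E => d <-; exact/derivableP.
have bP (t : R) : 0 <= t -> `|P t| <= M * t.
  move=> t0; apply: (le_trans (le_normr_Rintegral _ (ik t))) => //.
  apply: (@le_trans _ _ (\int[lebesgue_measure]_(s in [set` Interval (BLeft (0 : R)) (BRight t)]) M)%R).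
    apply: le_Rintegral => //.
    - by have := integrable_norm (ik t).
    - apply: measurable_bounded_integrable => //.
        by rewrite /= lebesgue_measure_itv/=; case: ifP => // _; rewrite -EFinD ltry.
      exact: bounded_cst.
    - by move=> x _; exact: gM.
  rewrite Rintegral_cst//= lebesgue_measure_itv/= lte_fin; case: ifPn => [|]; last by rewrite mulr0 => _; exact: mulr_ge0.
  by rewrite -EFinD/= subr0.
have dexp (c x : R) : is_derive x 1 (fun x => expR (c * x)) (c * expR (c * x)).
  have dc : is_derive x 1 (fun x : R => c * x) c.
    by have := @is_deriveZ _ _ _ id c x 1 1 (is_derive_id x 1); rewrite /GRing.scale/= mulr1.
  have := @is_derive1_comp R expR (fun x : R => c * x) x _ _ (is_derive_expR _) dc.
  by rewrite mulrC.
exists (fun x => a^-1 * (expR (- a * x) * P (expR (a * x)))); split; last first.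
  exists (a^-1 * M) => x.
  rewrite !normrM gtr0_norm ?invr_gt0// gtr0_norm ?expR_gt0//.
  rewrite ler_wpM2l ?invr_ge0 ?(ltW a0)//.
  apply: (le_trans (ler_wpM2l (ltW (expR_gt0 _)) (bP _ (ltW (expR_gt0 _))))).
  by rewrite mulrCA -expRD mulNr addNr expR0 mulr1.
move=> x.
have d1 : is_derive x 1 (fun x => P (expR (a * x))) (k (expR (a * x)) * (a * expR (a * x))).
  exact: (@is_derive1_comp R P (fun x : R => expR (a * x)) x _ _ (dP _ (expR_gt0 _)) (dexp a x)).
have := @is_deriveM _ _ _ _ x 1 _ _ (dexp (- a) x) d1.
move=> /(@is_deriveZ _ _ _ _ a^-1 x 1 _).
congr is_derive.
rewrite /k expRK /GRing.scale/= mulKf ?gt_eqF// mulNr expRN.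
have := expR_gt0 (a * x); set E := expR _ => E0.
by field; rewrite !gt_eqF.
Qed.

(** With [a] the square root of [l] and [d] the derivation, [l - d^2 = (a + d) (a - d)]. The first
    factor is inverted by [bounded_ode1]; the second becomes the first under the reflection
    [x -> - x]. *)
Lemma bounded_ode2 (l : R) g : 0 < l -> bcont g ->
  exists2 f, Cb2 f & forall x, l * f x - D2 f x = g x.
Proof.
move=> l0 bg; pose a := Num.sqrt l.
have a0 : 0 < a by rewrite sqrtr_gt0.
have al : a * a = l by rewrite -expr2 sqr_sqrtr// ltW.
have [p [dp [Mp bp]]] := bounded_ode1 a0 bg.
have dN (x : R) : is_derive x 1 (fun x : R => - x) (-1) by exact: is_deriveNid.
have [r [dr [Mr br]]] : exists p0, (forall x : R, is_derive x 1 p0 (- a * p0 x + p (- x))) /\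
    exists M : R, forall x, `|p0 x| <= M.
  apply: bounded_ode1 => //; split; last by exists Mp => x.
  move=> x; apply: (@cvg_comp _ _ _ (fun x : R => - x) p).
    exact: (is_derive_continuous dN).
  exact: (is_derive_continuous dp).
pose f x := r (- x).
have df (x : R) : is_derive x 1 f (a * f x - p x).
  have -> : a * f x - p x = (- a * r (- x) + p (- - x)) * -1 by rewrite opprK /f; ring.
  exact: (@is_derive1_comp R r (fun x : R => - x) x _ _ (dr _) (dN x)).
have df1 (x : R) : is_derive x 1 (fun x => a * f x - p x) (l * f x - g x).
  have -> : l * f x - g x = a *: (a * f x - p x) - (- a * p x + g x).
    by rewrite /GRing.scale/= -al; ring.
  apply: (@is_deriveB _ _ _ (fun x => a * f x) p x 1 _ _ _ (dp x)).
have [cg [M gM]] := bg.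
have C : C2 f (fun x => a * f x - p x) (fun x => l * f x - g x).
  split => [//|//|x]; apply: cvgB; last exact: cg.
  by apply: cvgM; [exact: cvg_cst|exact: (is_derive_continuous df)].
exists f; last by move=> x; have [_ ->] := C2D C; ring.
apply: (C2_Cb2 C (M := (1 + a + l) * `|Mr| + `|Mp| + `|M|)) => x.
have fb : `|f x| <= `|Mr| by apply: (le_trans (br _)); exact: ler_norm.
have pb : `|p x| <= `|Mp| by apply: (le_trans (bp _)); exact: ler_norm.
have gb : `|g x| <= `|M| by apply: (le_trans (gM _)); exact: ler_norm.
have := normr_ge0 Mr; have := normr_ge0 Mp; have := normr_ge0 M.
have afb : `|a * f x| <= a * `|Mr| by rewrite normrM gtr0_norm// ler_wpM2l// ltW.
have lfb : `|l * f x| <= l * `|Mr| by rewrite normrM gtr0_norm// ler_wpM2l// ltW.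
have := mulr_ge0 (ltW a0) (normr_ge0 Mr); have := mulr_ge0 (ltW l0) (normr_ge0 Mr).
have := ler_normB (a * f x) (p x); have := ler_normB (l * f x) (g x).
by move=> *; split; [|split]; lra.
Qed.

Lemma elliptic_id : elliptic (@id R) 1.
Proof. by move=> a b ab /=; split; lra. Qed.

(** Rewrite the equation as [l v - v'' = F v] with [F v = l v - K (v - psi)]. As the slopes of [K]
    lie in [[k, l]], [F] has Lipschitz constant [l - k] in the sup norm, whereas the inverse of
    [l - d^2] has norm [1 / l] by comparison: their composition contracts by [q = (l - k) / l]. *)
Lemma resolvent_exists (K : R -> R) (k l : R) (psi : R -> R) : 0 < k -> bcont psi ->
  (forall a b : R, a <= b -> k * (b - a) <= K b - K a /\ K b - K a <= l * (b - a)) ->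
  exists2 v, Cb2 v & forall x, D2 v x = K (v x - psi x).
Proof.
move=> k0 [cpsi [Mp psiM]] HK.
have kl : k <= l by have [] := HK 0 1 ler01; lra.
have l0 : 0 < l by exact: lt_le_trans kl.
pose q := (l - k) / l.
have q01 : 0 <= q < 1.
  by rewrite /q ltr_pdivrMr// mul1r divr_ge0 ?subr_ge0 ?(ltW l0)//= ltrBlDr ltrDl.
have [q0 q1] := andP q01.
have absK a b : `|K b - K a| <= l * `|b - a|.
  have [ab|/ltW ba] := leP a b.
    have [h1 h2] := HK _ _ ab.
    have h3 : 0 <= k * (b - a) by rewrite mulr_ge0 ?subr_ge0// ltW.
    by rewrite !ger0_norm ?subr_ge0//; lra.
  have [h1 h2] := HK _ _ ba.
  have h3 : 0 <= k * (a - b) by rewrite mulr_ge0 ?subr_ge0// ltW.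
  by rewrite distrC (distrC b) !ger0_norm ?subr_ge0//; lra.
have cK : continuous K.
  move=> x; apply/cvgrPdist_lt => e e0.
  near=> y; rewrite (le_lt_trans (absK _ _))// -ltr_pdivlMl// mulrC.
  by near: y; apply: cvgr_dist_lt => //; exact: divr_gt0.
pose F (w : R -> R) x := l * w x - K (w x - psi x).
have bF w : bcont w -> bcont (F w).
  move=> [cw [M wM]]; split.
    move=> x; apply: cvgB; first by apply: cvgM; [exact: cvg_cst|exact: cw].
    apply: (@cvg_comp _ _ _ (fun x => w x - psi x) K); last exact: cK.
    by apply: cvgB; [exact: cw|exact: cpsi].
  exists (l * M + (`|K 0| + l * (M + Mp))) => x.
  rewrite (le_trans (ler_normB _ _))// lerD//.
    by rewrite normrM gtr0_norm// ler_wpM2l// ltW.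
  have -> : K (w x - psi x) = K 0 + (K (w x - psi x) - K 0) by ring.
  rewrite (le_trans (ler_normD _ _))// lerD// (le_trans (absK _ _))// ler_wpM2l//.
    exact: ltW.
  by rewrite subr0 (le_trans (ler_normB _ _))// lerD.
have contrF (u w : R -> R) (c : R) : (forall x, `|u x - w x| <= c) -> forall x, `|F u x - F w x| <= l * q * c.
  move=> uw x; have lq : l * q = l - k by rewrite /q mulrC divfK// gt_eqF.
  have -> : F u x - F w x = l * (u x - w x) - (K (u x - psi x) - K (w x - psi x)) by rewrite /F; ring.
  have := uw x; rewrite lq.
  have key (a b : R) : a <= b -> b - a <= c ->
      `|l * (b - a) - (K (b - psi x) - K (a - psi x))| <= (l - k) * c.
    move=> ab bac; have [|h1 h2] := HK (a - psi x) (b - psi x); first by rewrite lerD2r.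
    have E : b - psi x - (a - psi x) = b - a by ring.
    rewrite E in h1 h2; rewrite ger0_norm; last lra.
    apply: (@le_trans _ _ ((l - k) * (b - a))); first lra.
    by rewrite ler_wpM2l// subr_ge0.
  have [ab|/ltW ba] := leP (w x) (u x); first by rewrite ger0_norm ?subr_ge0//; exact: key.
  rewrite distrC ger0_norm ?subr_ge0// => h.
  by rewrite -normrN; have := key _ _ ba h; congr (_ <= _); congr `|_|; ring.
(* [Gr] inverts [l - d^2] on bounded continuous data; elsewhere its value is arbitrary. *)
have /choice[Gr HGr] : forall g, exists f, bcont g ->
    Cb2 f /\ forall x, l * f x - D2 f x = g x.
  move=> g; have [bg|nbg] := pselect (bcont g); last by exists g.
  by have [f ? ?] := bounded_ode2 l0 bg; exists f.
have contrG (g1 g2 : R -> R) (c : R) : bcont g1 -> bcont g2 -> (forall x, g1 x <= g2 x + l * c) ->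
    forall x, Gr g1 x <= Gr g2 x + c.
  move=> /HGr[b1 E1] /HGr[b2 E2] gg.
  apply: (resolvent_le elliptic_id (h := l^-1)) => //; first by rewrite invr_ge0 ltW.
  move=> x; have E f : f x - l^-1 * D2 f x = l^-1 * (l * f x - D2 f x).
    by rewrite mulrBr mulKf// gt_eqF.
  by rewrite /= !E E1 E2 -(ler_pM2l l0) mulrDr !mulVKf ?gt_eqF.
have bG g : bcont g -> bcont (Gr g).
  move=> /HGr[b _]; split; first exact: Cb2_continuous.
  by have [M _ H] := Cb2_bound b; exists M => x; have [] := H x.
have contr (u w : R -> R) (c : R) : bcont u -> bcont w -> (forall x, `|u x - w x| <= c) ->
    forall x, `|Gr (F u) x - Gr (F w) x| <= q * c.
  move=> bu bw uw x; have Fuw := contrF _ _ _ uw.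
  have h1 : Gr (F u) x <= Gr (F w) x + q * c.
    by apply: contrG; [exact: bF|exact: bF|move=> y; have := Fuw y; rewrite ler_norml mulrA; lra].
  have h2 : Gr (F w) x <= Gr (F u) x + q * c.
    by apply: contrG; [exact: bF|exact: bF|move=> y; have := Fuw y; rewrite ler_norml mulrA; lra].
  by rewrite ler_norml; apply/andP; split; lra.
pose w n := iter n (fun u => Gr (F u)) (fun=> 0).
have bw n : bcont (w n).
  elim: n => [|n IH]; last exact/bG/bF.
  by split; [move=> x; exact: cvg_cst|exists 0 => x; rewrite normr0].
have [D w1D] : exists D, forall x, `|w 1%N x| <= D by have [] := bw 1%N.
have step n : forall x, `|w n.+1 x - w n x| <= D * q ^+ n.
  elim: n => [x|n IH x]; first by rewrite expr0 mulr1 subr0.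
  by rewrite exprS mulrCA; apply: (contr (w n.+1) (w n)).
pose e (n : nat) (x : R) := D / (1 - q) * q ^+ n.
have D0 : 0 <= D by apply: le_trans (w1D 0).
have e0 n x : 0 <= e n x by rewrite mulr_ge0 ?divr_ge0 ?subr_ge0 ?(ltW q1)// exprn_ge0.
(* The exact partial sum of the geometric series, with its factor [1 - q ^+ m], is what lets the
   induction close. *)
have tel n m x : `|w (n + m)%N x - w n x| <= e n x * (1 - q ^+ m).
  elim: m => [|m IH]; first by rewrite addn0 subrr normr0 expr0 subrr mulr0.
  have -> : w (n + m.+1)%N x - w n x = (w (n + m).+1 x - w (n + m)%N x) + (w (n + m)%N x - w n x).
    by rewrite addnS; ring.
  rewrite (le_trans (ler_normD _ _))//; have := step (n + m)%N x.
  have -> : D * q ^+ (n + m) = e n x * (1 - q ^+ m.+1) - e n x * (1 - q ^+ m).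
    by rewrite /e exprS exprD; field; rewrite gt_eqF// subr_gt0.
  by move: IH; lra.
have tel' n m x : (n <= m)%N -> `|w m x - w n x| <= e n x.
  move=> nm; rewrite -(subnKC nm); apply: (le_trans (tel _ _ _)).
  by rewrite ler_piMr// gerBl exprn_ge0.
have [v Hv] : exists v : R -> R, forall n x, `|v x - w n x| <= e n x.
  apply: cauchy_envelope => n m x; have [nm|/ltnW mn] := leqP n m.
    by rewrite distrC (le_trans (tel' _ _ _ nm))// lerDl.
  by rewrite (le_trans (tel' _ _ _ mn))// lerDr.
have small eps : 0 < eps -> exists n, forall x, e n x <= eps.
  by move=> /(expr_small (D / (1 - q)) q01)[n Hn]; exists n.
have bv : bcont v.
  split.
    apply: uniform_limit_cont => eps /small[n Hn]; exists (w n); first by case: (bw n).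
    by move=> x; exact: le_trans (Hv n x) (Hn x).
  by exists (e 0 0) => x; have := Hv 0 x; rewrite /w/= subr0.
have vE : v = Gr (F v).
  apply/funext => x; apply/eqP; rewrite -subr_eq0 -normr_le0; apply/ler_addgt0Pr => eps eps0.
  have eps2 : 0 < eps / 2 by rewrite divr_gt0.
  have [n Hn] := small _ eps2; rewrite add0r.
  have h1 := Hv n.+1 x.
  have h2 : `|Gr (F v) x - w n.+1 x| <= q * (eps / 2).
    by apply: (contr v (w n)) => // y; exact: le_trans (Hv n y) (Hn y).
  have h3 : e n.+1 x <= q * (eps / 2).
    by rewrite /e exprS mulrCA; apply: ler_wpM2l => //; exact: Hn.
  have h4 : q * (eps / 2) <= eps / 2 by apply: ler_piMl; lra.
  have -> : v x - Gr (F v) x = (v x - w n.+1 x) - (Gr (F v) x - w n.+1 x) by ring.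
  by rewrite (le_trans (ler_normB _ _))//; lra.
have [b E] := HGr _ (bF _ bv); rewrite -vE in b E.
by exists v => // x; have := E x; rewrite /F; lra.
Unshelve. all: by end_near. Qed.

End Resolvent.

(** * The implicit Euler scheme *)

Section Scheme.
Variable R : realType.

Lemma ler_eps (A B C : R) : (forall b : R, 0 < b -> A <= B + b * C) -> A <= B.
Proof.
move=> H; apply/ler_addgt0Pr => e e0.
have C1 : 0 < `|C| + 1 by rewrite ltr_wpDl.
apply: (le_trans (H (e / (`|C| + 1)) _)); first exact: divr_gt0.
rewrite lerD2l mulrAC ler_pdivrMr// ler_wpM2l ?(ltW e0)//.
by have := ler_norm C; lra.
Qed.

Variables (G : R -> R) (s1 s2 : R).
Hypothesis s1_ge0 : 0 <= s1.
Hypothesis s12 : s1 <= s2.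
Hypothesis GE : forall a, G a = Num.max (s1 * a) (s2 * a).

Lemma s2_ge0 : 0 <= s2. Proof. exact: le_trans s12. Qed.

Lemma G_pos a : 0 <= a -> G a = s2 * a.
Proof. by move=> a0; rewrite GE max_r// ler_wpM2r. Qed.

Lemma G_neg a : a <= 0 -> G a = s1 * a.
Proof. by move=> a0; rewrite GE max_l// ler_wnM2r. Qed.

Lemma G_elliptic : elliptic G s2.
Proof.
move=> a b ab; have h1 : s1 * (b - a) <= s2 * (b - a) by rewrite ler_wpM2r// subr_ge0.
have h0 : 0 <= s1 * (b - a) by rewrite mulr_ge0// subr_ge0.
have [a0|/ltW a0] := leP 0 a.
  have b0 : 0 <= b by exact: le_trans ab.
  by rewrite (G_pos a0) (G_pos b0); split; lra.
have h2 : s2 * a <= s1 * a by rewrite ler_wnM2r.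
have [b0|/ltW b0] := leP 0 b; rewrite (G_neg a0).
  have h3 : s1 * b <= s2 * b by rewrite ler_wpM2r.
  have h4 : 0 <= s1 * b by rewrite mulr_ge0.
  have h5 : 0 <= s1 * - a by rewrite mulr_ge0// oppr_ge0.
  by rewrite (G_pos b0); split; lra.
by rewrite (G_neg b0); split; lra.
Qed.

Lemma G_homog c a : 0 <= c -> G (c * a) = c * G a.
Proof. by move=> c0; rewrite !GE !(mulrCA _ c) maxr_pMr. Qed.

(** Solving for the second derivative gives [D2 v = K (v - psi)], where [K] is the inverse of
    [a -> h (G a + e a)]. The latter is the maximum of two lines, so [K] is the minimum of the lines
    with the inverse slopes; [e > 0] keeps these finite when [s1 = 0]. *)
Lemma euler_exists (h e : R) psi : 0 < h -> 0 < e -> bcont psi ->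
  exists2 v, Cb2 v & forall x, v x - h * (G (D2 v x) + e * D2 v x) = psi x.
Proof.
move=> h0 e0 bpsi.
have t1 : 0 < (s1 + e) * h by rewrite mulr_gt0// ltr_wpDl.
have t2 : 0 < (s2 + e) * h by rewrite mulr_gt0// ltr_wpDl ?s2_ge0.
set k := ((s2 + e) * h)^-1; set l := ((s1 + e) * h)^-1.
have k0 : 0 < k by rewrite invr_gt0.
have l0 : 0 < l by rewrite invr_gt0.
have kl : k <= l by rewrite lef_pV2 ?posrE// ler_wpM2r ?(ltW h0)// lerD2r.
pose K z := Num.min (l * z) (k * z).
have Kp z : 0 <= z -> K z = k * z by move=> z0; rewrite /K min_r// ler_wpM2r.
have Kn z : z <= 0 -> K z = l * z by move=> z0; rewrite /K min_l// ler_wnM2r.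
have [|v bv Ev] := @resolvent_exists R K k l psi k0 bpsi.
  move=> a b ab; have h1 : k * (b - a) <= l * (b - a) by rewrite ler_wpM2r// subr_ge0.
  have [a0|/ltW a0] := leP 0 a.
    have b0 : 0 <= b by exact: le_trans ab.
    by rewrite (Kp _ a0) (Kp _ b0); split; lra.
  have h2 : l * a <= k * a by rewrite ler_wnM2r.
  have [b0|/ltW b0] := leP 0 b; rewrite (Kn _ a0).
    have h3 : k * b <= l * b by rewrite ler_wpM2r.
    by rewrite (Kp _ b0); split; lra.
  by rewrite (Kn _ b0); split; lra.
exists v => // x; rewrite Ev.
have [z0|/ltW z0] := leP 0 (v x - psi x).
  rewrite (Kp _ z0) G_pos ?mulr_ge0 ?(ltW k0)// /k.
  by field; rewrite !gt_eqF// ltr_wpDl ?s2_ge0.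
rewrite (Kn _ z0) G_neg ?mulr_ge0_le0 ?(ltW l0)// /l.
by field; rewrite !gt_eqF// ltr_wpDl.
Qed.

Definition scheme (h e : R) (v : nat -> R -> R) :=
  [/\ 0 < h, 0 < e, forall k, Cb2 (v k) &
   forall k x, v k.+1 x - h * (G (D2 (v k.+1) x) + e * D2 (v k.+1) x) = v k x].

Lemma Cb2_bcont (f : R -> R) : Cb2 f -> bcont f.
Proof.
move=> bf; split; first exact: Cb2_continuous.
by have [M _ H] := Cb2_bound bf; exists M => x; have [] := H x.
Qed.

Lemma scheme_exists (h e : R) phi : 0 < h -> 0 < e -> Cb2 phi ->
  exists2 v, scheme h e v & v 0%N = phi.
Proof.
move=> h0 e0 bphi.
have /choice[J HJ] : forall psi : R -> R, exists v, bcont psi -> Cb2 v /\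
    forall x, v x - h * (G (D2 v x) + e * D2 v x) = psi x.
  move=> psi; have [b|n] := pselect (bcont psi); last by exists psi.
  by have [v ? ?] := euler_exists h0 e0 b; exists v.
have b k : Cb2 (iter k J phi).
  by elim: k => [//|k IH]; have [] := HJ _ (Cb2_bcont IH).
exists (fun k => iter k J phi) => //; split=> // k x.
by have [_] := HJ _ (Cb2_bcont (b k)); exact.
Qed.

Lemma Heps_elliptic (e : R) : 0 < e -> elliptic (fun a => G a + e * a) (s2 + e).
Proof.
move=> e0 a b ab; have [h1 h2] := G_elliptic ab.
have h3 : 0 <= e * (b - a) by rewrite mulr_ge0 ?subr_ge0// ltW.
by split; lra.
Qed.

Section OneScheme.
Variables (h e : R) (v : nat -> R -> R).
Hypothesis sv : scheme h e v.

Let h_gt0 : 0 < h. Proof. by case: sv. Qed.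
Let e_gt0 : 0 < e. Proof. by case: sv. Qed.
Let vb k : Cb2 (v k). Proof. by case: sv. Qed.
Let vE k x : v k.+1 x - h * (G (D2 (v k.+1) x) + e * D2 (v k.+1) x) = v k x.
Proof. by case: sv. Qed.

Lemma scheme_comparison k w c : Cb2 w ->
  (forall x, v k x <= w x - h * (G (D2 w x) + e * D2 w x) + c) ->
  forall x, v k.+1 x <= w x + c.
Proof.
move=> bw H; refine (resolvent_le (Heps_elliptic e_gt0) (ltW h_gt0) (vb k.+1) bw _) => x.
by rewrite /= vE; exact: H.
Qed.

Lemma scheme_comparison_ge k w c : Cb2 w ->
  (forall x, w x - h * (G (D2 w x) + e * D2 w x) <= v k x + c) ->
  forall x, w x <= v k.+1 x + c.
Proof.
move=> bw H; refine (resolvent_le (Heps_elliptic e_gt0) (ltW h_gt0) bw (vb k.+1) _) => x.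
by rewrite /= vE; exact: H.
Qed.

Section Bounds.
Variable M : R.
Hypothesis vM : forall x, `|D2 (v 0%N) x| <= M.

Let M_ge0 : 0 <= M. Proof. exact: le_trans (vM 0). Qed.

(** The first increment is bounded by comparing [v 1] with [v 0] plus a constant. Since constants
    pass through the equation, comparison transfers a bound on one increment to the next. *)
Let Ub : forall k x, v k.+1 x - v k x <= h * ((s2 + e) * M).
Proof.
elim=> [|k IH] x; rewrite lerBlDl; apply: scheme_comparison => // y.
  rewrite -addrA lerDl addrC subr_ge0 ler_wpM2l ?(ltW h_gt0)//.
  have /ler_normlP[_ D] := vM y; have [+ _] := Heps_elliptic e_gt0 D.
  by rewrite /= (G_pos M_ge0) mulrDl; lra.
by rewrite vE -lerBlDl; exact: IH.
Qed.

Let Lb : forall k x, - (h * ((s1 + e) * M)) <= v k.+1 x - v k x.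
Proof.
elim=> [|k IH] x; rewrite lerNl opprB lerBlDl; apply: scheme_comparison_ge => // y.
  rewrite lerD2l lerNl -mulrN ler_wpM2l ?(ltW h_gt0)//.
  have /ler_normlP[D _] := vM y; rewrite lerNl in D.
  have nM : - M <= 0 by rewrite oppr_le0.
  have [+ _] := Heps_elliptic e_gt0 D.
  by rewrite /= (G_neg nM) mulrDl; lra.
by rewrite vE; have := IH y; lra.
Qed.

(** An increment equals [h (G a + e a)] with [a] the second derivative of the later step. The bounds
    [Ub] and [Lb] carry the slopes [s2 + e] and [s1 + e] that [G + e] has on the two half-lines, so
    inverting it returns exactly [M], with no loss in [k]. *)
Lemma scheme_D2 k x : `|D2 (v k) x| <= M.
Proof.
case: k => [//|k]; have := vE k x; have := Ub k x; have := Lb k x.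
set a := D2 _ x => u1 u2 E.
have lo : - ((s1 + e) * M) <= G a + e * a.
  by rewrite -(ler_pM2l h_gt0) mulrN; lra.
have up : G a + e * a <= (s2 + e) * M by rewrite -(ler_pM2l h_gt0); lra.
rewrite ler_norml; apply/andP; split.
- have [a0|/ltW a0] := leP 0 a; first by rewrite (le_trans _ a0)// oppr_le0.
  by move: lo; rewrite (G_neg a0) -mulrDl -mulrN ler_pM2l// ltr_wpDl.
- have [a0|/ltW a0] := leP 0 a; last by rewrite (le_trans a0).
  by move: up; rewrite (G_pos a0) -mulrDl ler_pM2l// ltr_wpDl ?s2_ge0.
Qed.

Lemma scheme_increment k x : `|v k.+1 x - v k x| <= h * ((s2 + e) * M).
Proof.
have := Ub k x; have := Lb k x; have : h * ((s1 + e) * M) <= h * ((s2 + e) * M).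
  by rewrite ler_wpM2l ?(ltW h_gt0)// ler_wpM2r// lerD2r.
by move=> *; rewrite ler_norml; apply/andP; split; lra.
Qed.

Lemma scheme_drift k x : `|v k x - v 0%N x| <= k%:R * h * ((s2 + e) * M).
Proof.
elim: k => [|k IH]; first by rewrite subrr normr0 !mul0r.
have -> : v k.+1 x - v 0%N x = (v k.+1 x - v k x) + (v k x - v 0%N x) by ring.
rewrite (le_trans (ler_normD _ _))//; have := scheme_increment k x.
have -> : k.+1%:R * h * ((s2 + e) * M) = k%:R * h * ((s2 + e) * M) + h * ((s2 + e) * M).
  by rewrite -natr1; ring.
by move: IH; lra.
Qed.

End Bounds.

(** The scheme commutes with translations, so comparison applies to [v k] and its translate by [d],
    shifted by the constant [L * |d|]. *)
Lemma scheme_lipschitz L : (forall x y, `|v 0%N x - v 0%N y| <= L * `|x - y|) ->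
  forall k x y, `|v k x - v k y| <= L * `|x - y|.
Proof.
move=> L0; have main k : forall d x, v k (x + d) <= v k x + L * `|d|.
  elim: k => [|k IH] d.
    by move=> x; have /ler_normlP[_] := L0 (x + d) x; rewrite addrAC subrr add0r; lra.
  have [b _ E] := Cb2_aff 1 d (vb k.+1).
  have E1 x : 1 * x + d = x + d by rewrite mul1r.
  move=> x; rewrite -(E1 x).
  apply: (@scheme_comparison_ge k (fun x => v k.+1 (1 * x + d))) => // y.
  by rewrite E /= expr1n !mul1r vE; exact: IH.
move=> k x y; rewrite ler_norml; apply/andP; split.
  have := main k (y - x) x; rewrite distrC addrC subrK; lra.
have := main k (x - y) y; rewrite addrC subrK; lra.
Qed.

End OneScheme.

Lemma scheme_step_lt h e v h' e' w k j (x : R) (b : R) :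
  scheme h e v -> scheme h' e' w -> 0 < b -> exists y,
  v k.+1 x - w j.+1 x <= v k.+1 y - w j.+1 y /\
  D2 (v k.+1) y <= D2 (w j.+1) y + 2 * b.
Proof.
move=> [_ _ vb _] [_ _ wb _] b0; have [bF DF] := Cb2_sub (vb k.+1) (wb j.+1).
have [y ymax yD] := coercive_max x bF b0; exists y; split.
  have := ymax x; rewrite subrr expr0n/= mulr0 subr0 => /le_trans; apply.
  by rewrite gerBl mulr_ge0 ?sqr_ge0// ltW.
by move: yD; rewrite DF; lra.
Qed.

(* The squared time lag is compensated exactly: the right-hand side [Q]
   satisfies [(h + h') Q k.+1 j.+1 = h' Q k j.+1 + h Q k.+1 j] (Crandall-Liggett). *)
Lemma two_schemes h e v h' e' w (M M' c C eta : R) :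
  scheme h e v -> scheme h' e' w ->
  (forall x, `|D2 (v 0%N) x| <= M) -> (forall x, `|D2 (w 0%N) x| <= M') ->
  (forall k x, v k x <= w 0%N x + c + C * (k%:R * h)) ->
  (forall j x, v 0%N x <= w j x + c + C * (j%:R * h')) -> 0 < eta ->
  forall k j x, v k x <= w j x + c + eta +
    C ^+ 2 / (4 * eta) * ((k%:R * h - j%:R * h') ^+ 2 + k%:R * h ^+ 2 + j%:R * h' ^+ 2)
    + k%:R * h * (e * M) + j%:R * h' * (e' * M').
Proof.
move=> sv sw vM wM H0 H1 eta0.
have [h0 e0 vb vE] := sv; have [h'0 e'0 wb wE] := sw.
set B := C ^+ 2 / (4 * eta).
have B0 : 0 <= B by rewrite divr_ge0 ?sqr_ge0// mulr_ge0// ltW.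
have M0 : 0 <= M by exact: le_trans (vM 0).
have M'0 : 0 <= M' by exact: le_trans (wM 0).
(* Young's inequality turns the linear time modulus [C t] into the quadratic one carried through the
   induction. *)
have amgm t : C * t <= eta + B * t ^+ 2.
  have E : (C * t - 2 * eta) ^+ 2 / (4 * eta) = eta + B * t ^+ 2 - C * t.
    by rewrite /B; field; rewrite gt_eqF.
  by rewrite -subr_ge0 -E divr_ge0 ?sqr_ge0// mulr_ge0// ltW.
have pos (n : nat) (a b : R) : 0 < a -> 0 < b -> 0 <= n%:R * a * b.
  by move=> a0 b0; rewrite !mulr_ge0 ?(ltW a0) ?(ltW b0).
have pos0 (n : nat) (a b : R) : 0 < a -> 0 <= b -> 0 <= n%:R * a * b.
  by move=> a0 b0; rewrite !mulr_ge0 ?(ltW a0).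
have eM : 0 <= e * M by rewrite mulr_ge0// ltW.
have eM' : 0 <= e' * M' by rewrite mulr_ge0// ltW.
elim=> [|k IHk].
  move=> j x; have := H1 j x; have := amgm (j%:R * h').
  have := pos0 j _ _ h'0 eM'; have := pos0 j _ _ h'0 (ltW h'0).
  move=> p1 p2; rewrite !mul0r sub0r sqrrN !addr0.
  have := mulr_ge0 B0 p1; rewrite -mulrA -expr2; lra.
elim=> [|j IHj] x.
  have := H0 k.+1 x; have := amgm (k.+1%:R * h).
  have := pos0 k.+1 _ _ h0 eM; have := pos0 k.+1 _ _ h0 (ltW h0).
  move=> p1 p2; rewrite !mul0r subr0 !addr0.
  have := mulr_ge0 B0 p1; rewrite -mulrA -expr2; lra.
set Q := (X in _ <= X).
apply: (@ler_eps _ _ (2 * s2 * h)) => b b0.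
have [y [xy Dy]] := @scheme_step_lt h e v h' e' w k j x b sv sw b0.
have hh : 0 < h + h' by exact: addr_gt0.
pose S := Q - w j.+1 x.
(* The two equations are combined with weights [h'] and [h], so that both diffusion terms get the
   common factor [h * h']; what remains are the induction hypotheses for [(k, j.+1)] and
   [(k.+1, j)]. *)
suff main : (h + h') * (v k.+1 y - w j.+1 y) <= (h + h') * (S + b * (2 * s2 * h)).
  by move: main; rewrite ler_pM2l// /S; lra.
have E1 := vE k y; have E2 := wE j y.
have /ler_normlP[_ P1] := scheme_D2 sv vM k.+1 y.
have /ler_normlP[P2 _] := scheme_D2 sw wM j.+1 y.
have I1 := ler_wpM2l (ltW h'0) (IHk j.+1 y); have I2 := ler_wpM2l (ltW h0) (IHj y).
have [G1 _] := G_elliptic Dy.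
have [|_ G2] := @G_elliptic (D2 (w j.+1) y) (D2 (w j.+1) y + 2 * b); first by lra.
rewrite {}/S {}/Q -(natr1 k) -(natr1 j) in I1 I2 *.
move: E1 E2 P1 P2 G1 G2 I1 I2; set p := D2 (v k.+1) y; set q := D2 (w j.+1) y.
move: (G p) (G q) (G (q + 2 * b)) => gp gq gqb E1 E2 P1 P2 G1 G2 I1 I2.
have hh'0 : 0 <= h * h' by rewrite mulr_ge0// ltW.
have F1 := ler_wpM2l (mulr_ge0 hh'0 (ltW e0)) P1.
have F2 := ler_wpM2l (mulr_ge0 hh'0 (ltW e'0)) P2.
have F3 : h * h' * (gp - gq) <= h * h' * (s2 * (2 * b)) by apply: ler_wpM2l => //; lra.
have F4 : 0 <= h * h * (s2 * b).
  by rewrite mulr_ge0 ?mulr_ge0 ?s2_ge0// ltW.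
have E1' : h' * v k.+1 y - h' * v k y = h * h' * (gp + e * p) by rewrite -E1; ring.
have E2' : h * w j.+1 y - h * w j y = h * h' * (gq + e' * q) by rewrite -E2; ring.
clear -I1 I2 F1 F2 F3 F4 E1' E2'; clearbody B.
move: (v k.+1 y) (w j.+1 y) (v k y) (w j y) (k%:R) (j%:R) I1 I2 E1' E2' => a a' b1 b2 K J I1 I2 E1' E2'.
nra.
Qed.

(** Diffusing for a time [r ^+ 2] moves an [L]-Lipschitz function by O(r). The penalty
    [(y - x)^2 / r] bounds the second derivative by [2 / r] at the maximum, and also absorbs the
    displacement [L |y - x|] up to [r L^2]. *)
Lemma euler_bump (f psi : R -> R) (r e L : R) x : 0 < r -> 0 < e -> Cb2 f ->
  (forall y, f y <= psi y + r ^+ 2 * ((s2 + e) * Num.max (D2 f y) 0)) ->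
  (forall x y, `|psi x - psi y| <= L * `|x - y|) ->
  f x <= psi x + r * (L ^+ 2 + 2 * (s2 + e)).
Proof.
move=> r0 e0 bf fE psiL; have b0 : 0 < r^-1 by rewrite invr_gt0.
have [y ymax yD] := coercive_max x bf b0.
have := ymax x; rewrite subrr expr0n/= mulr0 subr0 => fx.
have se : 0 < s2 + e by rewrite ltr_wpDl ?s2_ge0.
have m0 : Num.max (D2 f y) 0 <= 2 * r^-1 by rewrite ge_max yD mulr_ge0// ltW.
have h1 := fE y; have /ler_normlP[_ h2] := psiL y x.
have h3 : r ^+ 2 * ((s2 + e) * Num.max (D2 f y) 0) <= r * (2 * (s2 + e)).
  have -> : r * (2 * (s2 + e)) = r ^+ 2 * ((s2 + e) * (2 * r^-1)).
    by field; rewrite gt_eqF.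
  by rewrite ler_wpM2l ?sqr_ge0// ler_wpM2l// ltW.
have h4 : L * `|y - x| <= r * L ^+ 2 + r^-1 * (y - x) ^+ 2.
  rewrite -(real_normK (num_real (y - x))); set d := `|_|.
  have E : (r * L - d / 2) ^+ 2 / r + (3 / 4) * (d ^+ 2 / r) = r * L ^+ 2 + r^-1 * d ^+ 2 - L * d.
    by field; rewrite gt_eqF.
  have p1 : 0 <= (r * L - d / 2) ^+ 2 / r by rewrite divr_ge0 ?sqr_ge0// ltW.
  have p2 : 0 <= d ^+ 2 / r by rewrite divr_ge0 ?sqr_ge0// ltW.
  by lra.
by move: fx h1 h2 h3 h4; rewrite mulrDr; lra.
Qed.

(** The approximation is one implicit step from [phi] with time step [r ^+ 2] and [e = 1]. The
    equation bounds [r ^+ 2 * |D2 f|] by [|f - phi|], which is O(r); this is why the second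
    derivative costs only [1 / r]. *)
Lemma CbLip_approx (phi : R -> R) (L r : R) : (exists M : R, forall x, `|phi x| <= M) ->
  (forall x y, `|phi x - phi y| <= L * `|x - y|) -> 0 < r ->
  exists f, [/\ Cb2 f, forall x, `|f x - phi x| <= r * (L ^+ 2 + 2 * (s2 + 1)),
    forall x, `|D2 f x| <= (L ^+ 2 + 2 * (s2 + 1)) / r &
    forall x y, `|f x - f y| <= L * `|x - y|].
Proof.
move=> bphi phiL r0.
have cphi : bcont phi.
  split=> // x; apply/cvgrPdist_lt => e e0.
  near=> y; apply: (le_lt_trans (phiL x y)).
  apply: (@le_lt_trans _ _ ((`|L| + 1) * `|x - y|)).
    by rewrite ler_wpM2r// ler_wpDr// ler_norm.
  rewrite -ltr_pdivlMl ?ltr_wpDl// mulrC; near: y; apply: cvgr_dist_lt => //.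
  by rewrite divr_gt0// ltr_wpDl.
have r20 : 0 < r ^+ 2 by rewrite exprn_gt0.
have [f bf fE] := euler_exists r20 ltr01 cphi.
have G0 a : G a + 1 * a <= (s2 + 1) * Num.max a 0 /\ (- (G a + 1 * a) <= (s2 + 1) * Num.max (- a) 0)
    /\ `|a| <= `|G a + 1 * a|.
  rewrite mul1r; have s20 := s2_ge0; have [a0|/ltW a0] := leP 0 a.
    rewrite (G_pos a0); have p : 0 <= s2 * a by exact: mulr_ge0.
    have -> : Num.max (- a) 0 = 0 by apply: max_r; rewrite oppr_le0.
    by rewrite mulr0 !ger0_norm ?addr_ge0//; split; [|split]; lra.
  rewrite (G_neg a0); have p : s1 * a <= 0 by exact: mulr_ge0_le0.
  have p2 : s2 * a <= s1 * a by rewrite ler_wnM2r.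
  have -> : Num.max (- a) 0 = - a by apply: max_l; rewrite oppr_ge0.
  rewrite mulr0 !ler0_norm//; last lra.
  by split; [|split]; lra.
have up x : f x <= phi x + r * (L ^+ 2 + 2 * (s2 + 1)).
  apply: euler_bump => // y; rewrite -(fE y) -addrA lerDl addrC subr_ge0.
  by rewrite ler_wpM2l ?(ltW r20)//; have [] := G0 (D2 f y).
have lo x : - f x <= - phi x + r * (L ^+ 2 + 2 * (s2 + 1)).
  have [bN EN] := Cb2_sub (Cb2_cst (0 : R)).1 bf.
  rewrite -(sub0r (f x)).
  apply: (@euler_bump (fun x => 0 - f x) (fun x => - phi x)) => // [y|y z]; last first.
    by rewrite -opprD normrN; exact: phiL.
  rewrite EN (Cb2_cst (0:R)).2 /= !sub0r -(fE y).
  have [_ [g _]] := G0 (D2 f y).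
  by have := ler_wpM2l (ltW r20) g; rewrite mulrN; lra.
have near x : `|f x - phi x| <= r * (L ^+ 2 + 2 * (s2 + 1)).
  by have := up x; have := lo x; rewrite ler_norml => *; apply/andP; split; lra.
exists f; split=> //.
  move=> x; have [_ [_ g]] := G0 (D2 f x); apply: (le_trans g).
  rewrite -(ler_pM2l r20) -[X in X * `|_|]gtr0_norm// -normrM.
  have -> : r ^+ 2 * (G (D2 f x) + 1 * D2 f x) = f x - phi x by rewrite -(fE x); ring.
  have -> : r ^+ 2 * ((L ^+ 2 + 2 * (s2 + 1)) / r) = r * (L ^+ 2 + 2 * (s2 + 1)).
    by field; rewrite gt_eqF.
  exact: near.
have main d x : f (x + d) <= f x + L * `|d|.
  have [b _ E] := Cb2_aff 1 d bf.
  have E1 z : 1 * z + d = z + d by rewrite mul1r.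
  rewrite -(E1 x).
  refine (resolvent_le (Heps_elliptic ltr01) (ltW r20) b bf _ x) => y.
  rewrite E /= expr1n !mul1r; have := fE (y + d); have := fE y; rewrite !mul1r => -> ->.
  by have /ler_normlP[_] := phiL (y + d) y; rewrite addrAC subrr add0r; lra.
move=> x y; rewrite ler_norml; apply/andP; split.
  have := main (y - x) x; rewrite distrC addrC subrK; lra.
have := main (x - y) y; rewrite addrC subrK; lra.
Unshelve. all: by end_near. Qed.

End Scheme.

(** * Viscosity solutions *)

Section Viscosity.
Variable R : realType.
Implicit Types (H G : R -> R) (u psi : R -> R -> R).

Definition visc_sub H u := forall psi (t x : R), 0 < t -> C12 psi ->
  loc_max_at (fun s y => u s y - psi s y) t x ->
  dt psi t x - H (dx (dx psi) t x) <= 0.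

Definition visc_sup H u := forall psi (t x : R), 0 < t -> C12 psi ->
  loc_max_at (fun s y => psi s y - u s y) t x ->
  dt psi t x - H (dx (dx psi) t x) >= 0.

Definition tcont u :=
  {within [set p : R * R | 0 <= p.1], continuous (fun p : R * R => u p.1 p.2)}.

Definition tbounded u := exists M : R, forall t x : R, 0 <= t -> `|u t x| <= M.

Lemma C12_separable (a a1 a2 q q1 q2 : R -> R) : C2 a a1 a2 -> C2 q q1 q2 ->
  let psi t x := a x + q t in
  [/\ C12 psi, dt psi = (fun t _ => q1 t) & dx (dx psi) = (fun _ x => a2 x)].
Proof.
move=> [da da1 ca2] [dq dq1 cq2] psi.
have d1 (t x : R) : is_derive t 1 (fun s => psi s x) (q1 t).
  by rewrite -[q1 t]add0r; exact: (@is_deriveD _ _ _ (cst (a x)) q t 1 0 (q1 t)).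
have d2 (t x : R) : is_derive x 1 (psi t) (a1 x).
  by rewrite -[a1 x]addr0; exact: (@is_deriveD _ _ _ a (cst (q t)) x 1 (a1 x) 0).
have Et : dt psi = fun t _ => q1 t.
  by apply/funext => t; apply/funext => x; rewrite /dt derive1E; apply: derive_val.
have Ex : dx psi = fun _ x => a1 x.
  by apply/funext => t; apply: is_derive1E.
have Exx : dx (dx psi) = fun _ x => a2 x.
  by rewrite Ex; apply/funext => t; apply: is_derive1E.
have c1 (f : R -> R) : continuous f -> continuous (fun p : R * R => f p.1).
  by move=> cf p; apply: (@cvg_comp _ _ _ fst f); [exact: cvg_fst|exact: cf].
have c2 (f : R -> R) : continuous f -> continuous (fun p : R * R => f p.2).
  by move=> cf p; apply: (@cvg_comp _ _ _ snd f); [exact: cvg_snd|exact: cf].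
split; [|exact: Et|exact: Exx].
split; [|split; [|split; [|split; [|split; [|split]]]]].
- by move=> t x; have [] := d1 t x.
- by move=> t x; have [] := d2 t x.
- by move=> t x; rewrite Ex; have [] := da1 x.
- move=> p; apply: cvgD; first exact/c2/(is_derive_continuous da).
  exact/c1/(is_derive_continuous dq).
- by rewrite Et; exact/c1/(is_derive_continuous dq1).
- by rewrite Ex; exact/c2/(is_derive_continuous da1).
- by rewrite Exx; exact: c2.
Qed.

Lemma C12N psi : C12 psi -> let psi' t x := - psi t x in
  [/\ C12 psi', dt psi' = (fun t x => - dt psi t x) &
      dx (dx psi') = (fun t x => - dx (dx psi) t x)].
Proof.
move=> [h1 [h2 [h3 [h4 [h5 [h6 h7]]]]]] psi'.
have dN (f : R -> R) (x : R) : derivable f x 1 -> is_derive x 1 (fun y => - f y) (- derive1 f x).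
  by move=> df; apply: (is_deriveN (derivable_is_derive df)).
have Et : dt psi' = fun t x => - dt psi t x.
  apply/funext => t; apply/funext => x; rewrite /dt derive1E.
  by apply: derive_val; exact: dN.
have Ex : dx psi' = fun t x => - dx psi t x.
  by apply/funext => t; apply: is_derive1E => x; exact: dN.
have Exx : dx (dx psi') = fun t x => - dx (dx psi) t x.
  by rewrite Ex; apply/funext => t; apply: is_derive1E => x; exact: dN.
split; [|exact: Et|exact: Exx].
split; [|split; [|split; [|split; [|split; [|split]]]]].
- by move=> t x; have [] := dN _ _ (h1 t x).
- by move=> t x; have [] := dN _ _ (h2 t x).
- by move=> t x; rewrite Ex; have [] := dN _ _ (h3 t x).
- by move=> p; apply: cvgN; exact: h4.
- by rewrite Et => p; apply: cvgN; exact: h5.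
- by rewrite Ex => p; apply: cvgN; exact: h6.
- by rewrite Exx => p; apply: cvgN; exact: h7.
Qed.

(** Supersolutions are always handled through this reflection. It replaces the convex [G] by a
    concave nonlinearity, which is why the lemmas on viscosity solutions take a general elliptic
    [H]. *)
Lemma visc_sup_opp H u : visc_sup H u ->
  visc_sub (fun a => - H (- a)) (fun t x => - u t x).
Proof.
move=> vs psi t x t0 Cpsi [r r0 mx]; have [CN Et Exx] := C12N Cpsi.
have := vs _ t x t0 CN; rewrite Et Exx.
suff lm : loc_max_at (fun s y => - psi s y - u s y) t x by move=> /(_ lm); lra.
by exists r => // s y s0 st yx; have := mx s y s0 st yx; rewrite /=; lra.
Qed.

(** The terms [d x^2] and [q t] grow, so if [u] exceeded the barrier somewhere the excess would have
    a global maximum in a compact box. The initial ordering excludes time [0]; at a positive time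
    the barrier is an admissible test function, and the subsolution inequality contradicts [strict],
    which is asked only where [u] lies above the barrier. *)
Lemma visc_comparison H u f (q q1 q2 : R -> R) (d m : R) :
  tcont u -> tbounded u -> visc_sub H u -> Cb2 f -> C2 q q1 q2 -> 0 < d ->
  (forall t : R, 0 <= t -> m <= q t) ->
  (forall B, exists T, forall t, T <= t -> B <= q t) ->
  (forall x, u 0 x <= f x + d * x ^+ 2 + q 0) ->
  (forall t x : R, 0 < t -> f x + d * x ^+ 2 + q t < u t x ->
     H (D2 f x + 2 * d) < q1 t) ->
  forall t x : R, 0 <= t -> u t x <= f x + d * x ^+ 2 + q t.
Proof.
move=> cu [M uM] su bf Cq d0 qm qoo u0 strict t x t0.
rewrite leNgt; apply/negP => gu.
have [N N0 fN] := Cb2_bound bf.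
have fb y : `|f y| <= N by have [] := fN y.
pose a y := f y + d * y ^+ 2.
have Ca : C2 a (fun y => D1 f y + d * (2 * (y - 0))) (fun y => D2 f y + d * 2).
  have := C2_add (Cb2D bf) (C2_scale d (C2_sqr 0)).
  by congr C2; apply/funext => y; rewrite subr0.
have [C12psi Et Exx] := C12_separable Ca Cq.
set psi := (fun _ _ => _) in C12psi Et Exx.
have [T HT] := qoo (M + N).
(* Outside [[0, T'] x [- A, A]] either [q] exceeds [M + N], or [d * y ^+ 2] makes up for
   [M + N + |m|]; in both cases the excess is nonpositive. *)
pose T' := Num.max T t; pose A := 1 + `|x| + (M + N + `|m|) / d.
have M0 : 0 <= M by apply: le_trans (uM 0 0 (lexx _)).
have q0 : 0 <= (M + N + `|m|) / d by rewrite divr_ge0 ?(ltW d0)// !addr_ge0// ltW.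
have A1 : 1 <= A by rewrite /A -addrA lerDl addr_ge0.
have xA : `|x| <= A by rewrite /A; lra.
have far s y : 0 <= s -> ~~ ((s \in `[0, T']) && (y \in `[- A, A])) -> u s y - psi s y <= 0.
  move=> s0; rewrite !in_itv/= s0/= negb_and -!ltNge -ler_norml -ltNge => H'.
  have /ler_normlP[_ us] := uM s y s0; have /ler_normlP[fs _] := fb y.
  have dy : 0 <= d * y ^+ 2 by rewrite mulr_ge0 ?sqr_ge0// ltW.
  rewrite /psi /a; move/orP: H' => [sT|yA].
    have := HT s; rewrite (le_trans _ (ltW sT)) ?le_max ?lexx// => /(_ isT); lra.
  have y1 : A <= y ^+ 2.
    rewrite -(real_normK (num_real y)) expr2; apply: (le_trans (ltW yA)).
    by apply: ler_peMl => //; apply: (le_trans A1); exact: ltW.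
  have : M + N + `|m| <= d * y ^+ 2.
    apply: (@le_trans _ _ (d * A)); last by rewrite ler_wpM2l// ltW.
    rewrite /A !mulrDr mulr1 mulrCA divff ?gt_eqF// mulr1 lerDr addr_ge0 ?(ltW d0)//.
    by rewrite mulr_ge0// ltW.
  have := qm s s0; have := ler_normr m m; rewrite lexx/=; have := ler_norm (- m); rewrite normrN; lra.
pose K : set (R * R) := `[0, T']%classic `*` `[- A, A]%classic.
have tK : K (t, x).
  by split; rewrite /= in_itv/= ?t0 ?le_max ?lexx ?orbT// -ler_norml.
have [|||[t1 x1] K1 mx] := @compact_EVT_max (R * R)%type R (fun p => u p.1 p.2 - psi p.1 p.2) K.
- by exists (t, x).
- by apply: compact_setX; exact: segment_compact.
- have KW : K `<=` [set p : R * R | 0 <= p.1].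
    by move=> [s y] [/= + _]; rewrite in_itv/= => /andP[].
  have := continuous_subspaceW KW cu => cuK.
  have [_ [_ [_ [cpsi _]]]] := C12psi.
  have cpK : {within K, continuous (fun p : R * R => psi p.1 p.2)}.
    by apply: continuous_subspaceT; exact: cpsi.
  by move=> p; apply: cvgB; [exact: cuK|exact: cpK].
have val1 : 0 < u t1 x1 - psi t1 x1.
  have := mx (t, x); rewrite inE => /(_ tK) /=; apply: lt_le_trans.
  by rewrite subr_gt0 /psi /a.
rewrite inE in K1; have [/= t1K x1K] := K1.
have t10 : 0 <= t1 by move: t1K; rewrite in_itv/= => /andP[].
have t1_gt0 : 0 < t1.
  rewrite lt_neqAle t10 andbT; apply/eqP => E; move: val1; rewrite -E.
  by have := u0 x1; rewrite /psi /a; lra.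
have lm : loc_max_at (fun s y => u s y - psi s y) t1 x1.
  exists 1 => // s y s0 _ _.
  have [inK|nK] := boolP ((s \in `[0, T']) && (y \in `[- A, A])).
    have /andP[sK yK] := inK; have := mx (s, y); rewrite inE; apply.
    by split.
  exact: (le_trans (far _ _ (ltW s0) nK) (ltW val1)).
have := su _ _ _ t1_gt0 C12psi lm; rewrite Et Exx.
have := strict t1 x1 t1_gt0; rewrite (mulrC d 2).
have lt1 : f x1 + d * x1 ^+ 2 + q t1 < u t1 x1 by move: val1; rewrite subr_gt0 /psi /a.
by move=> /(_ lt1); lra.
Qed.

Lemma linear_C2 (c b : R) : C2 (fun t => c + b * t) (fun=> b) (fun=> 0).
Proof.
split; last by move=> x; exact: cvg_cst.
- move=> t; have -> : b = 0 + b *: 1 by rewrite /GRing.scale/= mulr1 add0r.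
  rewrite {1}/GRing.scale /= mulr1 add0r.
  apply: (@is_deriveD _ _ _ (cst c) (fun t => b * t) t 1 0 (b *: 1)).
- by move=> t; exact: is_derive_cst.
Qed.

Lemma visc_drift H L u f (c C : R) : elliptic H L -> 0 <= C ->
  tcont u -> tbounded u -> visc_sub H u -> Cb2 f ->
  (forall x, u 0 x <= f x + c) -> (forall x, H (D2 f x) <= C) ->
  forall t x : R, 0 <= t -> u t x <= f x + c + C * t.
Proof.
move=> eH C0 cu bu su bf u0 HC t x t0.
have L0 : 0 <= L by have [] := eH 0 1 ler01; lra.
apply: (@ler_eps _ _ _ (x ^+ 2 + (2 * L + 1) * t)) => d d0.
(* In this time slope [2 * L * d] pays for the second derivative of [d x^2], and the additional [d]
   makes the inequality strict. *)
have K0 : 0 < C + d * (2 * L + 1) by rewrite ltr_wpDl// mulr_gt0//; lra.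
have := @visc_comparison H u f _ _ _ d c cu bu su bf (linear_C2 c (C + d * (2 * L + 1))) d0.
move=> /(_ _ _ _ _ t x t0) h.
have : u t x <= f x + d * x ^+ 2 + (c + (C + d * (2 * L + 1)) * t); last by lra.
apply: h.
- by move=> s s0; rewrite lerDl mulr_ge0// ltW.
- move=> B; exists ((B - c) / (C + d * (2 * L + 1))) => s.
  by rewrite ler_pdivrMr// mulrC; lra.
- move=> y; rewrite mulr0 addr0; have := u0 y.
  by have : 0 <= d * y ^+ 2; [rewrite mulr_ge0 ?sqr_ge0// ltW|lra].
- move=> s y s0 _; have [|_ h1] := eH (D2 f y) (D2 f y + 2 * d); first by lra.
  by have := HC y; lra.
Qed.

Lemma quad_C2 (c b a : R) : C2 (fun t => c + b * (t - a) ^+ 2) (fun t => b * (2 * (t - a))) (fun=> b * 2).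
Proof.
have := C2_add (C2_cst c) (C2_scale b (C2_sqr a)); congr C2; apply/funext => t.
  by rewrite add0r.
by rewrite add0r.
Qed.

(* Doubling the time variable only: [v k] is smooth in space, hence a
   legitimate test function.  [P k t = (t - k h)^2 + k h^2] satisfies
   [P k = P k.+1 + h P' k.+1]. *)
Lemma visc_sub_scheme H L u (v : nat -> R -> R) (h E c C eta : R) : elliptic H L ->
  tcont u -> tbounded u -> visc_sub H u -> (forall k, Cb2 (v k)) -> 0 < h ->
  (forall k x, v k x + h * H (D2 (v k.+1) x) <= v k.+1 x + h * E) ->
  (forall t x : R, 0 <= t -> u t x <= v 0%N x + c + C * t) ->
  (forall k x, v 0%N x <= v k x + C * (k%:R * h)) -> 0 < C -> 0 < eta -> 0 <= E ->
  forall k (t x : R), 0 <= t -> u t x <= v k x + c + eta +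
    C ^+ 2 / (4 * eta) * ((t - k%:R * h) ^+ 2 + k%:R * h ^+ 2) + k%:R * h * E.
Proof.
move=> eH cu bu su bv h0 vE ub vb C0 eta0 E0.
have L0 : 0 <= L by have [] := eH 0 1 ler01; lra.
set B := C ^+ 2 / (4 * eta).
have B0 : 0 < B by rewrite divr_gt0 ?exprn_gt0// mulr_gt0.
have amgm s : C * s <= eta + B * s ^+ 2.
  have E1 : (C * s - 2 * eta) ^+ 2 / (4 * eta) = eta + B * s ^+ 2 - C * s.
    by rewrite /B; field; rewrite gt_eqF.
  by rewrite -subr_ge0 -E1 divr_ge0 ?sqr_ge0// mulr_ge0// ltW.
clearbody B.
elim=> [|k IH] t x t0.
  rewrite !mul0r subr0 !addr0; have := ub t x t0; have := amgm t; lra.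
set Q := (X in _ <= X).
apply: (@ler_eps _ _ _ (x ^+ 2 + 2 * L * h)) => d d0.
pose K := k.+1%:R * h; have K0 : 0 <= K by rewrite mulr_ge0// ltW.
have KE : K = k%:R * h + h by rewrite /K -natr1; ring.
(* The last term pays, over one time step, for the effect of the penalty [d x^2] on [H]; it
   disappears with [d]. *)
pose cc := c + eta + B * (k.+1%:R * h ^+ 2) + K * E + d * (2 * L * h).
have kh2 : 0 <= k.+1%:R * h ^+ 2 by rewrite mulr_ge0 ?sqr_ge0.
have := @visc_comparison H u (v k.+1) _ _ _ d cc cu bu su (bv _) (quad_C2 cc B K) d0.
move=> /(_ _ _ _ _ t x t0) hh.
suff : u t x <= v k.+1 x + d * x ^+ 2 + (cc + B * (t - K) ^+ 2).
  by rewrite /Q /cc -/K; lra.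
apply: hh.
- by move=> s _; rewrite lerDl mulr_ge0 ?sqr_ge0// ltW.
- move=> b; exists (K + 1 + `|b - cc| / B) => s sT.
  have p : 0 <= `|b - cc| / B by rewrite divr_ge0// ltW.
  have s1 : `|b - cc| / B <= (s - K) ^+ 2.
    apply: (@le_trans _ _ (s - K)); first lra.
    by rewrite expr2 ler_peMl//; lra.
  rewrite -lerBlDl; apply: (le_trans (ler_norm _)).
  by rewrite -ler_pdivrMl// mulrC.
- move=> y; have := ub 0 y (lexx _); have := vb k.+1 y; rewrite -/K sub0r sqrrN.
  have := amgm K; have := mulr_ge0 (ltW B0) kh2; have := mulr_ge0 K0 E0.
  have : 0 <= d * y ^+ 2 by rewrite mulr_ge0 ?sqr_ge0// ltW.
  have : 0 <= d * (2 * L * h) by rewrite !mulr_ge0 ?(ltW d0) ?(ltW h0).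
  by rewrite /cc; lra.
- move=> s y s0 gu; have := IH s y (ltW s0); have := vE k y.
  have [|_ h1] := eH (D2 (v k.+1) y) (D2 (v k.+1) y + 2 * d); first by lra.
  move: gu h1; rewrite /cc KE.
  have -> : k.+1%:R * h ^+ 2 = k%:R * h ^+ 2 + h ^+ 2 by rewrite -natr1; ring.
  move: (H _) (H _) => p q; clear -h0 d0.
  move=> gu h1 h2 h3.
  have dy : 0 <= d * y ^+ 2 by rewrite mulr_ge0 ?sqr_ge0// ltW.
  have h1' := ler_wpM2l (ltW h0) h1.
  rewrite -(ltr_pM2l h0).
  have dh : 0 < d * h by exact: mulr_gt0.
  nra.
Qed.

Definition visc_sol G phi u :=
  [/\ tcont u, tbounded u, forall x, u 0 x = phi x, visc_sub G u & visc_sup G u].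

Lemma elliptic_opp H L : elliptic H L -> elliptic (fun a => - H (- a)) L.
Proof.
move=> eH a b ab; have ab' : - b <= - a by rewrite lerN2.
by have [] := eH _ _ ab'; split; lra.
Qed.

Lemma Cb2N (f : R -> R) : Cb2 f -> Cb2 (fun x => - f x) /\ D2 (fun x => - f x) = (fun x => - D2 f x).
Proof.
move=> bf; have [a b] := Cb2_sub (Cb2_cst (0 : R)).1 bf.
have E (g : R -> R) : (fun x : R => 0 - g x) = (fun x => - g x).
  by apply/funext => x; rewrite sub0r.
by rewrite (Cb2_cst (0:R)).2 !E in a b.
Qed.

Lemma tcontN u : tcont u -> tcont (fun t x => - u t x).
Proof. by move=> cu p; apply: cvgN; exact: cu. Qed.

Lemma tboundedN u : tbounded u -> tbounded (fun t x => - u t x).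
Proof. by move=> [M uM]; exists M => t x t0; rewrite normrN; exact: uM. Qed.

Section SchemeVisc.
Variables (G : R -> R) (s1 s2 : R).
Hypothesis s1_ge0 : 0 <= s1.
Hypothesis s12 : s1 <= s2.
Hypothesis GE : forall a, G a = Num.max (s1 * a) (s2 * a).

(** The term [e * D2 (v k)] is moved to the error, at most [e * M] per unit of time. Both
    inequalities come from [visc_sub_scheme], applied to [G] and to its reflection. *)
Lemma scheme_visc phi u (h e : R) v (M c C eta : R) :
  visc_sol G phi u -> scheme G h e v -> (forall x, `|D2 (v 0%N) x| <= M) ->
  (forall x, `|phi x - v 0%N x| <= c) -> (s2 + e) * M <= C -> 0 < C -> 0 < eta ->
  forall k (t x : R), 0 <= t -> `|u t x - v k x| <= c + eta +
    C ^+ 2 / (4 * eta) * ((t - k%:R * h) ^+ 2 + k%:R * h ^+ 2) + k%:R * h * (e * M).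
Proof.
move=> [cu bu u0 su pu] sv vM pv MC C0 eta0 k t x t0.
have [h0 e0 vb vE] := sv; have eG := G_elliptic s1_ge0 s12 GE.
have M0 : 0 <= M by apply: le_trans (vM 0).
have eM : 0 <= e * M by rewrite mulr_ge0// ltW.
have kh0 n : 0 <= n%:R * h by rewrite mulr_ge0// ltW.
have drift n y : `|v n y - v 0%N y| <= C * (n%:R * h).
  apply: (le_trans (scheme_drift s1_ge0 s12 GE sv vM n y)).
  by rewrite mulrC ler_wpM2r.
have GC y : `|G (D2 (v 0%N) y)| <= C.
  have /ler_normlP[l1 l2] := vM y.
  have sM : 0 <= (s2 - s1) * M by rewrite mulr_ge0// subr_ge0.
  have [] := eG _ _ l2; rewrite (G_pos s12 GE M0).
  have nM : - M <= D2 (v 0%N) y by lra.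
  have nM0 : - M <= 0 by rewrite oppr_le0.
  have [] := eG _ _ nM; rewrite (G_neg s12 GE nM0) => *.
  by rewrite ler_norml; apply/andP; split; lra.
have eD n y : `|e * D2 (v n) y| <= e * M.
  by rewrite normrM gtr0_norm// ler_wpM2l ?(ltW e0)//; exact: (scheme_D2 s1_ge0 s12 GE sv vM).
have up : u t x <= v k x + c + eta +
    C ^+ 2 / (4 * eta) * ((t - k%:R * h) ^+ 2 + k%:R * h ^+ 2) + k%:R * h * (e * M).
  apply: (@visc_sub_scheme G s2) => //.
  - move=> n y; rewrite -(vE n y) mulrDr.
    by have /ler_normlP[q0 q1] := eD n.+1 y; have := ler_wpM2l (ltW h0) q0; have := ler_wpM2l (ltW h0) q1; lra.
  - apply: (@visc_drift G s2) => //; first exact: ltW.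
      by move=> y; rewrite u0; have /ler_normlP[_] := pv y; lra.
    by move=> y; have /ler_normlP[_] := GC y.
  - by move=> n y; have /ler_normlP[+ _] := drift n y; lra.
have lo : - u t x <= - v k x + c + eta +
    C ^+ 2 / (4 * eta) * ((t - k%:R * h) ^+ 2 + k%:R * h ^+ 2) + k%:R * h * (e * M).
  have eH := elliptic_opp eG; have cN := tcontN cu; have bN := tboundedN bu.
  have sN := visc_sup_opp pu; have vN n := (Cb2N (vb n)).1.
  refine (visc_sub_scheme eH cN bN sN vN h0 _ _ _ C0 eta0 eM k x t0).
  - move=> n y; rewrite (Cb2N (vb n.+1)).2 opprK -(vE n y) mulrDr.
    by have /ler_normlP[q0 q1] := eD n.+1 y; have := ler_wpM2l (ltW h0) q0; have := ler_wpM2l (ltW h0) q1; lra.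
  - refine (visc_drift eH (ltW C0) cN bN sN (vN 0%N) _ _).
    + by move=> y; rewrite u0; have /ler_normlP[+ _] := pv y; lra.
    + by move=> y; rewrite (Cb2N (vb 0%N)).2 opprK; have /ler_normlP[] := GC y.
  - by move=> n y; have /ler_normlP[_ +] := drift n y; lra.
by rewrite ler_norml; apply/andP; split; lra.
Qed.

End SchemeVisc.

End Viscosity.

(** * Stability of viscosity inequalities and existence of solutions *)

Section Stability.
Variable R : realType.

Lemma nat_argmax (P : nat -> Prop) (g : nat -> R) (n k0 : nat) : P k0 ->
  (forall k, P k -> (k < n)%N) -> exists2 k1, P k1 & forall k, P k -> g k <= g k1.
Proof.
elim: n P k0 => [|n IH] P k0 Pk0 Pn; first by have := Pn _ Pk0.
have [Pnn|nP] := pselect (P n); last first.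
  apply: (IH P k0 Pk0) => k Pk; have := Pn k Pk; rewrite ltnS leq_eqVlt.
  by case/orP => // /eqP E; move: Pk; rewrite E.
have [E|k0n] := pselect (forall k, P k -> k = n).
  by exists n => // k /E ->.
have [k Pk kn] : exists2 k, P k & k <> n.
  apply: contrapT => H; apply: k0n => k Pk; apply: contrapT => kn.
  by apply: H; exists k.
have [||k1 [Pk1 _] mx] := IH (fun k => P k /\ (k < n)%N) k.
- split=> //; have := Pn k Pk; rewrite ltnS leq_eqVlt => /orP[/eqP E|//].
  by case: kn.
- by move=> ? [].
have [le|lt] := leP (g n) (g k1).
- exists k1 => // j Pj; have := Pn j Pj; rewrite ltnS leq_eqVlt => /orP[/eqP ->//|jn].
  exact: mx.
- exists n => // j Pj; have := Pn j Pj; rewrite ltnS leq_eqVlt => /orP[/eqP ->//|jn].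
  by apply: le_trans (ltW lt); exact: mx.
Qed.

Lemma continuous2_ball (f : R * R -> R) (t x e : R) : continuous f -> 0 < e ->
  exists2 d : R, 0 < d & forall s y : R, `|s - t| < d -> `|y - x| < d -> `|f (s, y) - f (t, x)| < e.
Proof.
move=> cf e0; have /cvgrPdist_lt /(_ e e0) := cf (t, x).
move=> /nbhs_ballP[d /= d0 Hd]; exists d => // s y st yx.
by rewrite distrC; apply: (Hd (s, y)); split; rewrite /ball/= distrC.
Qed.

Lemma truncn_bounds (t h : R) : 0 <= t -> 0 < h ->
  let k := Num.truncn (t / h) in k%:R * h <= t /\ t < k%:R * h + h.
Proof.
move=> t0 h0 k; have th : 0 <= t / h by rewrite divr_ge0// ltW.
have /andP[a b] := truncn_itv th.
rewrite -ler_pdivlMr//; split=> //.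
have : t < k.+1%:R * h by rewrite -ltr_pdivrMr.
by rewrite -natr1 mulrDl mul1r.
Qed.

(* Barles-Souganidis: the maximum of [v - psi - th * (quadratic)] over a small
   box is attained near [(t0, x0)], where the scheme is compared with [psi]. *)
Lemma scheme_touching (H : R -> R) L (u psi pt px pxx : R -> R -> R) (t0 x0 : R) :
  elliptic H L -> continuous (fun p : R * R => u p.1 p.2) ->
  (forall T e : R, 0 < e -> exists (h : R) v, [/\ 0 < h <= e, forall k : nat, Cb2 (v k),
    forall k x, v k.+1 x <= v k x + h * H (D2 (v k.+1) x) + h * e &
    forall k x, k%:R * h <= T -> `|u (k%:R * h) x - v k x| <= e]) ->
  (forall t x : R, is_derive t 1 (fun s => psi s x) (pt t x)) ->
  (forall t x : R, is_derive x 1 (psi t) (px t x)) ->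
  (forall t x : R, is_derive x 1 (px t) (pxx t x)) ->
  continuous (fun p : R * R => psi p.1 p.2) ->
  continuous (fun p : R * R => pt p.1 p.2) ->
  continuous (fun p : R * R => pxx p.1 p.2) ->
  0 < t0 -> loc_max_at (fun s y => u s y - psi s y) t0 x0 ->
  pt t0 x0 - H (pxx t0 x0) <= 0.
Proof.
move=> eH cu approx hd1 hd2 hd3 cpsi ct cxx t0_gt0 [r r0 mx].
have L0 : 0 <= L by have [] := eH 0 1 ler01; lra.
rewrite leNgt; apply/negP; set P : R := _ - _ => P0.
have PE : P = pt t0 x0 - H (pxx t0 x0) by [].
have L4 : 0 < 2 * (4 + 3 * L) by lra.
(* The errors of the final inequality add up to at most [th * (3 + 3 * L)], which is less than
   [P]. *)
pose th : R := P / (2 * (4 + 3 * L)); have th0 : 0 < th by exact: divr_gt0.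
have thE : th * (2 * (4 + 3 * L)) = P by rewrite /th divfK// gt_eqF.
clearbody th P.
have [d1 d10 Hd1] := continuous2_ball t0 x0 ct th0.
have [d2 d20 Hd2] := continuous2_ball t0 x0 cxx th0.
pose rho : R := Num.min (Num.min (Num.min d1 d2) (Num.min r t0)) 1 / 2.
have m0 : 0 < Num.min (Num.min (Num.min d1 d2) (Num.min r t0)) 1.
  by rewrite !lt_min d10 d20 r0 t0_gt0 ltr01.
have rho0 : 0 < rho by exact: divr_gt0.
have rho_le : 2 * rho <= d1 /\ 2 * rho <= d2 /\ 2 * rho <= r /\ 2 * rho <= t0 /\ 2 * rho <= 1.
  have -> : 2 * rho = Num.min (Num.min (Num.min d1 d2) (Num.min r t0)) 1 by rewrite /rho; field.
  by rewrite !ge_min !lexx !orbT/=.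
have [r1 [r2 [r3 [r4 r5]]]] := rho_le; clear rho_le m0; clearbody rho.
(* Two errors of the scheme and one of continuity, each at most [e'], together with the grid error
   [th * rho ^+ 2 / 16], give [th * (rho / 2) ^+ 2]: the maximum lies in the half-size box. *)
pose e' : R := th * rho ^+ 2 / 16.
have e'E : e' = th * rho ^+ 2 / 16 by [].
have e'0 : 0 < e' by rewrite divr_gt0// mulr_gt0// exprn_gt0.
clearbody e'.
have cup : continuous (fun p : R * R => u p.1 p.2 - psi p.1 p.2).
  by move=> p; apply: cvgB; [exact: cu|exact: cpsi].
have [d3 d30 Hd3] := continuous2_ball t0 x0 cup e'0.
pose e : R := Num.min (Num.min e' th) (Num.min (rho / 4) (d3 / 2)).
have e0 : 0 < e by rewrite !lt_min e'0 th0 !divr_gt0.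
have [e1 [e2 [e3 e4]]] : e <= e' /\ e <= th /\ e <= rho / 4 /\ e <= d3 / 2.
  by rewrite /e !ge_min !lexx !orbT.
clearbody e.
have [h [v [/andP[h0 he] bv vE uv]]] := approx (t0 + rho) e e0.
pose tk k : R := k%:R * h.
have tk0 : tk 0%N = 0 by rewrite /tk mul0r.
have tkS k : tk k.+1 = tk k + h by rewrite /tk -natr1 mulrDl mul1r.
have tkgrid t : 0 <= t -> exists k, tk k <= t /\ t < tk k + h.
  by move=> ht; exists (Num.truncn (t / h)); exact: truncn_bounds.
have tkbound T : exists K, forall k, tk k <= T -> (k < K)%N.
  exists (Num.truncn (T / h)).+1 => k; rewrite /tk -ler_pdivlMr// => kT.
  by rewrite -(ltr_nat R) (le_lt_trans kT)// truncnS_gt.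
have {}uv k x : tk k <= t0 + rho -> `|u (tk k) x - v k x| <= e by exact: uv.
clearbody tk.
pose F k y := v k y - psi (tk k) y - th * ((tk k - t0) ^+ 2 + (y - x0) ^+ 2).
pose inK (k : nat) := `|tk k - t0| <= rho.
have dF k (y : R) : is_derive y 1 (F k) (D1 (v k) y - px (tk k) y - th * (2 * (y - x0))).
  have h1 := is_deriveB (let: And3 a _ _ := Cb2D (bv k) in a y) (hd2 (tk k) y).
  have [h2 _ _] := C2_scale th (C2_add (C2_cst ((tk k - t0) ^+ 2)) (C2_sqr x0)).
  have := is_deriveB h1 (h2 y); rewrite add0r; exact.
have dF1 k (y : R) : is_derive y 1 (fun y => D1 (v k) y - px (tk k) y - th * (2 * (y - x0)))
     (D2 (v k) y - pxx (tk k) y - th * 2).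
  have h1 := is_deriveB (let: And3 _ a _ := Cb2D (bv k) in a y) (hd3 (tk k) y).
  have [_ h2 _] := C2_scale th (C2_sqr x0).
  exact: is_deriveB h1 (h2 y).
have maxx k : exists2 y, `|y - x0| <= rho & forall z, `|z - x0| <= rho -> F k z <= F k y.
  have [||y yin ymx] := @EVT_max R (F k) (x0 - rho) (x0 + rho).
  - by lra.
  - by apply: continuous_subspaceT; exact: (is_derive_continuous (dF k)).
  have E z : (z \in `[x0 - rho, x0 + rho]) = (`|z - x0| <= rho).
    by rewrite in_itv/= ler_distl.
  by rewrite E in yin; exists y => // z zin; apply: ymx; rewrite E.
have /choice[g Hg] : forall k, exists y, `|y - x0| <= rho /\ forall z, `|z - x0| <= rho -> F k z <= F k y.
  by move=> k; have [y ? ?] := maxx k; exists y.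
have [k0 [a b]] := tkgrid _ (ltW t0_gt0).
have k0K : `|tk k0 - t0| <= h by rewrite ler_norml; apply/andP; split; clear -a b h0; lra.
have Pk0 : inK k0 by rewrite /inK (le_trans k0K)//; clear -he e3 rho0; lra.
have [k1 Pk1 k1max] : exists2 k1, inK k1 & forall k, inK k -> F k (g k) <= F k1 (g k1).
  have [K HK] := tkbound (t0 + rho).
  apply: (@nat_argmax inK (fun k => F k (g k)) K k0 Pk0) => k.
  by rewrite /inK => /ler_normlP[_ kk]; apply: HK; clear -kk; lra.
set x1 := g k1 in k1max; have [x1rho x1max] := Hg k1; rewrite -/x1 in x1rho x1max; clearbody x1.
pose t1 : R := tk k1; have t1rho : `|t1 - t0| <= rho by [].
have /ler_normlP[t1a t1b] := t1rho.
have t1_gt0 : 0 < t1 by clear -t1a r4 rho0; lra.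
have Fle : F k0 x0 <= F k1 x1.
  apply: (le_trans _ (k1max k0 Pk0)); have [_] := Hg k0; apply.
  by rewrite subrr normr0 ltW.
have sqle (c1 c2 : R) : 0 <= c1 -> c1 <= c2 -> c1 ^+ 2 <= c2 ^+ 2.
  by move=> c10 c12; rewrite lerXn2r ?nnegrE// (le_trans c10).
have h2 : h ^+ 2 <= rho ^+ 2 / 16.
  have -> : rho ^+ 2 / 16 = (rho / 4) ^+ 2 by field.
  by apply: sqle; clear -h0 he e3; lra.
have uk0 : `|u (tk k0) x0 - v k0 x0| <= e by apply: uv; clear -a rho0; lra.
have uk1 : `|u t1 x1 - v k1 x1| <= e by apply: uv; rewrite -/t1; clear -t1b; lra.
have near0 : `|u (tk k0) x0 - psi (tk k0) x0 - (u t0 x0 - psi t0 x0)| < e'.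
  apply: (Hd3 (tk k0) x0); last by rewrite subrr normr0.
  by rewrite (le_lt_trans k0K)//; clear -he e4 d30; lra.
have max1 : u t1 x1 - psi t1 x1 <= u t0 x0 - psi t0 x0.
  have rr : rho < r by clear -r3 rho0; lra.
  by apply: mx; [exact: t1_gt0|exact: le_lt_trans rr|exact: le_lt_trans rr].
have Dle : (t1 - t0) ^+ 2 + (x1 - x0) ^+ 2 <= (rho / 2) ^+ 2.
  rewrite -(ler_pM2l th0); move: Fle; rewrite /F subrr expr0n/= addr0 -/t1.
  have k0h2 : th * (tk k0 - t0) ^+ 2 <= th * (rho ^+ 2 / 16).
    rewrite ler_wpM2l ?(ltW th0)//; apply: le_trans h2.
    by rewrite -(real_normK (num_real (_ - t0))); exact: sqle.
  have -> : (rho / 2) ^+ 2 = rho ^+ 2 / 4 by field.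
  have thr : 0 <= th * rho ^+ 2 by rewrite mulr_ge0 ?sqr_ge0// ltW.
  move/ltr_normlP: near0 => [n1 n2]; move/ler_normlP: uk0 => [n3 n4].
  move/ler_normlP: uk1 => [n5 n6]; move: e1 k0h2 thr n1 n2 n3 n4 n5 n6 max1.
  by rewrite e'E; clear; lra.
have sq0 (z : R) : 0 <= z ^+ 2 by exact: sqr_ge0.
have half (z : R) : z ^+ 2 <= (rho / 2) ^+ 2 -> `|z| <= rho / 2.
  by rewrite -(real_normK (num_real z)) ler_pXn2r// ?nnegrE ?normr_ge0 ?divr_ge0 ?(ltW rho0).
have t1h : `|t1 - t0| <= rho / 2 by apply: half; have := sq0 (x1 - x0); clear -Dle; lra.
have x1h : `|x1 - x0| <= rho / 2 by apply: half; have := sq0 (t1 - t0); clear -Dle; lra.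
have /ler_normlP[t1c t1d] := t1h.
(* As [t1 > 0], the maximising index has a predecessor; lying in the half-size box keeps that
   predecessor inside the full box, where maximality applies to it. *)
case: k1 @t1 Pk1 k1max x1rho x1max uk1 Fle max1 Dle t1rho t1_gt0 t1a t1b t1h x1h t1c t1d
  => [|k'] t1 Pk1 k1max x1rho x1max uk1 Fle max1 Dle t1rho t1_gt0 t1a t1b t1h x1h t1c t1d.
  by move: t1_gt0; rewrite /t1 tk0 ltxx.
have t1E : t1 = tk k' + h by exact: tkS.
have Pk' : inK k' by rewrite /inK ler_norml; apply/andP; split; clear -t1E t1c t1d he e3 h0 rho0; lra.
have F' : F k' x1 <= F k'.+1 x1.
  by apply: (le_trans _ (k1max k' Pk')); have [_] := Hg k'; apply.
have [xi [xid psiE]] := mvt (tk k') t1 (fun s => hd1 s x1).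
have xit : `|xi - t0| < d1.
  move: xid; rewrite {1}t1E addrAC subrr add0r (gtr0_norm h0) => /ler_normlP[q1 q2].
  by rewrite ltr_norml; apply/andP; split; clear -q1 q2 t1E t1c t1d he e3 h0 rho0 r1; lra.
have xd (d : R) : 2 * rho <= d -> `|x1 - x0| < d by move=> rd; rewrite (le_lt_trans x1rho)//; clear -rd rho0; lra.
have /ltr_normlP[dt1 dt2] := Hd1 xi x1 xit (xd _ r1).
have t1d2 : `|t1 - t0| < d2 by rewrite (le_lt_trans t1rho)//; clear -r2 rho0; lra.
have /ltr_normlP[dx1 dx2] := Hd2 t1 x1 t1d2 (xd _ r2).
have sec : D2 (v k'.+1) x1 - pxx t1 x1 - th * 2 <= 0.
  have rho2 : 0 < rho / 2 by exact: divr_gt0.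
  refine (max_second_derivative rho2 (dF k'.+1) (dF1 k'.+1 x1) _) => y /ltr_normlP[y1 y2].
  apply: x1max; move/ler_normlP: x1h => [q1 q2].
  by rewrite ler_norml; apply/andP; split; clear -y1 y2 q1 q2; lra.
have Hle : H (D2 (v k'.+1) x1) <= H (pxx t0 x0) + L * (3 * th).
  have le3 : D2 (v k'.+1) x1 <= pxx t0 x0 + 3 * th by move: sec dx1 dx2 => /=; clear; lra.
  have [q1 _] := eH _ _ le3.
  have [|_] := eH (pxx t0 x0) (pxx t0 x0 + 3 * th); first by clear -th0; lra.
  by rewrite addrAC subrr add0r; clear -q1; lra.
have vle := vE k' x1.
have psi1 : psi t1 x1 - psi (tk k') x1 = pt xi x1 * h.
  by rewrite psiE t1E addrAC subrr add0r.
move: F'; rewrite /F -/t1 => F'.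
have low : h * (pt t0 x0 - th) - th * (2 * rho * h) <= h * H (D2 (v k'.+1) x1) + h * e.
  have q1 : h * (pt t0 x0 - th) <= pt xi x1 * h.
    by rewrite mulrC ler_wpM2r ?(ltW h0)//; move: dt1 dt2 => /=; clear; lra.
  have q2 : th * ((tk k' - t0) ^+ 2 - (t1 - t0) ^+ 2) <= th * (2 * rho * h).
    rewrite ler_wpM2l ?(ltW th0)//.
    have -> : (tk k' - t0) ^+ 2 - (t1 - t0) ^+ 2 = (h - 2 * (t1 - t0)) * h by rewrite t1E; ring.
    by rewrite ler_wpM2r ?(ltW h0)//; move: t1c t1d e3 he h0 rho0; clear; lra.
  by move: q1 q2 F' vle psi1; clear; lra.
have fin : h * (pt t0 x0 - th - th * (2 * rho)) <= h * (H (pxx t0 x0) + L * (3 * th) + th).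
  have q1 := ler_wpM2l (ltW h0) Hle; have q2 := ler_wpM2l (ltW h0) e2.
  by move: low q1 q2; clear; lra.
move: fin; rewrite ler_pM2l// => fin.
have rth : th * (2 * rho) <= th * 1 by rewrite ler_wpM2l// ltW.
have Lth : 0 <= th * L by rewrite mulr_ge0// ltW.
by move: thE fin rth Lth th0; rewrite PE; clear; lra.
Qed.

Lemma limit_visc_sub (H : R -> R) L (u : R -> R -> R) : elliptic H L ->
  continuous (fun p : R * R => u p.1 p.2) ->
  (forall T e : R, 0 < e -> exists (h : R) v, [/\ 0 < h <= e, forall k : nat, Cb2 (v k),
    forall k x, v k.+1 x <= v k x + h * H (D2 (v k.+1) x) + h * e &
    forall k x, k%:R * h <= T -> `|u (k%:R * h) x - v k x| <= e]) ->
  visc_sub H u.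
Proof.
move=> eH cu approx psi t0 x0 t0_gt0 [hd1 [hd2 [hd3 [cpsi [ct [_ cxx]]]]]].
exact: (@scheme_touching H L u psi (dt psi) (dx psi) (dx (dx psi)) t0 x0 eH cu approx
  (fun t x => derivable_is_derive (hd1 t x)) (fun t x => derivable_is_derive (hd2 t x))
  (fun t x => derivable_is_derive (hd3 t x)) cpsi ct cxx t0_gt0).
Qed.

Lemma visc_sub_opp (H : R -> R) (u : R -> R -> R) :
  visc_sub (fun a => - H (- a)) (fun t x => - u t x) -> visc_sup H u.
Proof.
move=> vs psi t x t0 Cpsi [r r0 mx]; have [CN Et Exx] := C12N Cpsi.
have := vs _ t x t0 CN; rewrite Et Exx !opprK.
suff lm : loc_max_at (fun s y => - u s y - - psi s y) t x by move=> /(_ lm); lra.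
by exists r => // s y s0 st yx; have := mx s y s0 st yx; rewrite /=; lra.
Qed.

Lemma inv_nat_small (e : R) : 0 < e -> exists n : nat, n.+1%:R^-1 <= e.
Proof.
move=> e0; exists (Num.truncn e^-1); rewrite invf_ple ?posrE// ?ltr0n//.
by rewrite ltW// truncnS_gt.
Qed.

(** With [C = C0 / a] and [eta = a] the coefficient [C^2 / (4 eta)] is of order [a^-3], and the time
    errors are of order [a^5]: the product [a^2] is below [a]. *)
Lemma gap_arith (D C0 t K J a b : R) : 0 < D -> 0 < C0 -> 0 <= t ->
  0 < a -> 0 < b -> a <= 1 -> b <= a -> 0 <= K -> 0 <= J ->
  K * a ^+ 5 <= t -> t < K * a ^+ 5 + a ^+ 5 ->
  J * b ^+ 5 <= t -> t < J * b ^+ 5 + b ^+ 5 ->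
  2 * D * a + a + (C0 / a) ^+ 2 / (4 * a) * ((K * a ^+ 5 - J * b ^+ 5) ^+ 2
    + K * (a ^+ 5) ^+ 2 + J * (b ^+ 5) ^+ 2)
    + K * a ^+ 5 * (a ^+ 2 * (D / a)) + J * b ^+ 5 * (b ^+ 2 * (D / b)) <=
  (4 * D + 1 + C0 ^+ 2) * (1 + t) * a.
Proof.
move=> D0 C00 t0 a0 b0 a1 ba K0 J0 k1 k2 j1 j2; pose C := C0 / a; rewrite -/C.
have b5 : b ^+ 5 <= a ^+ 5 by rewrite lerXn2r ?nnegrE ?(ltW a0) ?(ltW b0).
have a5 : 0 < a ^+ 5 by exact: exprn_gt0.
have b50 : 0 < b ^+ 5 by exact: exprn_gt0.
have a51 : a ^+ 5 <= 1 by rewrite exprn_ile1// ltW.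
set h := a ^+ 5 in k1 k2 a5 a51 b5 *; set h' := b ^+ 5 in j1 j2 b5 b50 *.
have d1 : (K * h - J * h') ^+ 2 <= h.
  have : `|K * h - J * h'| <= h by rewrite ler_norml; apply/andP; split; lra.
  rewrite -(real_normK (num_real (_ - _))) expr2 => dh.
  apply: (le_trans (ler_pM (normr_ge0 _) (normr_ge0 _) dh dh)).
  by rewrite ler_piMl// ltW.
have d2 : K * h ^+ 2 <= t * h by rewrite expr2 mulrA ler_wpM2r// ltW.
have d3 : J * h' ^+ 2 <= t * h.
  rewrite expr2 mulrA; apply: (le_trans (ler_wpM2r (ltW b50) j1)).
  exact: ler_wpM2l.
have Q : (K * h - J * h') ^+ 2 + K * h ^+ 2 + J * h' ^+ 2 <= (1 + 2 * t) * h by lra.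
have C2E : C ^+ 2 / (4 * a) * ((1 + 2 * t) * h) = C0 ^+ 2 * (1 + 2 * t) * (a * a) / 4.
  by rewrite /C /h; field; rewrite gt_eqF.
have Q2 : C ^+ 2 / (4 * a) * ((K * h - J * h') ^+ 2 + K * h ^+ 2 + J * h' ^+ 2) <=
    C0 ^+ 2 * (1 + t) * a.
  apply: (@le_trans _ _ (C ^+ 2 / (4 * a) * ((1 + 2 * t) * h))).
    by rewrite ler_wpM2l// divr_ge0 ?sqr_ge0// mulr_ge0// ltW.
  rewrite C2E.
  have p1 : 0 <= C0 ^+ 2 * (1 + 2 * t) by rewrite mulr_ge0 ?sqr_ge0//; lra.
  have aa : a * a <= a by rewrite ler_piMl// ltW.
  have p2 := ler_wpM2l p1 aa.
  have p3 : 0 <= C0 ^+ 2 * a by rewrite mulr_ge0 ?sqr_ge0// ltW.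
  have p4 := mulr_ge0 p3 t0; clear -p2 p3 p4; lra.
have e1 : K * h * (a ^+ 2 * (D / a)) <= t * (D * a).
  have -> : a ^+ 2 * (D / a) = D * a by field; rewrite gt_eqF.
  by rewrite ler_wpM2r// mulr_ge0 ?(ltW D0) ?(ltW a0).
have e2 : J * h' * (b ^+ 2 * (D / b)) <= t * (D * a).
  have -> : b ^+ 2 * (D / b) = D * b by field; rewrite gt_eqF.
  apply: (@le_trans _ _ (t * (D * b))); first by rewrite ler_wpM2r// mulr_ge0 ?(ltW D0) ?(ltW b0).
  by rewrite ler_wpM2l// ler_wpM2l// ltW.
have ta : 0 <= t * a by rewrite mulr_ge0// ltW.
have Da : 0 <= D * a by rewrite mulr_ge0// ltW.
have tDa : 0 <= t * (D * a) by rewrite mulr_ge0.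
by clear -Q2 e1 e2 ta Da tDa; lra.
Qed.

Definition q (n : nat) : R := n.+1%:R^-1.

Lemma q_gt0 n : 0 < q n. Proof. by rewrite invr_gt0 ltr0n. Qed.

Lemma q_le1 n : q n <= 1. Proof. by rewrite invf_le1 ?ler1n ?ltr0n. Qed.

Lemma q_le n m : (n <= m)%N -> q m <= q n.
Proof. by move=> nm; rewrite lef_pV2 ?posrE ?ltr0n// ler_nat. Qed.

Section Existence.
Variables (G : R -> R) (s1 s2 : R).
Hypothesis s1_ge0 : 0 <= s1.
Hypothesis s12 : s1 <= s2.
Hypothesis GE : forall a, G a = Num.max (s1 * a) (s2 * a).

Let s2_ge0 : 0 <= s2. Proof. exact: le_trans s12. Qed.

Lemma Heps_bound (e a M : R) : 0 < e -> `|a| <= M -> `|G a + e * a| <= (s2 + e) * M.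
Proof.
move=> e0 /ler_normlP[l1 l2]; have M0 : 0 <= M by lra.
have sM : 0 <= (s2 - s1) * M by rewrite mulr_ge0// subr_ge0.
have nM : - M <= a by lra.
have nM0 : - M <= 0 by rewrite oppr_le0.
have eH := Heps_elliptic s1_ge0 s12 GE e0.
have [+ _] := eH _ _ l2; have [+ _] := eH _ _ nM.
rewrite /= (G_pos s12 GE M0) (G_neg s12 GE nM0) => *.
by rewrite ler_norml; apply/andP; split; lra.
Qed.

Lemma scheme_shift (h e : R) v n : scheme G h e v -> scheme G h e (fun k => v (n + k)%N).
Proof.
move=> [h0 e0 vb vE]; split; [exact: h0|exact: e0|by move=> k; exact: vb|].
by move=> k x; rewrite addnS; exact: vE.
Qed.

Section Barrier.
Variables (h e : R) (v : nat -> R -> R) (g : R -> R) (M c C : R).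
Hypothesis sv : scheme G h e v.
Hypotheses (gb : Cb2 g) (gM : forall x, `|D2 g x| <= M) (MC : (s2 + e) * M <= C).

Let Hg x : `|G (D2 g x) + e * D2 g x| <= C.
Proof. by have [_ e0 _ _] := sv; apply: le_trans MC; exact: Heps_bound. Qed.

(** A fixed C^2 function plus a drift [C] per unit of time is a supersolution. Taking for [g] the
    datum of another scheme provides the linear time bounds required by [two_schemes]. *)
Lemma scheme_barrier_le : (forall x, v 0%N x <= g x + c) ->
  forall k x, v k x <= g x + c + C * (k%:R * h).
Proof.
move=> H; have [h0 _ _ _] := sv; elim=> [|k IH] x; first by rewrite mul0r mulr0 addr0.
rewrite -addrA; apply: (scheme_comparison s1_ge0 s12 GE sv gb) => y.
have := IH y; have /ler_normlP[q1 q2] := Hg y; have := ler_wpM2l (ltW h0) q2.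
by rewrite -natr1 mulrDl mul1r; lra.
Qed.

Lemma scheme_barrier_ge : (forall x, g x <= v 0%N x + c) ->
  forall k x, g x <= v k x + c + C * (k%:R * h).
Proof.
move=> H; have [h0 _ _ _] := sv; elim=> [|k IH] x; first by rewrite mul0r mulr0 addr0.
rewrite -addrA; apply: (scheme_comparison_ge s1_ge0 s12 GE sv gb) => y.
have := IH y; have /ler_normlP[q1 q2] := Hg y; have := ler_wpM2l (ltW h0) q1.
by rewrite -natr1 mulrDl mul1r; lra.
Qed.

End Barrier.

Lemma scheme_bounded (h e : R) v (B : R) : scheme G h e v -> (forall x, `|v 0%N x| <= B) ->
  forall k x, `|v k x| <= B.
Proof.
move=> sv vB k x; have [cb cD] := Cb2_cst (0 : R).
have M0 y : `|D2 (fun _ : R => 0 : R) y| <= 0 by rewrite cD normr0.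
have C0 : (s2 + e) * 0 <= 0 by rewrite mulr0.
have := @scheme_barrier_le h e v _ 0 B 0 sv cb M0 C0 _ k x.
have := @scheme_barrier_ge h e v _ 0 B 0 sv cb M0 C0 _ k x.
rewrite mul0r addr0 add0r => h1 h2.
rewrite ler_norml; apply/andP; split.
  by have /h1 : (forall x, 0 <= v 0%N x + B); [move=> y; have /ler_normlP[] := vB y; lra|lra].
by rewrite -[B]addr0; apply: h2 => y; have /ler_normlP[] := vB y.
Qed.

(* The accuracy [q n] of the data, the steps [h = q^5], [e = q^2] and the size
   [D / q] of the second derivatives are balanced so that the errors in
   [two_schemes] with [eta = q n] are all [O(q n)]. *)
Lemma scheme_gap (v : nat -> nat -> R -> R) (phi : R -> R) (D : R) : 0 < D ->
  (forall n, scheme G (q n ^+ 5) (q n ^+ 2) (v n)) ->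
  (forall n x, `|D2 (v n 0%N) x| <= D / q n) ->
  (forall n x, `|v n 0%N x - phi x| <= D * q n) ->
  forall n m k j (t x : R), (n <= m)%N -> 0 <= t ->
  k%:R * q n ^+ 5 <= t -> t < k%:R * q n ^+ 5 + q n ^+ 5 ->
  j%:R * q m ^+ 5 <= t -> t < j%:R * q m ^+ 5 + q m ^+ 5 ->
  `|v n k x - v m j x| <= (4 * D + 1 + ((s2 + 1) * D) ^+ 2) * (1 + t) * q n.
Proof.
move=> D0 sv vD vphi n m k j t x nm t0 k1 k2 j1 j2.
have qn := q_gt0 n; have qm := q_gt0 m; have qn1 := q_le1 n; have qm1 := q_le1 m.
have qmn := q_le nm.
pose C0 := (s2 + 1) * D; pose C := C0 / q n.
have C00 : 0 < C0 by rewrite mulr_gt0// ltr_wpDl.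
have MC p : q p ^+ 2 <= 1 -> (s2 + q p ^+ 2) * (D / q n) <= C.
  move=> q2; rewrite /C /C0 -mulrA ler_wpM2r ?divr_ge0 ?(ltW D0) ?(ltW qn)//.
  by rewrite lerD2l.
have q21 p : q p ^+ 2 <= 1 by rewrite exprn_ile1 ?q_le1// ltW// q_gt0.
have close y : `|v n 0%N y - v m 0%N y| <= 2 * D * q n.
  have /ler_normlP[a1 a2] := vphi n y; have /ler_normlP[b1 b2] := vphi m y.
  have := ler_wpM2l (ltW D0) qmn; rewrite ler_norml => *; apply/andP; split; lra.
have n2m y : v n 0%N y <= v m 0%N y + 2 * D * q n.
  by have /ler_normlP[_] := close y; lra.
have m2n y : v m 0%N y <= v n 0%N y + 2 * D * q n.
  by have /ler_normlP[+ _] := close y; lra.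
have m2n' y : v n 0%N y <= v n 0%N y + 0 by rewrite addr0.
have [_ _ vbn _] := sv n.
(* All four barriers are built on the coarser datum [v n 0], whose second derivative has the smaller
   bound [D / q n]. *)
have nn1 := scheme_barrier_le (sv n) (vbn 0%N) (vD n) (MC n (q21 n)) m2n'.
have nn2 := scheme_barrier_ge (sv n) (vbn 0%N) (vD n) (MC n (q21 n)) m2n'.
have nm1 := scheme_barrier_le (sv m) (vbn 0%N) (vD n) (MC m (q21 m)) m2n.
have nm2 := scheme_barrier_ge (sv m) (vbn 0%N) (vD n) (MC m (q21 m)) n2m.
have main1 := @two_schemes R G s1 s2 s1_ge0 s12 GE _ _ _ _ _ _ (D / q n) (D / q m)
  (2 * D * q n) C (q n) (sv n) (sv m) (vD n) (vD m) _ nm2 qn k j x.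
have main2 := @two_schemes R G s1 s2 s1_ge0 s12 GE _ _ _ _ _ _ (D / q m) (D / q n)
  (2 * D * q n) C (q n) (sv m) (sv n) (vD m) (vD n) nm1 _ qn j k x.
have {}main1 := main1 _; have {}main2 := main2 _.
set E := (X in _ <= X).
suff errs : 2 * D * q n + q n + C ^+ 2 / (4 * q n) * ((k%:R * q n ^+ 5 - j%:R * q m ^+ 5) ^+ 2
    + k%:R * (q n ^+ 5) ^+ 2 + j%:R * (q m ^+ 5) ^+ 2)
    + k%:R * q n ^+ 5 * (q n ^+ 2 * (D / q n)) + j%:R * q m ^+ 5 * (q m ^+ 2 * (D / q m)) <= E.
  have m1 : v n k x <= v m j x + E.
    apply: (le_trans (main1 _)); last by move: errs; clear; lra.
    move=> k' y; have := nn1 k' y; have := n2m y; clear; lra.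
  have m2 : v m j x <= v n k x + E.
    apply: (le_trans (main2 _)).
      by move=> k' y; have := nn2 k' y; have := m2n y; clear; lra.
    have -> : (j%:R * q m ^+ 5 - k%:R * q n ^+ 5) ^+ 2 = (k%:R * q n ^+ 5 - j%:R * q m ^+ 5) ^+ 2 by ring.
    by move: errs; clear; lra.
  by rewrite ler_norml; apply/andP; split; clear -m1 m2; lra.
rewrite {}/E -/C0; apply: gap_arith => //.
Qed.

End Existence.

(** The schemes started from the approximations of [phi], read at the last grid time before [t], are
    Cauchy by [scheme_gap]. Their moduli in space and time make the limit continuous, and the limit
    is a sub- and supersolution by stability, applied to [G] and to its reflection. *)
Lemma visc_exists (G : R -> R) (s1 s2 : R) (phi : R -> R) (B L : R) :
  0 <= s1 -> s1 <= s2 -> (forall a, G a = Num.max (s1 * a) (s2 * a)) ->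
  (forall x, `|phi x| <= B) ->
  (forall x y, `|phi x - phi y| <= L * `|x - y|) -> exists u, visc_sol G phi u.
Proof.
move=> s1_ge0 s12 GE phiB phiL; have s2_ge0 : 0 <= s2 by exact: le_trans s12.
pose D := L ^+ 2 + 2 * (s2 + 1).
have D0 : 0 < D.
  by rewrite ltr_wpDl ?sqr_ge0// mulr_gt0// ltr_wpDl.
have bphi : exists M : R, forall x, `|phi x| <= M by exists B.
have /choice[v Hv] : forall n, exists v, [/\ scheme G (q n ^+ 5) (q n ^+ 2) v,
    forall x, `|D2 (v 0%N) x| <= D / q n, forall x, `|v 0%N x - phi x| <= D * q n &
    forall x y, `|v 0%N x - v 0%N y| <= L * `|x - y|].
  move=> n; have [f [bf f1 f2 f3]] := CbLip_approx s1_ge0 s12 GE bphi phiL (q_gt0 n).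
  have h0 : 0 < q n ^+ 5 by rewrite exprn_gt0// q_gt0.
  have e0 : 0 < q n ^+ 2 by rewrite exprn_gt0// q_gt0.
  have [v sv v0] := scheme_exists s1_ge0 s12 GE h0 e0 bf.
  by exists v; rewrite v0; split=> [//|//|x|//]; rewrite mulrC; exact: f1.
have sv n : scheme G (q n ^+ 5) (q n ^+ 2) (v n) by case: (Hv n).
have vD n x : `|D2 (v n 0%N) x| <= D / q n by case: (Hv n).
have vphi n x : `|v n 0%N x - phi x| <= D * q n by case: (Hv n).
have vL0 n x y : `|v n 0%N x - v n 0%N y| <= L * `|x - y| by case: (Hv n).
have vL n k x y : `|v n k x - v n k y| <= L * `|x - y|.
  exact: (scheme_lipschitz s1_ge0 s12 GE (sv n) (vL0 n)).
clear Hv bphi; clearbody D.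
pose E := 4 * D + 1 + ((s2 + 1) * D) ^+ 2.
have E1 : 1 <= E by rewrite /E; have := sqr_ge0 ((s2 + 1) * D); clear -D0; lra.
have gap := scheme_gap s1_ge0 s12 GE D0 sv vD vphi; rewrite -/E in gap; clearbody E.
have h0 n : 0 < q n ^+ 5 by rewrite exprn_gt0// q_gt0.
(* Freezing the limit at its initial value for negative times makes it continuous on the whole
   plane. *)
pose pos (t : R) := Num.max t 0.
have pos0 t : 0 <= pos t by rewrite le_max lexx orbT.
pose kk n t := Num.truncn (pos t / q n ^+ 5).
have kkP n t : (kk n t)%:R * q n ^+ 5 <= pos t /\ pos t < (kk n t)%:R * q n ^+ 5 + q n ^+ 5.
  exact: truncn_bounds.
have [U0 HU0] : exists U : R * R -> R, forall n p,
    `|U p - v n (kk n p.1) p.2| <= E * (1 + pos p.1) * q n.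
  apply: (@cauchy_envelope R (R * R)%type (fun n p => v n (kk n p.1) p.2)
    (fun n p => E * (1 + pos p.1) * q n)) => n m [t x] /=.
  have bnd p : 0 <= E * (1 + pos t) * q p.
    by rewrite mulr_ge0 ?(ltW (q_gt0 _))// mulr_ge0 ?addr_ge0//; apply: le_trans E1.
  have [n1 n2] := kkP n t; have [m1 m2] := kkP m t.
  have [nm|/ltnW mn] := leqP n m.
    by apply: (le_trans (gap n m _ _ _ x nm (pos0 t) n1 n2 m1 m2)); rewrite lerDl.
  by rewrite distrC; apply: (le_trans (gap m n _ _ _ x mn (pos0 t) m1 m2 n1 n2)); rewrite lerDr.
pose u t x := U0 (t, x).
have HU n t x : `|u t x - v n (kk n t) x| <= E * (1 + pos t) * q n by exact: (HU0 n (t, x)).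
clearbody u; clear U0 HU0 gap.
have posE t : 0 <= t -> pos t = t by move=> ?; exact: max_l.
have HG n k x : `|u (k%:R * q n ^+ 5) x - v n k x| <= E * (1 + k%:R * q n ^+ 5) * q n.
  have := HU n (k%:R * q n ^+ 5) x.
  have kh : 0 <= k%:R * q n ^+ 5 by rewrite mulr_ge0// ltW.
  by rewrite /kk posE// mulfK ?gt_eqF// natrK.
have small (A e : R) : 0 <= A -> 0 < e -> exists n, A * q n <= e.
  move=> A0 e0; have [n Hn] := inv_nat_small (divr_gt0 e0 (ltr_wpDl A0 ltr01)).
  exists n; apply: (@le_trans _ _ ((A + 1) * q n)).
    by rewrite ler_wpM2r ?lerDl// ltW// q_gt0.
  by rewrite mulrC -ler_pdivlMr// ltr_wpDl.
have E0 : 0 <= E by apply: le_trans E1.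
have u0 x : u 0 x = phi x.
  apply/eqP; rewrite -subr_eq0 -normr_le0; apply/ler_addgt0Pr => e e0; rewrite add0r.
  have [|n Hn] := small (E + D) e _ e0; first by rewrite addr_ge0// ltW.
  have := HG n 0%N x; rewrite mul0r addr0 mulr1 => a1.
  have := vphi n x; have -> : u 0 x - phi x = (u 0 x - v n 0%N x) + (v n 0%N x - phi x) by ring.
  have := ler_normD (u 0 x - v n 0%N x) (v n 0%N x - phi x); clear -a1 Hn; lra.
have vB n k x : `|v n k x| <= B + D.
  apply: (scheme_bounded s1_ge0 s12 GE (sv n)) => y.
  have -> : v n 0%N y = phi y + (v n 0%N y - phi y) by ring.
  rewrite (le_trans (ler_normD _ _))// lerD//; apply: (le_trans (vphi n y)).
  by rewrite ler_piMr ?q_le1// ltW.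
have bu t x : `|u t x| <= B + D + 1.
  have [|n Hn] := small (E * (1 + pos t)) 1 _ ltr01; first by rewrite mulr_ge0// addr_ge0.
  have -> : u t x = v n (kk n t) x + (u t x - v n (kk n t) x) by ring.
  by rewrite (le_trans (ler_normD _ _))// lerD// (le_trans (HU n t x)).
have vT n k j x : `|v n (k + j)%N x - v n k x| <= j%:R * q n ^+ 5 * ((s2 + 1) * D / q n).
  have sh := scheme_shift k (sv n).
  have shD y : `|D2 (v n (k + 0)%N) y| <= D / q n.
    exact: (scheme_D2 s1_ge0 s12 GE (sv n) (vD n)).
  have := scheme_drift s1_ge0 s12 GE sh shD j x; rewrite addn0 => /le_trans; apply.
  have qn := ltW (q_gt0 n).
  rewrite -(mulrA (s2 + 1)) ler_wpM2l ?mulr_ge0 ?exprn_ge0// ler_wpM2r ?divr_ge0 ?(ltW D0)//.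
  by rewrite lerD2l exprn_ile1 ?q_le1.
have sD0 : 0 <= (s2 + 1) * D by rewrite mulr_ge0 ?addr_ge0// ltW.
have vT' n t s x : `|v n (kk n t) x - v n (kk n s) x| <=
    (`|pos t - pos s| + q n ^+ 5) * ((s2 + 1) * D / q n).
  wlog ts : t s / (kk n s <= kk n t)%N => [W|].
    have [ts|/ltnW st] := leqP (kk n s) (kk n t); first exact: W.
    by rewrite distrC (distrC (pos t)); exact: W.
  have := vT n (kk n s) (kk n t - kk n s)%N x; rewrite subnKC// => /le_trans; apply.
  rewrite ler_wpM2r ?divr_ge0 ?(ltW (q_gt0 n))//.
  have [a1 a2] := kkP n t; have [b1 b2] := kkP n s.
  rewrite natrB// mulrBl; have := ler_norm (pos t - pos s); clear -a1 a2 b1 b2; lra.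
have cu : continuous (fun p : R * R => u p.1 p.2).
  suff main (t0 x0 e : R) : 0 < e -> exists2 d, 0 < d & forall t x,
      `|t0 - t| < d -> `|x0 - x| < d -> `|u t0 x0 - u t x| < e.
    move=> [t0 x0]; apply/cvgrPdist_lt => e /(main t0 x0)[d d0 Hd].
    exists (ball (t0 : R) d, ball (x0 : R) d); first by split; exact: nbhsx_ballx.
    by move=> [t x] [/= bt bx]; exact: Hd.
  move=> e0; have F0 : 0 <= E * (1 + (pos t0 + 1)) + (s2 + 1) * D.
    by rewrite addr_ge0// mulr_ge0// addr_ge0// addr_ge0.
  have e8 : 0 < e / 8 by rewrite divr_gt0.
  have [n Hn] := small _ _ F0 e8.
  (* The time modulus [K] of the approximations deteriorates as [n] grows, so [n] is fixed by the
     accuracy before the radius [d] is chosen. *)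
  pose K := (s2 + 1) * D / q n; have K0 : 0 <= K by rewrite divr_ge0// ltW// q_gt0.
  pose d := Num.min 1 (Num.min (e / 8 / (K + 1)) (e / 8 / (`|L| + 1))).
  have d0 : 0 < d.
    by rewrite !lt_min ltr01/= !divr_gt0// ltr_wpDl.
  exists d => // t x bt bx.
  have d1 : d <= 1 by rewrite /d ge_min lexx.
  have d2 : d <= e / 8 / (K + 1) by rewrite /d !ge_min lexx !orbT.
  have d3 : d <= e / 8 / (`|L| + 1) by rewrite /d !ge_min lexx !orbT.
  have post : `|pos t0 - pos t| <= `|t0 - t|.
    rewrite /pos; have [t00|t00] := leP 0 t0; have [tt|tt] := leP 0 t.
    - exact: lexx.
    - by rewrite subr0 !ger0_norm//; clear -t00 tt; lra.
    - by rewrite sub0r normrN ger0_norm// ler0_norm; clear -t00 tt; lra.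
    - by rewrite subrr normr0.
  have A1 := HU n t0 x0; have A2 := HU n t x.
  have A3 := vT' n t0 t x0; have A4 := vL n (kk n t) x0 x.
  have pt : pos t <= pos t0 + 1.
    have := ler_norm (- (pos t0 - pos t)); rewrite normrN; clear -post bt d1; lra.
  have B1 : E * (1 + pos t0) * q n <= e / 8.
    apply: le_trans Hn; rewrite ler_wpM2r ?(ltW (q_gt0 n))//.
    apply: (@le_trans _ _ (E * (1 + (pos t0 + 1)))); last by rewrite lerDl.
    by rewrite ler_wpM2l// lerD2l lerDl.
  have B2 : E * (1 + pos t) * q n <= e / 8.
    apply: le_trans Hn; rewrite ler_wpM2r ?(ltW (q_gt0 n))//.
    apply: (@le_trans _ _ (E * (1 + (pos t0 + 1)))); last by rewrite lerDl.
    by rewrite ler_wpM2l// lerD2l.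
  have B3 : (`|pos t0 - pos t| + q n ^+ 5) * K <= e / 8 + e / 8.
    rewrite mulrDl lerD//.
      apply: (@le_trans _ _ (d * (K + 1))); last by rewrite -ler_pdivlMr// ltr_wpDl.
      rewrite ler_pM//; last by rewrite lerDl.
      by rewrite (le_trans post)// ltW.
    have -> : q n ^+ 5 * K = (s2 + 1) * D * q n ^+ 4.
      by rewrite /K; field; rewrite gt_eqF// q_gt0.
    apply: le_trans Hn; apply: (@le_trans _ _ ((s2 + 1) * D * q n)).
      rewrite ler_wpM2l// exprS ler_piMr ?exprn_ile1 ?q_le1 ?(ltW (q_gt0 n))//.
    by rewrite ler_wpM2r ?lerDr ?(ltW (q_gt0 n))// mulr_ge0// addr_ge0// addr_ge0.
  have B4 : L * `|x0 - x| <= e / 8.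
    apply: (@le_trans _ _ ((`|L| + 1) * d)); last by rewrite mulrC -ler_pdivlMr// ltr_wpDl.
    apply: (@le_trans _ _ ((`|L| + 1) * `|x0 - x|)).
      by rewrite ler_wpM2r//; apply: (le_trans (ler_norm L)); rewrite lerDl.
    by rewrite ler_wpM2l ?addr_ge0// ltW.
  have -> : u t0 x0 - u t x = (u t0 x0 - v n (kk n t0) x0) + (v n (kk n t0) x0 - v n (kk n t) x0)
     + (v n (kk n t) x0 - v n (kk n t) x) - (u t x - v n (kk n t) x) by ring.
  apply: (le_lt_trans (ler_normB _ _)).
  have N1 := ler_normD (u t0 x0 - v n (kk n t0) x0) (v n (kk n t0) x0 - v n (kk n t) x0).
  have N2 := ler_normD (u t0 x0 - v n (kk n t0) x0 + (v n (kk n t0) x0 - v n (kk n t) x0))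
     (v n (kk n t) x0 - v n (kk n t) x).
  move: N1 N2 A1 A2 A3 A4 B1 B2 B3 B4 e0; rewrite -/K.
  by clear; lra.
have approx T (e : R) : 0 < e -> exists n, [/\ 0 < q n ^+ 5 <= e,
    forall k x, `|q n ^+ 2 * D2 (v n k) x| <= e &
    forall k x, k%:R * q n ^+ 5 <= T -> `|u (k%:R * q n ^+ 5) x - v n k x| <= e].
  move=> e0; have A0 : 0 <= 1 + D + E * (1 + `|T|).
    by rewrite addr_ge0// ?addr_ge0// ?(ltW D0)// mulr_ge0// addr_ge0.
  have [n Hn] := small _ _ A0 e0; have qn := ltW (q_gt0 n).
  have ET : 0 <= E * (1 + `|T|) by rewrite mulr_ge0// addr_ge0.
  exists n; split.
  - rewrite h0/=; apply: le_trans Hn; apply: (@le_trans _ _ (1 * q n)).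
      by rewrite mul1r exprS ler_piMr ?exprn_ile1 ?q_le1.
    by rewrite ler_wpM2r// -addrA lerDl addr_ge0// ltW.
  - move=> k x; rewrite normrM ger0_norm ?exprn_ge0//.
    apply: le_trans Hn; apply: (@le_trans _ _ (D * q n)).
      have := scheme_D2 s1_ge0 s12 GE (sv n) (vD n) k x.
      move=> /(ler_wpM2l (exprn_ge0 2 qn)) /le_trans; apply.
      have -> : q n ^+ 2 * (D / q n) = D * q n by field; rewrite gt_eqF// q_gt0.
      exact: lexx.
    by rewrite ler_wpM2r// addrAC lerDr addr_ge0.
  - move=> k x kT; apply: (le_trans (HG n k x)); apply: le_trans Hn.
    rewrite ler_wpM2r//; apply: (@le_trans _ _ (E * (1 + `|T|))).
      by rewrite ler_wpM2l// lerD2l (le_trans kT)// ler_norm.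
    by rewrite lerDr addr_ge0// ltW.
have eG := G_elliptic s1_ge0 s12 GE.
exists u; split.
- by apply: continuous_subspaceT; exact: cu.
- by exists (B + D + 1) => t x _; exact: bu.
- exact: u0.
- apply: (limit_visc_sub eG cu) => T e e0; have [n [a1 a2 a3]] := approx T e e0.
  have [_ _ bv vE] := sv n.
  exists (q n ^+ 5), (v n); split; [exact: a1|exact: bv| |exact: a3].
  move=> k x; rewrite -(vE k x); have /ler_normlP[c1 c2] := a2 k.+1 x.
  have := ler_wpM2l (ltW (h0 n)) c2; clear; lra.
- apply: visc_sub_opp; apply: (limit_visc_sub (elliptic_opp eG)).
    by move=> p; apply: cvgN; exact: cu.
  move=> T e e0; have [n [a1 a2 a3]] := approx T e e0.
  have [_ _ bv vE] := sv n.
  exists (q n ^+ 5), (fun k x => - v n k x); split; first exact: a1.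
  + by move=> k; have [] := Cb2N (bv k).
  + move=> k x; rewrite (Cb2N (bv k.+1)).2 opprK -(vE k x).
    have /ler_normlP[c1 c2] := a2 k.+1 x.
    have := ler_wpM2l (ltW (h0 n)) c1; clear; lra.
  + by move=> k x kT; rewrite -opprD normrN; exact: a3.
Qed.

End Stability.

(** * Sublinear expectations *)

Section Expectation.
Variables (R : realType) (Theta : set (probability R R)).
Hypothesis UI : unif_integrable Theta.
Implicit Types (mu : probability R R) (f g : R -> R).

(** The class integrated against Theta: the Stein integrand contains [x * f'(x)], so bounded
    functions are not enough, and first moments are all that is available. *)
Definition lingrowth f := continuous f /\ exists C : R, forall x, `|f x| <= C * (1 + `|x|).

Definition Ex mu f : R := (\int[mu]_x f x)%R.

(** Continuous substitute for [|x|] restricted to [|x| > N], which dominates it. *)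
Definition tail (N : R) (x : R) : R := Num.max (`|x| - N) 0.

Lemma lingrowth_bcont f : bcont f -> lingrowth f.
Proof.
move=> [cf [M fM]]; split; [exact: cf|exists M => x].
by have M0 : 0 <= M := le_trans (normr_ge0 _) (fM 0); apply: (le_trans (fM x)); rewrite ler_peMr// lerDl.
Qed.

Lemma lingrowthD f g : lingrowth f -> lingrowth g -> lingrowth (fun x => f x + g x).
Proof.
move=> [cf [C fC]] [cg [D gD]]; split.
  by move=> x; apply: cvgD; [exact: cf|exact: cg].
exists (C + D) => x; rewrite (le_trans (ler_normD _ _))// mulrDl lerD//.
Qed.

Lemma lingrowthZ (k : R) f : lingrowth f -> lingrowth (fun x => k * f x).
Proof.
move=> [cf [C fC]]; split.
  by move=> x; apply: cvgM; [exact: cvg_cst|exact: cf].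
by exists (`|k| * C) => x; rewrite normrM -mulrA ler_wpM2l.
Qed.

Lemma continuous_norm : continuous (fun x : R => `|x|).
Proof. by move=> x; exact: norm_continuous. Qed.

Lemma lingrowth_norm : lingrowth (fun x => `|x|).
Proof.
by split; [exact: continuous_norm|exists 1 => x; rewrite normr_id mul1r lerDr].
Qed.

Lemma lingrowth_tail N : 0 <= N -> lingrowth (tail N).
Proof.
move=> N0; split.
  move=> x; apply: (@continuous_max R R (fun x => `|x| - N) (cst 0) x).
    by apply: cvgB; [exact: continuous_norm|exact: cvg_cst].
  exact: cvg_cst.
exists 1 => x; rewrite mul1r /tail ger0_norm ?le_max ?lexx ?orbT//.
by rewrite ge_max addr_ge0// andbT; lra.
Qed.

Lemma unif_integrable_tail (e : R) : 0 < e -> exists2 N : R, 0 < N & forall mu, Theta mu ->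
  (\int[mu]_(x in [set y : R | (N < `|y|)%R]) (`|x|)%:E <= e%:E)%E.
Proof.
move=> e0; have /fine_cvgP[fn cv] := UI.
have /cvgr0Pnorm_lt /(_ e e0) lt := cv.
have [M [_ HM]] : \forall N \near +oo, (ereal_sup [set (\int[mu]_(x in [set y : R | (N < `|y|)%R]) (`|x|)%:E)%E
               | mu in Theta] <= e%:E)%E.
  near=> N.
  have fnN : ereal_sup [set (\int[mu]_(x in [set y : R | (N < `|y|)%R]) (`|x|)%:E)%E
               | mu in Theta] \is a fin_num by near: N.
  have ltN : `|(fine \o fun N : R => ereal_sup [set (\int[mu]_(x in [set y : R | (N < `|y|)%R]) (`|x|)%:E)%E
               | mu in Theta]) N| < e by near: N.
  rewrite -(fineK fnN) lee_fin; apply: le_trans (ltW ltN); exact: ler_norm.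
exists (Num.max M 0 + 1).
  by rewrite ltr_wpDl// le_max lexx orbT.
move=> mu Tmu; apply: le_trans (HM (Num.max M 0 + 1) _).
  by apply: ereal_sup_ubound; exists mu.
by rewrite ltr_pwDr// le_max lexx.
Unshelve. all: by end_near. Qed.

Let farset (N : R) : set R := [set y : R | (N < `|y|)%R].

Let measurable_far N : measurable (farset N).
Proof.
apply: open_measurable; apply: (@open_comp _ _ (fun y : R => `|y|) [set x | N < x]).
  by move=> x _; exact: continuous_norm.
exact: open_gt.
Qed.

Let mnorm : measurable_fun [set: R] (fun x : R => (`|x|)%:E).
Proof. by apply/measurable_EFinP; exact: continuous_measurable_fun continuous_norm. Qed.

Let mfar N : measurable_fun [set: R] ((fun x : R => (`|x|)%:E) \_ (farset N)).
Proof. by apply/(measurable_restrictT _ _).1 => //; exact: measurable_funS mnorm. Qed.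

Lemma integral_norm_le mu (N e : R) : 0 <= N ->
  (\int[mu]_(x in farset N) (`|x|)%:E <= e%:E)%E -> (\int[mu]_x (`|x|)%:E <= (N + e)%:E)%E.
Proof.
move=> N0 Ne; apply: (@le_trans _ _ (\int[mu]_x (N%:E + ((fun x : R => (`|x|)%:E) \_ (farset N)) x))%E).
  apply: ge0_le_integral => //=.
  - by apply: emeasurable_funD => //; exact: measurable_cst.
  - move=> x _; rewrite patchE; case: ifPn => [_|].
      by rewrite -EFinD lee_fin lerDr.
    by rewrite notin_setE /farset/= adde0 lee_fin => /negP; rewrite -leNgt.
rewrite ge0_integralD//=; last first.
  by move=> x _; rewrite patchE; case: ifPn => // _; rewrite lee_fin.
have -> : (\int[mu]__ N%:E = N%:E)%E.
  have h := integral_cst mu measurableT N%:E.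
  by rewrite -[RHS]mule1 -(probability_setT mu) -h.
rewrite -integral_mkcond EFinD.
exact: leeD2l.
Qed.

Lemma Ex_norm_bound : exists2 m : R, 0 <= m & forall mu, Theta mu ->
  (\int[mu]_x (`|x|)%:E <= m%:E)%E.
Proof.
have [N N0 HN] := unif_integrable_tail ltr01.
exists (N + 1); first by rewrite addr_ge0// ltW.
by move=> mu /HN; exact/integral_norm_le/ltW.
Qed.

Lemma integrable_lingrowth mu f : Theta mu -> lingrowth f -> mu.-integrable setT (EFin \o f).
Proof.
move=> Tmu [cf [C fC]]; have [m m0 /(_ _ Tmu) le] := Ex_norm_bound.
have in1 : mu.-integrable setT (EFin \o (fun x : R => `|x|)).
  apply/integrableP; split=> //=; under eq_integral do rewrite normr_id.
  exact: le_lt_trans (ltry m).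
have in0 : mu.-integrable setT (EFin \o (cst (1 : R))).
  exact: finite_measure_integrable_cst.
have in2 : mu.-integrable setT (EFin \o (fun x : R => C * (1 + `|x|))).
  have := @integrableZl _ _ _ mu setT measurableT C _ (integrableD measurableT in0 in1).
  by [].
apply: (le_integrable _ _ _ in2) => //.
  by apply/measurable_EFinP; exact: continuous_measurable_fun.
move=> x _ /=; rewrite lee_fin; apply: le_trans (fC x) (ler_norm _).
Qed.

Lemma mint_Ex mu f : Theta mu -> lingrowth f -> mint mu f = (Ex mu f)%:E.
Proof.
move=> Tmu lf; rewrite /Ex /Rintegral fineK//.
by apply: integrable_fin_num => //; exact: integrable_lingrowth.
Qed.

Lemma ExD mu f g : Theta mu -> lingrowth f -> lingrowth g ->
  Ex mu (fun x => f x + g x) = Ex mu f + Ex mu g.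
Proof. by move=> Tmu lf lg; apply: RintegralD => //; exact: integrable_lingrowth. Qed.

Lemma ExZ mu (k : R) f : Theta mu -> lingrowth f -> Ex mu (fun x => k * f x) = k * Ex mu f.
Proof. by move=> Tmu lf; apply: RintegralZl => //; exact: integrable_lingrowth. Qed.

Lemma Ex_le mu f g : Theta mu -> lingrowth f -> lingrowth g -> (forall x, f x <= g x) ->
  Ex mu f <= Ex mu g.
Proof. by move=> Tmu lf lg fg; apply: le_Rintegral => //; exact: integrable_lingrowth. Qed.

Lemma Ex_cst mu (c : R) : Ex mu (fun _ : R => c) = c.
Proof. by rewrite /Ex Rintegral_cst//= probability_setT/= mulr1. Qed.

Lemma Ex_norm_le : exists2 m : R, 0 <= m & forall mu, Theta mu -> Ex mu (fun x : R => `|x|) <= m.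
Proof.
have [m m0 Hm] := Ex_norm_bound; exists m => // mu Tmu.
by rewrite -lee_fin -mint_Ex//; [exact: Hm|exact: lingrowth_norm].
Qed.

Lemma Ex_tail_le (e : R) : 0 < e ->
  exists2 N : R, 0 < N & forall mu, Theta mu -> Ex mu (tail N) <= e.
Proof.
move=> /unif_integrable_tail[N N0 HN]; exists N => // mu Tmu.
have lt := lingrowth_tail (ltW N0).
rewrite -lee_fin -mint_Ex//; apply: le_trans (HN _ Tmu); rewrite integral_mkcond.
apply: ge0_le_integral => //=.
- by move=> x _; rewrite lee_fin /tail le_max lexx orbT.
- by apply/measurable_EFinP; apply: continuous_measurable_fun; case: lt.
- exact: mfar.
- move=> x _; rewrite patchE /tail; case: ifPn => [_|].
    by rewrite lee_fin ge_max normr_ge0 andbT; move: N0; lra.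
  rewrite notin_setE /farset/= => /negP; rewrite -leNgt => xN.
  by rewrite lee_fin ge_max lexx andbT subr_le0.
Qed.

(* Uniform integrability makes the second-order Taylor remainder of
   [f (x - d x)] a uniform [o(d)] although second moments may be infinite. *)
Lemma Ex_min_sqr_le (e : R) : 0 < e -> exists2 d0 : R, 0 < d0 & forall mu (d : R) f, Theta mu ->
  0 <= d <= d0 -> lingrowth f -> (forall x, f x <= Num.min (d * x ^+ 2) `|x|) -> Ex mu f <= e.
Proof.
move=> e0; have e4 : 0 < e / 4 by rewrite divr_gt0.
have [N N0 HN] := Ex_tail_le e4; have [m m0 Hm] := Ex_norm_le.
have K0 : 0 < 4 * N * (m + 1) by rewrite !mulr_gt0// ltr_wpDl.
exists (e / (4 * N * (m + 1))); first by rewrite divr_gt0.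
move=> mu d f Tmu /andP[d0 de] lf fle.
have lt := lingrowth_tail (ltW N0).
apply: (@le_trans _ _ (Ex mu (fun x => (d * (2 * N)) * `|x| + 2 * tail N x))).
  apply: Ex_le => //.
    by apply: lingrowthD; apply: lingrowthZ => //; exact: lingrowth_norm.
  move=> x; apply: (le_trans (fle x)).
  (* Below [2 * N] the quadratic bound is at most [2 * d * N * |x|]; beyond it
     [|x| <= 2 * (|x| - N)] and the uniformly small tail takes over. *)
  have [xN|Nx] := leP `|x| (2 * N).
    apply: (@le_trans _ _ (d * x ^+ 2)); first by rewrite ge_min lexx.
    apply: (@le_trans _ _ (d * (2 * N) * `|x|)).
      by rewrite -mulrA ler_wpM2l// -(real_normK (num_real x)) expr2 ler_wpM2r.
    by rewrite lerDl mulr_ge0// /tail le_max lexx orbT.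
  apply: (@le_trans _ _ `|x|); first by rewrite ge_min lexx orbT.
  apply: (@le_trans _ _ (2 * (`|x| - N))); first by move: Nx; lra.
  apply: (@le_trans _ _ (2 * tail N x)); first by rewrite ler_wpM2l// /tail le_max lexx.
  by rewrite lerDr !mulr_ge0// ltW.
rewrite ExD//; last 2 first.
- by apply: lingrowthZ; exact: lingrowth_norm.
- exact: lingrowthZ.
rewrite !ExZ//; last exact: lingrowth_norm.
have h1 := HN mu Tmu; have h2 := Hm mu Tmu.
have h3 : d * (2 * N) * Ex mu (fun x : R => `|x|) <= e / 2.
  apply: (@le_trans _ _ (d * (2 * N) * (m + 1))).
    by rewrite ler_wpM2l ?mulr_ge0 ?(ltW N0)// (le_trans h2)// lerDl.
  move: de; rewrite ler_pdivlMr//; lra.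
by move: h1 h3; lra.
Qed.

End Expectation.

(** * The sublinear functional and weak compactness *)

Section Sublinear.
Variables (R : realType) (Theta : set (probability R R)).
Hypothesis UI : unif_integrable Theta.
Implicit Types (mu : probability R R) (f g : R -> R).

Definition Nr f : R := fine (sublinN Theta f).

Section Nonempty.
Hypothesis Theta0 : Theta !=set0.

Lemma bcont_Ex_bounds f : bcont f -> exists M : R, forall mu, Theta mu -> `|Ex mu f| <= M.
Proof.
move=> bf; have [_ [M fM]] := bf; exists M => mu Tmu.
have lf := lingrowth_bcont bf.
have lc (c : R) : lingrowth (fun _ : R => c).
  by apply: lingrowth_bcont; split; [move=> x; exact: cvg_cst|exists `|c| => x].
rewrite ler_norml; apply/andP; split.
  rewrite -[X in X <= _](Ex_cst mu); apply: (Ex_le UI Tmu (lc _) lf) => x.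
  by have /ler_normlP[] := fM x; lra.
rewrite -[X in _ <= X](Ex_cst mu); apply: (Ex_le UI Tmu lf (lc _)) => x.
by have /ler_normlP[] := fM x.
Qed.

Lemma sublinN_Nr f : bcont f -> sublinN Theta f = (Nr f)%:E.
Proof.
move=> bf; rewrite /Nr fineK//; have [M HM] := bcont_Ex_bounds bf.
have lf := lingrowth_bcont bf; have [mu0 T0] := Theta0.
rewrite fin_numE; apply/andP; split.
  apply/eqP => E; have : (mint mu0 f <= sublinN Theta f)%E.
    by apply: ereal_sup_ubound; exists mu0.
  by rewrite E (mint_Ex UI T0 lf) leeNy_eq.
apply/eqP => E; have : (sublinN Theta f <= M%:E)%E.
  apply: ge_ereal_sup => _ [mu Tmu <-]; rewrite (mint_Ex UI Tmu lf) lee_fin.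
  exact: le_trans (ler_norm _) (HM _ Tmu).
by rewrite E leye_eq.
Qed.

Lemma Nr_ge mu f : Theta mu -> bcont f -> Ex mu f <= Nr f.
Proof.
move=> Tmu bf; rewrite -lee_fin -sublinN_Nr// -(mint_Ex UI Tmu (lingrowth_bcont bf)).
by apply: ereal_sup_ubound; exists mu.
Qed.

Lemma Nr_le f (c : R) : bcont f -> (forall mu, Theta mu -> Ex mu f <= c) -> Nr f <= c.
Proof.
move=> bf H; rewrite -lee_fin -sublinN_Nr//; apply: ge_ereal_sup => _ [mu Tmu <-].
by rewrite (mint_Ex UI Tmu (lingrowth_bcont bf)) lee_fin; exact: H.
Qed.

Lemma Nr_approx f (e : R) : bcont f -> 0 < e -> exists2 mu, Theta mu & Nr f - e <= Ex mu f.
Proof.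
move=> bf e0; apply: contrapT => H.
have : Nr f <= Nr f - e.
  apply: Nr_le => // mu Tmu; rewrite leNgt; apply/negP => lt.
  by apply: H; exists mu => //; exact: ltW.
by lra.
Qed.

Lemma Nr_shift f g (c : R) : bcont f -> bcont g -> (forall x, f x <= g x + c) ->
  Nr f <= Nr g + c.
Proof.
move=> bf bg fg; apply: Nr_le => // mu Tmu.
have lc : lingrowth (fun _ : R => c).
  by apply: lingrowth_bcont; split; [move=> x; exact: cvg_cst|exists `|c| => x].
have := Ex_le UI Tmu (lingrowth_bcont bf) (lingrowthD (lingrowth_bcont bg) lc) fg.
rewrite (ExD UI Tmu (lingrowth_bcont bg) lc) Ex_cst => /le_trans; apply.
by rewrite lerD2r; exact: Nr_ge.
Qed.

Lemma Nr_cst (c : R) : Nr (fun _ : R => c) = c.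
Proof.
have bc : bcont (fun _ : R => c).
  by split; [move=> x; exact: cvg_cst|exists `|c| => x].
have [mu Tmu] := Theta0; apply/eqP; rewrite eq_le; apply/andP; split.
  by apply: Nr_le => // nu _; rewrite Ex_cst.
by have := Nr_ge Tmu bc; rewrite Ex_cst.
Qed.

End Nonempty.

Definition clip (B : R) f (x : R) : R := Num.max (- B) (Num.min B (f x)).

Lemma Cb_clip B f : 0 <= B -> continuous f -> Cb (clip B f).
Proof.
move=> B0 cf; split.
  move=> x; apply: (@continuous_max R R (cst (- B)) (fun x => Num.min B (f x)) x).
    exact: cvg_cst.
  by apply: (@continuous_min R R (cst B) f x); [exact: cvg_cst|exact: cf].
exists B => x; rewrite /clip ler_norml; apply/andP; split.
  by rewrite le_max lexx.
by rewrite ge_max ge_min lexx andbT; lra.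
Qed.

(** At this level the truncation acts only where [|x| > 2 * max(N, 1)], and there
    [1 + |x| <= 4 * (|x| - N)]. *)
Lemma clip_close (B C N x : R) f : 0 < N -> 0 <= C -> `|f x| <= C * (1 + `|x|) ->
  B = C * (1 + 2 * Num.max N 1) -> `|f x - clip B f x| <= 4 * C * tail N x.
Proof.
move=> N0 C0 fC BE; pose N' := Num.max N 1.
have N'1 : 1 <= N' by rewrite /N' le_max lexx orbT.
have NN' : N <= N' by rewrite /N' le_max lexx.
have B0 : 0 <= B by rewrite BE mulr_ge0 ?addr_ge0 ?mulr_ge0//; move: N'1; rewrite /N'; lra.
have t0 : 0 <= tail N x by rewrite /tail le_max lexx orbT.
have [fB|Bf] := leP `|f x| B.
  have /ler_normlP[f1 f2] := fB.
  have m1 : Num.min B (f x) = f x by apply: min_r.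
  have -> : clip B f x = f x by rewrite /clip m1; apply: max_r; lra.
  by rewrite subrr normr0 !mulr_ge0.
have Cpos : 0 < C.
  rewrite lt_neqAle C0 andbT; apply/eqP => E; move: fC Bf; rewrite BE -E !mul0r; lra.
have xN : 2 * N' < `|x|.
  have : C * (1 + 2 * N') < C * (1 + `|x|) by rewrite /N' -BE; apply: (lt_le_trans Bf).
  by rewrite ltr_pM2l//; lra.
have cl : `|f x - clip B f x| <= `|f x|.
  rewrite /clip; have [f0|f0] := leP 0 (f x).
    have fB : B < f x by rewrite -(ger0_norm f0).
    have m1 : Num.min B (f x) = B by apply: min_l; exact: ltW.
    have m2 : Num.max (- B) B = B by apply: max_r; lra.
    by rewrite m1 m2 !ger0_norm ?subr_ge0 ?(ltW fB)//; lra.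
  have fB : f x < - B by move: Bf; rewrite ltr0_norm//; lra.
  have m1 : Num.min B (f x) = f x by apply: min_r; lra.
  have m2 : Num.max (- B) (f x) = - B by apply: max_l; exact: ltW.
  by rewrite m1 m2 !ler0_norm; lra.
apply: (le_trans cl); apply: (le_trans fC).
have tl : `|x| - N <= tail N x by rewrite /tail le_max lexx.
rewrite -mulrA mulrCA ler_wpM2l//; lra.
Qed.

(** Weak neighbourhoods test bounded continuous functions only. Truncating [f] costs an amount that
    uniform integrability makes small for all the measures at once, which extends the passage to the
    limit to linear growth. *)
Lemma cluster_Ex_ge (F : set_system (probability R R)) mu f (a : R) : Filter F ->
  Theta mu -> lingrowth f ->
  (forall (n : nat) (fs : 'I_n -> R -> R) (eps : R), (forall i, Cb (fs i)) -> 0 < eps ->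
      forall A, F A -> A `&` weak_nbhs mu fs eps !=set0) ->
  (forall e : R, 0 < e -> F [set nu | Theta nu /\ a - e <= Ex nu f]) -> a <= Ex mu f.
Proof.
move=> FF Tmu lf cl HF; have [cf [C0 fC0]] := lf.
pose C := `|C0|; have fC x : `|f x| <= C * (1 + `|x|).
  by apply: (le_trans (fC0 x)); rewrite ler_wpM2r ?addr_ge0// ler_norm.
have C00 : 0 <= C by exact: normr_ge0.
apply: (@ler_eps _ _ _ (2 + 8 * C)) => e e0.
have [N N0 HN] := Ex_tail_le UI e0.
pose B := C * (1 + 2 * Num.max N 1).
have B0 : 0 <= B.
  by rewrite mulr_ge0// addr_ge0// mulr_ge0// le_max ler01 orbT.
have Cbf := Cb_clip B0 cf; have lt := lingrowth_tail (ltW N0).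
have lcl : lingrowth (clip B f) by apply: lingrowth_bcont.
have near nu : Theta nu -> `|Ex nu f - Ex nu (clip B f)| <= 4 * C * e.
  move=> Tnu; have le x := @clip_close B C N x f N0 C00 (fC x) erefl.
  have lb : Ex nu (fun x => 4 * C * tail N x) <= 4 * C * e.
    by rewrite (ExZ UI)// ler_wpM2l ?mulr_ge0// HN.
  have l4 := lingrowthZ (4 * C) lt.
  have h1 := Ex_le UI Tnu lf (lingrowthD lcl l4).
  have h2 := Ex_le UI Tnu lcl (lingrowthD lf l4).
  rewrite (ExD UI Tnu lcl l4) in h1; rewrite (ExD UI Tnu lf l4) in h2.
  have {}h1 : Ex nu f <= Ex nu (clip B f) + Ex nu (fun x => 4 * C * tail N x).
    by apply: h1 => x; have /ler_normlP[] := le x; lra.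
  have {}h2 : Ex nu (clip B f) <= Ex nu f + Ex nu (fun x => 4 * C * tail N x).
    by apply: h2 => x; have /ler_normlP[] := le x; lra.
  by rewrite ler_norml; apply/andP; split; lra.
have [nu [[Tnu nua] wn]] := cl 1%N (fun=> clip B f) e (fun=> Cbf) e0 _ (HF e e0).
have := wn ord0; rewrite (mint_Ex UI Tnu lcl) (mint_Ex UI Tmu lcl) -EFinB /= lte_fin.
move=> /ltr_normlP[w1 w2].
have /ler_normlP[a1 a2] := near nu Tnu; have /ler_normlP[b1 b2] := near mu Tmu.
lra.
Qed.

(** The sets [S e] generate a proper filter, and any cluster point of it works. Two functions are
    treated together so that a single limit measure is both optimal and satisfies the Stein
    inequality. *)
Lemma weakly_compact_attain f g (a b : R) : weakly_compact Theta ->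
  lingrowth f -> lingrowth g ->
  (forall e : R, 0 < e -> exists2 mu, Theta mu & a - e <= Ex mu f /\ b - e <= Ex mu g) ->
  exists2 mu, Theta mu & a <= Ex mu f /\ b <= Ex mu g.
Proof.
move=> wc lf lg H.
pose S (e : R) := [set nu | Theta nu /\ (a - e <= Ex nu f /\ b - e <= Ex nu g)].
pose F : set_system (probability R R) := [set A | exists2 e : R, 0 < e & S e `<=` A].
have FF : ProperFilter F.
  split.
    by case=> e e0 Se; have [mu Tmu Hmu] := H e e0; apply: (Se mu).
  split.
  - by exists 1.
  - move=> A A' [e e0 Se] [e' e'0 Se']; exists (Num.min e e'); first by rewrite lt_min e0.
    have l1 : Num.min e e' <= e by rewrite ge_min lexx.
    have l2 : Num.min e e' <= e' by rewrite ge_min lexx orbT.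
    by move=> nu [Tnu [h1 h2]]; split; [apply: Se|apply: Se']; split=> //; split; lra.
  - by move=> A A' AA' [e e0 Se]; exists e => //; exact: subset_trans AA'.
have FT : F Theta by exists 1 => // nu [].
have [mu Tmu cl] := wc F FF FT; exists mu => //; split.
  by apply: (cluster_Ex_ge _ Tmu lf cl) => e e0; exists e => // nu [Tnu []].
by apply: (cluster_Ex_ge _ Tmu lg cl) => e e0; exists e => // nu [Tnu []].
Qed.

End Sublinear.

(** * The Stein condition implies G-normality *)

Section Generator.
Variable R : realType.

Lemma Cb2_dilate (r : R) (f : R -> R) : Cb2 f ->
  [/\ Cb2 (fun y => f (r * y)), D1 (fun y => f (r * y)) = (fun y => r * D1 f (r * y)) &
   D2 (fun y => f (r * y)) = (fun y => r ^+ 2 * D2 f (r * y))].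
Proof.
move=> bf; have := Cb2_aff r 0 bf.
have E (g : R -> R) : (fun y => g (r * y + 0)) = (fun y => g (r * y)).
  by apply/funext => y; rewrite addr0.
rewrite E => -[a b c]; split; [exact: a|rewrite b|rewrite c]; apply/funext => y; by rewrite addr0.
Qed.

(* The remainder of [taylor_rm]: quadratic near [0], linear at infinity, where
   only first moments are controlled. *)
Definition rm (d y : R) : R := Num.min (`|d| * y ^+ 2) `|y|.

Lemma rm_ge0 d y : 0 <= rm d y.
Proof. by rewrite le_min normr_ge0 andbT mulr_ge0// sqr_ge0. Qed.

Lemma lingrowth_rm d : lingrowth (rm d).
Proof.
split.
  move=> x; apply: (@continuous_min R R (fun y => `|d| * y ^+ 2) (fun y => `|y|) x).
    by apply: cvgM; [exact: cvg_cst|exact: exprn_continuous].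
  exact: continuous_norm.
exists 1 => x; rewrite ger0_norm ?rm_ge0// mul1r.
by apply: (@le_trans _ _ `|x|); [rewrite ge_min lexx orbT|rewrite lerDr].
Qed.

(** By the mean value theorem the remainder is [d y (f'(c) - f'(x))]; the difference of derivatives
    is at most [K |d y|] and at most [2 K], which gives the two branches of [rm]. *)
Lemma taylor_rm (f : R -> R) (K x y d : R) : Cb2 f ->
  (forall z, `|D1 f z| <= K) -> (forall z, `|D2 f z| <= K) ->
  `|f (x + d * y) - f x - d * y * D1 f x| <= 2 * K * (`|d| * rm d y).
Proof.
move=> bf f1 f2; have [d1 d2 _] := Cb2D bf.
have K0 : 0 <= K := le_trans (normr_ge0 _) (f1 0).
have [c [cx E]] := mvt x (x + d * y) d1.
move: cx E; have -> : x + d * y - x = d * y by ring.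
move=> cx ->.
have -> : D1 f c * (d * y) - d * y * D1 f x = (d * y) * (D1 f c - D1 f x) by ring.
rewrite normrM.
have b1 : `|D1 f c - D1 f x| <= K * `|d * y|.
  by apply: (le_trans (lipschitz_of_derive d2 f2 c x)); rewrite ler_wpM2l.
have b2 : `|D1 f c - D1 f x| <= 2 * K.
  by apply: (le_trans (ler_normB _ _)); have := f1 c; have := f1 x; lra.
have -> : 2 * K * (`|d| * rm d y) = `|d| * (2 * K * rm d y) by ring.
have -> : `|d * y| * `|D1 f c - D1 f x| = `|d| * (`|y| * `|D1 f c - D1 f x|).
  by rewrite normrM mulrA.
apply: ler_wpM2l => //.
have y2 : `|y| ^+ 2 = y ^+ 2 by exact: real_normK (num_real y).
rewrite /rm; case: (leP (`|d| * y ^+ 2) `|y|) => _.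
  apply: (@le_trans _ _ (`|y| * (K * `|d * y|))); first by rewrite ler_wpM2l.
  rewrite normrM -y2; have := mulr_ge0 K0 (mulr_ge0 (normr_ge0 d) (sqr_ge0 `|y|)); lra.
by rewrite mulrC ler_wpM2r.
Qed.

Variables (G : R -> R) (s1 s2 : R).
Hypothesis s1_ge0 : 0 <= s1.
Hypothesis s12 : s1 <= s2.
Hypothesis GE : forall a, G a = Num.max (s1 * a) (s2 * a).

Let s2_ge0 : 0 <= s2. Proof. exact: le_trans s12. Qed.

Lemma G_lip a b : `|G a - G b| <= s2 * `|a - b|.
Proof.
have eG := G_elliptic s1_ge0 s12 GE.
have [ab|/ltW ba] := leP b a.
  by have [h1 h2] := eG _ _ ab; rewrite !ger0_norm ?subr_ge0//; rewrite -subr_ge0.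
have [h1 h2] := eG _ _ ba.
by rewrite distrC (distrC a) !ger0_norm ?subr_ge0//; rewrite -subr_ge0.
Qed.

Lemma G_cont : continuous G.
Proof.
move=> x; apply/cvgrPdist_lt => e e0.
near=> y; rewrite (le_lt_trans (G_lip _ _))//.
apply: (@le_lt_trans _ _ ((s2 + 1) * `|x - y|)); first by rewrite ler_wpM2r// lerDl.
rewrite -ltr_pdivlMl ?ltr_wpDl// mulrC; near: y.
by apply: cvgr_dist_lt => //; rewrite divr_gt0// ltr_wpDl.
Unshelve. all: by end_near. Qed.

Definition gen (f : R -> R) (y : R) : R := G (D2 f y) - y / 2 * D1 f y.

Lemma bcont_GD2 f : Cb2 f -> bcont (fun y => G (D2 f y)).
Proof.
move=> bf; have [d1 d2 c] := Cb2D bf; have [M M0 fM] := Cb2_bound bf; split.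
  by move=> x; apply: (@cvg_comp _ _ _ (D2 f) G); [exact: c|exact: G_cont].
exists (`|G 0| + s2 * M) => x.
have -> : G (D2 f x) = G 0 + (G (D2 f x) - G 0) by ring.
rewrite (le_trans (ler_normD _ _))// lerD// (le_trans (G_lip _ _))// subr0 ler_wpM2l//.
by have [_ []] := fM x.
Qed.

Lemma bcont_D1 (f : R -> R) : Cb2 f -> bcont (D1 f).
Proof.
move=> bf; have [d1 d2 c] := Cb2D bf; have [M M0 fM] := Cb2_bound bf; split.
  exact: is_derive_continuous d2.
by exists M => x; have [_ []] := fM x.
Qed.

Lemma lingrowth_idM (f : R -> R) : bcont f -> lingrowth (fun y => y * f y).
Proof.
move=> [cf [M fM]]; split.
  by move=> x; apply: cvgM; [exact: cvg_id|exact: cf].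
exists M => x; have M0 : 0 <= M := le_trans (normr_ge0 _) (fM 0).
rewrite normrM mulrC ler_pM//; by rewrite lerDr.
Qed.

Lemma lingrowth_gen f : Cb2 f -> lingrowth (gen f).
Proof.
move=> bf; have E : gen f = (fun y => G (D2 f y) + - 2^-1 * (y * D1 f y)).
  by apply/funext => y; rewrite /gen; ring.
rewrite E; apply: lingrowthD; first exact/lingrowth_bcont/bcont_GD2.
by apply: lingrowthZ; apply: lingrowth_idM; exact: bcont_D1.
Qed.

Section SteinLower.
Variables (Theta : set (probability R R)).
Hypothesis UI : unif_integrable Theta.
Hypothesis Theta0 : Theta !=set0.
Hypothesis stein_le : forall V, Cb2 V -> exists2 mu, Theta mu &
  Ex mu V = Nr Theta V /\ Ex mu (gen V) <= 0.

Let Nge mu f := @Nr_ge R Theta UI Theta0 mu f.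

Lemma Nr_dilate_lip (f : R -> R) (L m r s : R) : bcont f -> 0 <= L ->
  (forall x y, `|f x - f y| <= L * `|x - y|) ->
  (forall mu, Theta mu -> Ex mu (fun x : R => `|x|) <= m) ->
  Nr Theta (fun y => f (r * y)) <= Nr Theta (fun y => f (s * y)) + L * `|r - s| * m.
Proof.
move=> bf L0 fL Hm.
have bd t : bcont (fun y => f (t * y)).
  have [cf [M fM]] := bf; split; last by exists M.
  move=> x; apply: (@cvg_comp _ _ _ (fun y => t * y) f); last exact: cf.
  by apply: cvgM; [exact: cvg_cst|exact: cvg_id].
apply: Nr_le => // mu Tmu.
have lb t := lingrowth_bcont (bd t).
have ln := lingrowthZ (L * `|r - s|) (@lingrowth_norm R).
have := Ex_le UI Tmu (lb r) (lingrowthD (lb s) ln).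
rewrite (ExD UI Tmu (lb s) ln) (ExZ UI _ Tmu (@lingrowth_norm R)).
have h1 := Nge Tmu (bd s); have h2 := Hm mu Tmu.
have h3 := ler_wpM2l (mulr_ge0 L0 (normr_ge0 (r - s))) h2.
move=> h; apply: (@le_trans _ _ (Ex mu (fun y => f (s * y)) + L * `|r - s| * Ex mu (fun x : R => `|x|))).
  apply: h => y; have /ler_normlP[_] := fL (r * y) (s * y).
  by rewrite -mulrBl normrM mulrA; lra.
by rewrite lerD.
Qed.

(* Touching from above at a maximum of [Nr (V (r .)) - q r] over [r >= r0]
   bounds the derivative of [r |-> Ex mu (V (r .))] at the touching point for
   every optimal [mu]. *)
Lemma touching_slope mu (f : R -> R) (r1 A B X : R) : Theta mu -> Cb2 f ->
  Ex mu (fun y => f (r1 * y)) = Nr Theta (fun y => f (r1 * y)) ->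
  (forall d, 0 < d <= 1 -> Nr Theta (fun y => f ((r1 + d) * y)) - (B + d * A + d * (d * X)) <=
     Nr Theta (fun y => f (r1 * y)) - B) ->
  Ex mu (fun y => y * D1 f (r1 * y)) <= A.
Proof.
move=> Tmu bf opt touch; have [M M0 fM] := Cb2_bound bf.
have f1 z : `|D1 f z| <= M by have [_ []] := fM z.
have f2 z : `|D2 f z| <= M by have [_ []] := fM z.
have bdil r : bcont (fun y => f (r * y)) by apply: Cb2_bcont; case: (Cb2_dilate r bf).
have bD1 : bcont (fun y => D1 f (r1 * y)).
  have [c [K HK]] := bcont_D1 bf; split; last by exists K.
  move=> x; apply: (@cvg_comp _ _ _ (fun y => r1 * y) (D1 f)); last exact: c.
  by apply: cvgM; [exact: cvg_cst|exact: cvg_id].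
have l1 := lingrowth_idM bD1.
apply: (@ler_eps _ _ _ (`|X| + 2 * M)) => e e0.
have [d0 d00 Hd0] := Ex_min_sqr_le UI e0.
pose d := Num.min d0 (Num.min e 1).
have d_gt0 : 0 < d by rewrite !lt_min d00 e0 ltr01.
have dd0 : d <= d0 by rewrite /d ge_min lexx.
have de : d <= e by rewrite /d !ge_min lexx !orbT.
have d1 : d <= 1 by rewrite /d !ge_min lexx !orbT.
clearbody d.
have rme : Ex mu (rm d) <= e.
  apply: (Hd0 mu d) => //; [by rewrite (ltW d_gt0)|exact: lingrowth_rm|].
  by move=> x; rewrite /rm gtr0_norm.
have lrm := lingrowth_rm d.
have lR := lingrowthZ (2 * M * d) lrm.
have lD := lingrowthZ d l1.
have lV := lingrowth_bcont (bdil r1); have lVd := lingrowth_bcont (bdil (r1 + d)).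
have h1 : Ex mu (fun y => f (r1 * y)) + d * Ex mu (fun y => y * D1 f (r1 * y)) <=
    Ex mu (fun y => f ((r1 + d) * y)) + 2 * M * d * Ex mu (rm d).
  rewrite -(ExZ UI d Tmu l1) -(ExZ UI _ Tmu lrm) -(ExD UI Tmu lV lD) -(ExD UI Tmu lVd lR).
  apply: (Ex_le UI Tmu (lingrowthD lV lD) (lingrowthD lVd lR)) => y.
  have := taylor_rm (r1 * y) y d bf f1 f2; rewrite (gtr0_norm d_gt0) -mulrDl mulrA => /ler_normlP[+ _].
  lra.
have h2 := Nge Tmu (bdil (r1 + d)).
have h3 := touch d (introT andP (conj d_gt0 d1)).
have h4 : 2 * M * d * Ex mu (rm d) <= 2 * M * d * e by rewrite ler_wpM2l// !mulr_ge0// ltW.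
have h5 : d * (d * X) <= d * (e * `|X|).
  rewrite ler_wpM2l ?(ltW d_gt0)//; apply: (@le_trans _ _ (d * `|X|)).
    by rewrite ler_wpM2l ?(ltW d_gt0)// ler_norm.
  by rewrite ler_wpM2r.
rewrite -(ler_pM2l d_gt0); move: opt h1 h2 h3 h4 h5; lra.
Qed.

End SteinLower.

End Generator.

(** * Lower bound: touching the dilated expectations from above *)

Section LowerBound.
Variable R : realType.
Variable Theta : set (probability R R).
Hypothesis UI : unif_integrable Theta.
Hypothesis Theta0 : Theta !=set0.
Variables (G : R -> R) (s1 s2 : R).
Hypothesis s1_ge0 : 0 <= s1.
Hypothesis s12 : s1 <= s2.
Hypothesis GE : forall a, G a = Num.max (s1 * a) (s2 * a).

Lemma bcont_dilate (r : R) (f : R -> R) : bcont f -> bcont (fun y => f (r * y)).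
Proof.
move=> [cf [M fM]]; split; last by exists M.
move=> x; apply: (@cvg_comp _ _ _ (fun y => r * y) f); last exact: cf.
by apply: cvgM; [exact: cvg_cst|exact: cvg_id].
Qed.

Lemma Nr_bound (f : R -> R) (M : R) : bcont f -> (forall x, `|f x| <= M) -> `|Nr Theta f| <= M.
Proof.
move=> bf fM; rewrite ler_norml; apply/andP; split.
  rewrite -(Nr_cst UI Theta0 (- M)).
  have := Nr_shift UI Theta0 (Cb2_bcont (proj1 (Cb2_cst (- M)))) bf (c := 0); rewrite addr0; apply => x.
  by have /ler_normlP[] := fM x; rewrite addr0; lra.
rewrite -(Nr_cst UI Theta0 M).
have := Nr_shift UI Theta0 bf (Cb2_bcont (proj1 (Cb2_cst M))) (c := 0); rewrite !addr0; apply => x.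
by have /ler_normlP[] := fM x; lra.
Qed.

Lemma gen_dilate (r y : R) (f : R -> R) : Cb2 f ->
  gen G (fun y => f (r * y)) y = r ^+ 2 * G (D2 f (r * y)) - r / 2 * (y * D1 f (r * y)).
Proof.
move=> bf; have [_ d1 d2] := Cb2_dilate r bf.
by rewrite /gen d1 d2 (G_homog GE) ?sqr_ge0//; ring.
Qed.

Lemma quad_increment (z r d : R) : 0 <= r -> 0 < d <= 1 ->
  (z + 2 * r * d + d ^+ 2) ^+ 2 - z ^+ 2 <= d * (4 * z * r) + d * (d * (2 * `|z| + (2 * r + 1) ^+ 2)).
Proof.
move=> r0 /andP[d0 d1].
have -> : (z + 2 * r * d + d ^+ 2) ^+ 2 - z ^+ 2 =
  d * (4 * z * r) + d * (d * (2 * z + (2 * r + d) ^+ 2)) by ring.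
rewrite lerD2l !ler_pM2l// lerD//; first by rewrite ler_pM2l// ler_norm.
by rewrite ler_sqr ?nnegrE; lra.
Qed.

Lemma max_exceeding (F : R -> R) (r0 T : R) : 0 < r0 -> r0 <= T -> continuous F -> 0 < F r0 ->
  (forall r, T <= r -> F r <= 0) ->
  exists r1, [/\ r0 <= r1, 0 < F r1 & forall r, r1 <= r -> F r <= F r1].
Proof.
move=> r00 r0T cF F0 FT.
have [r1 + Hr1] := EVT_max r0T (@continuous_subspaceT _ _ `[r0, T]%classic F cF).
rewrite in_itv/= => /andP[r01 r1T].
have F1 : F r0 <= F r1 by apply: Hr1; rewrite in_itv/= lexx.
exists r1; split => //; first exact: lt_le_trans F1.
move=> r r1r; have [rT|/ltW rT] := leP r T; first by apply: Hr1; rewrite in_itv/= rT (le_trans r01).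
by rewrite (le_trans (FT _ rT))// ltW// (lt_le_trans F0).
Qed.

Section Step.
Hypothesis stein_le : forall V, Cb2 V -> exists2 mu, Theta mu &
  Ex mu V = Nr Theta V /\ Ex mu (gen G V) <= 0.

(** The touching function has slope [4 * beta * z * r1] at [r1], which bounds the slope of every
    optimal measure. One of them satisfies the Stein inequality, whence an expected diffusion of at
    most [2 * beta * z]; integrating [step] against that measure gives the claim. *)
Lemma touching_step (f g : R -> R) (h e M beta z r1 c : R) : Cb2 f -> bcont g -> 0 < r1 -> 0 < h ->
  0 <= beta ->
  (forall y, f y - h * G (D2 f y) - h * (e * M) <= g y) ->
  (forall d, 0 < d <= 1 -> Nr Theta (fun y => f ((r1 + d) * y)) -
     (c + beta * (z + 2 * r1 * d + d ^+ 2) ^+ 2) <=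
     Nr Theta (fun y => f (r1 * y)) - (c + beta * z ^+ 2)) ->
  Nr Theta (fun y => f (r1 * y)) <= Nr Theta (fun y => g (r1 * y)) + h * (2 * beta * z) + h * (e * M).
Proof.
move=> bf bg r10 h0 beta0 step touch.
have [bfr d1 d2] := Cb2_dilate r1 bf.
have [mu Tmu [opt genle]] := stein_le bfr.
have bG := bcont_dilate r1 (bcont_GD2 s1_ge0 s12 GE bf).
have lY := lingrowth_idM (bcont_dilate r1 (bcont_D1 bf)).
have lG := lingrowth_bcont bG.
have slope : Ex mu (fun y => y * D1 f (r1 * y)) <= beta * (4 * z * r1).
  apply: (touching_slope UI Theta0 (B := c + beta * z ^+ 2) (X := beta * (2 * `|z| + (2 * r1 + 1) ^+ 2)) Tmu bf opt) => d d01.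
  apply: le_trans (touch d d01); rewrite lerB// -!addrA lerD2l.
  have := ler_wpM2l beta0 (quad_increment z (ltW r10) d01); lra.
have genE : Ex mu (gen G (fun y => f (r1 * y))) =
    r1 ^+ 2 * Ex mu (fun y => G (D2 f (r1 * y))) + - (r1 / 2) * Ex mu (fun y => y * D1 f (r1 * y)).
  rewrite -(ExZ UI _ Tmu lG) -(ExZ UI _ Tmu lY) -(ExD UI Tmu (lingrowthZ _ lG) (lingrowthZ _ lY)).
  congr Ex; apply/funext => y; rewrite gen_dilate//; ring.
have EG : Ex mu (fun y => G (D2 f (r1 * y))) <= 2 * beta * z.
  have r2 : 0 < r1 ^+ 2 by rewrite exprn_gt0.
  rewrite -(ler_pM2l r2).
  have := ler_wpM2l (ltW r10) slope; rewrite genE in genle; lra.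
have lf := lingrowth_bcont (Cb2_bcont bfr).
have bgr := bcont_dilate r1 bg.
have lc := lingrowth_bcont (Cb2_bcont (proj1 (Cb2_cst (- (h * (e * M)))))).
have := Ex_le UI Tmu (lingrowthD lf (lingrowthD (lingrowthZ (- h) lG) lc)) (lingrowth_bcont bgr).
rewrite (ExD UI Tmu lf (lingrowthD (lingrowthZ (- h) lG) lc)) (ExD UI Tmu (lingrowthZ (- h) lG) lc).
rewrite (ExZ UI _ Tmu lG) Ex_cst opt => hle.
have {}hle : Nr Theta (fun y => f (r1 * y)) + (- h * Ex mu (fun y => G (D2 f (r1 * y))) + - (h * (e * M))) <=
  Ex mu (fun y => g (r1 * y)) by apply: hle => y; have := step (r1 * y); lra.
have := Nr_ge UI Theta0 Tmu bgr.
have := ler_wpM2l (ltW h0) EG; lra.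
Qed.

(* [beta (r^2 - 1 + k h)^2] is a discrete first-order barrier along the
   characteristics [r^2 + k h = 1]. *)
Lemma stein_lower_scheme (h e M L m eta beta : R) (v : nat -> R -> R) : scheme G h e v ->
  (forall x, `|D2 (v 0) x| <= M) -> 0 <= L -> (forall x y, `|v 0 x - v 0 y| <= L * `|x - y|) ->
  (forall mu, Theta mu -> Ex mu (fun x : R => `|x|) <= m) -> 0 <= m ->
  0 < eta -> 0 < beta -> (L * m) ^+ 2 <= 4 * eta * beta ->
  forall k r, 0 < r -> Nr Theta (fun y => v k (r * y)) <=
    Nr Theta (v 0) + eta + beta * ((r ^+ 2 - 1 + k%:R * h) ^+ 2 + k%:R * h ^+ 2) + k%:R * h * (e * M).
Proof.
move=> sv vM L0 vL Hm m0 eta0 beta0 hb.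
have [h0 e0 bv step] := sv.
have bc k : bcont (v k) by apply: Cb2_bcont.
have vkL := scheme_lipschitz s1_ge0 s12 GE sv vL.
have vkM := scheme_D2 s1_ge0 s12 GE sv vM.
have dil k (r s : R) := Nr_dilate_lip UI Theta0 r s (bc k) L0 (vkL k) Hm.
set alpha := Nr Theta (v 0).
elim => [|k IH] r r0.
  have E : (fun y => v 0 (1 * y)) = v 0 by apply/funext => y; rewrite mul1r.
  have := dil 0 r 1; rewrite E -/alpha => h1.
  have h2 : `|r - 1| <= `|r ^+ 2 - 1|.
    have -> : r ^+ 2 - 1 = (r - 1) * (r + 1) by ring.
    by rewrite normrM ler_peMr// ger0_norm; lra.
  rewrite !mul0r !addr0; set t := r ^+ 2 - 1 in h2 *.
  have t2 : `|t| ^+ 2 = t ^+ 2 by exact: real_normK (num_real t).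
  rewrite -t2; move: h1 h2; set w := `|r - 1|; set w' := `|t| => h1 h2.
  (* What remains is a Young inequality, for which [hb] is the discriminant condition. *)
  have h3 := ler_wpM2l (mulr_ge0 L0 m0) h2.
  suff h4 : L * m * w' <= eta + beta * w' ^+ 2 by lra.
  have w0 : 0 <= w' by exact: normr_ge0.
  have p0 : 0 <= eta + beta * w' ^+ 2 by rewrite addr_ge0 ?mulr_ge0 ?sqr_ge0// ltW.
  rewrite -ler_sqr ?nnegrE ?mulr_ge0// exprMn.
  have := ler_wpM2r (sqr_ge0 w') hb; have := sqr_ge0 (eta - beta * w' ^+ 2); lra.
have [M1 fM1] : exists M1, forall x, `|v k.+1 x| <= M1 by have [_] := bc k.+1.
pose c := alpha + eta + beta * (k.+1%:R * h ^+ 2) + k.+1%:R * h * (e * M).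
pose q r := c + beta * (r ^+ 2 - 1 + k.+1%:R * h) ^+ 2.
rewrite (_ : _ + _ = q r); last by rewrite /q /c; ring.
have [//|lt_q] := leP (Nr Theta (fun y => v k.+1 (r * y))) (q r); exfalso.
pose F r := Nr Theta (fun y => v k.+1 (r * y)) - q r.
have cF : continuous F.
  move=> x; apply: cvgB.
    apply/cvgrPdist_lt => d d0; near=> y.
    apply: (@le_lt_trans _ _ (L * m * `|x - y|)).
      rewrite ler_norml; have := dil k.+1 x y; have := dil k.+1 y x; rewrite (distrC y) => a b.
      by apply/andP; split; lra.
    apply: (@le_lt_trans _ _ ((L * m + 1) * `|x - y|)); first by rewrite ler_wpM2r// lerDl.
    rewrite -ltr_pdivlMl ?ltr_wpDl ?mulr_ge0// mulrC; near: y.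
    by apply: cvgr_dist_lt => //; rewrite divr_gt0// ltr_wpDl ?mulr_ge0.
  rewrite /q; apply: cvgD; first exact: cvg_cst.
  apply: cvgM; first exact: cvg_cst.
  apply: (@cvg_comp _ _ _ (fun r => r ^+ 2 - 1 + k.+1%:R * h) (fun z => z ^+ 2)); last exact: exprn_continuous.
  apply: cvgD; last exact: cvg_cst.
  by apply: cvgB; [exact: exprn_continuous|exact: cvg_cst].
(* Beyond [T] the barrier exceeds the bound [M1], so the excess attains a maximum on the half-line
   to the right of [r]. This half-line is enough, since touching only compares with larger radii. *)
pose T := 2 + r + `|M1 - c| / beta.
have T0 : 0 <= `|M1 - c| / beta by rewrite divr_ge0// ltW.
have kh : 0 <= k.+1%:R * h by rewrite mulr_ge0// ltW.
have FT s : T <= s -> F s <= 0.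
  rewrite /T => Ts.
  have h1 : Nr Theta (fun y => v k.+1 (s * y)) <= M1.
    have /ler_normlP[_] := @Nr_bound (fun y => v k.+1 (s * y)) M1 (bcont_dilate s (bc k.+1)) (fun y => fM1 _).
    by [].
  have h2 : M1 - c <= beta * s.
    apply: (le_trans (ler_norm _)); rewrite -ler_pdivrMl// mulrC; move: T0 r0 Ts; clear; lra.
  have h3 : s <= (s ^+ 2 - 1 + k.+1%:R * h) ^+ 2.
    set w := s ^+ 2 - 1 + _.
    have s2' : 2 <= s by move: T0 r0 Ts; clear; lra.
    have ss : 2 * s <= s ^+ 2 by rewrite expr2 ler_wpM2r//; lra.
    have w1 : s <= w by rewrite /w; lra.
    apply: (le_trans w1); rewrite expr2 ler_peMl//; lra.
  have := ler_wpM2l (ltW beta0) h3; rewrite /F /q; lra.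
have Fr : 0 < F r by rewrite /F subr_gt0.
have rT : r <= T by rewrite /T; lra.
have [r1 [rr1 F1 Hr1]] := max_exceeding r0 rT cF Fr FT.
have r10 : 0 < r1 by exact: lt_le_trans rr1.
have := IH r1 r10.
pose z := r1 ^+ 2 - 1 + k.+1%:R * h.
have sub y : v k.+1 y - h * G (D2 (v k.+1) y) - h * (e * M) <= v k y.
  rewrite -(step k y) mulrDr opprD addrA lerD2l lerN2 ler_pM2l// ler_pM2l//.
  by have /ler_normlP[] := vkM k.+1 y.
have tch d : 0 < d <= 1 -> Nr Theta (fun y => v k.+1 ((r1 + d) * y)) -
     (c + beta * (z + 2 * r1 * d + d ^+ 2) ^+ 2) <=
     Nr Theta (fun y => v k.+1 (r1 * y)) - (c + beta * z ^+ 2).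
  move=> /andP[d0 d1]; have := Hr1 (r1 + d); rewrite lerDl (ltW d0) => /(_ isT).
  rewrite /F /q -/z (_ : (r1 + d) ^+ 2 - 1 + k.+1%:R * h = z + 2 * r1 * d + d ^+ 2)//.
  by rewrite /z; ring.
have := touching_step (bv k.+1) (bc k) r10 h0 (ltW beta0) sub tch.
have -> : r1 ^+ 2 - 1 + k%:R * h = z - h by rewrite /z -(natr1 k); ring.
move: F1; rewrite /F /q -/z subr_gt0 /c -!(natr1 k); lra.
Unshelve. all: by end_near. Qed.

(** At the last step the characteristic has reached radius [0], where the dilated function is the
    constant [v n.+1 0]. The scheme estimate concerns positive radii, so a radius [s] is sent to [0]
    through the Lipschitz bound in the dilation. *)
Lemma stein_lower (e M L m eta beta : R) (n : nat) (v : nat -> R -> R) :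
  scheme G n.+1%:R^-1 e v ->
  (forall x, `|D2 (v 0) x| <= M) -> 0 <= L -> (forall x y, `|v 0 x - v 0 y| <= L * `|x - y|) ->
  (forall mu, Theta mu -> Ex mu (fun x : R => `|x|) <= m) -> 0 <= m ->
  0 < eta -> 0 < beta -> (L * m) ^+ 2 <= 4 * eta * beta ->
  v n.+1 0 <= Nr Theta (v 0) + eta + beta / n.+1%:R + e * M.
Proof.
move=> sv vM L0 vL Hm m0 eta0 beta0 hb.
have [h0 e0 bv step] := sv.
have vkL := scheme_lipschitz s1_ge0 s12 GE sv vL.
have bc := Cb2_bcont (bv n.+1).
have n0 : n.+1%:R != 0 :> R by rewrite pnatr_eq0.
apply: (@ler_eps _ _ _ (L * m + beta)) => r r0.
pose s := Num.min r 1.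
have s0 : 0 < s by rewrite lt_min r0 ltr01.
have s1' : s <= 1 by rewrite /s ge_min lexx orbT.
have sr : s <= r by rewrite /s ge_min lexx.
clearbody s.
have h1 := Nr_dilate_lip UI Theta0 0 s bc L0 (vkL n.+1) Hm.
have := stein_lower_scheme sv vM L0 vL Hm m0 eta0 beta0 hb n.+1 s0.
have E : (fun y : R => v n.+1 (0 * y)) = (fun=> v n.+1 0) by apply/funext => y; rewrite mul0r.
rewrite E (Nr_cst UI Theta0) in h1.
rewrite divff// subrK mul1r.
have -> : n.+1%:R * n.+1%:R^-1 ^+ 2 = n.+1%:R^-1 :> R by field.
rewrite sub0r normrN gtr0_norm// in h1.
have s4 : (s ^+ 2) ^+ 2 <= s.
  rewrite -exprM (_ : (2 * 2)%N = 3.+1)// exprS ler_piMr ?(ltW s0)//.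
  by rewrite exprn_ile1// ltW.
have := ler_wpM2l (ltW beta0) s4.
have := ler_wpM2l (mulr_ge0 L0 m0) sr; have := ler_wpM2l (ltW beta0) sr.
move: h1; set A := Nr _ _; set N := n.+1%:R^-1; clear; lra.
Qed.

End Step.
End LowerBound.

(** * Smoothing by a linear resolvent *)

Section Smoothing.
Variable R : realType.

(** The resolvent serves as a mollifier: it preserves sup, Lipschitz and second-derivative bounds,
    and [D2 w = (w - v) / lam] inherits from [v] and [w] a Lipschitz modulus in space and a small
    increment between steps. *)
Lemma smoothing_exists (lam : R) (v : R -> R) : 0 < lam -> bcont v ->
  exists2 w, Cb2 w & forall x, w x - lam * D2 w x = v x.
Proof.
move=> lam0 bv; have l0 : 0 < lam^-1 by rewrite invr_gt0.
have [cv [M vM]] := bv.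
have bg : bcont (fun x => lam^-1 * v x).
  split; first by move=> x; apply: cvgM; [exact: cvg_cst|exact: cv].
  by exists (lam^-1 * M) => x; rewrite normrM gtr0_norm// ler_pM2l.
have [w bw Ew] := bounded_ode2 l0 bg; exists w; first exact: bw.
move=> x; have E : D2 w x = lam^-1 * w x - lam^-1 * v x by rewrite -(Ew x); ring.
by rewrite E; field; rewrite gt_eqF.
Qed.

Lemma smoothing_le (lam c : R) (f g : R -> R) : 0 < lam -> Cb2 f -> Cb2 g ->
  (forall x, f x - lam * D2 f x <= g x - lam * D2 g x + c) -> forall x, f x <= g x + c.
Proof. move=> lam0 bf bg H; exact: (resolvent_le (@elliptic_id R) (ltW lam0) bf bg H). Qed.

Section Bounds.
Variables (lam M : R) (v w : R -> R).
Hypothesis lam0 : 0 < lam.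
Hypothesis bv : Cb2 v.
Hypothesis bw : Cb2 w.
Hypothesis wv : forall x, w x - lam * D2 w x = v x.

Lemma smoothing_D2E x : D2 w x = (w x - v x) / lam.
Proof. by rewrite -(wv x); field; rewrite gt_eqF. Qed.

Lemma smoothing_D2 : (forall x, `|D2 v x| <= M) -> forall x, `|D2 w x| <= M.
Proof.
move=> vM x.
have h1 : v x <= w x + lam * M.
  apply: (smoothing_le lam0 bv bw) => y; rewrite wv lerD2l -mulrN ler_pM2l//.
  by have /ler_normlP[] := vM y.
have h2 : w x <= v x + lam * M.
  apply: (smoothing_le lam0 bw bv) => y; rewrite wv -addrA lerDl -mulrN -mulrDr mulr_ge0 ?(ltW lam0)//.
  by have /ler_normlP[_] := vM y; lra.
by rewrite smoothing_D2E normrM normfV (gtr0_norm lam0) ler_pdivrMr// ler_norml; apply/andP; split; lra.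
Qed.

Lemma smoothing_lipschitz (L : R) : (forall x y, `|v x - v y| <= L * `|x - y|) ->
  forall x y, `|w x - w y| <= L * `|x - y|.
Proof.
move=> vL.
have H x y : w x <= w y + L * `|x - y|.
  have [bt _ t2] := Cb2_aff 1 (y - x) bw.
  have : w x <= w (1 * x + (y - x)) + L * `|x - y|.
    apply: (smoothing_le lam0 bw bt) => z; rewrite t2 wv.
    have := wv (1 * z + (y - x)); have /ler_normlP[_] := vL z (1 * z + (y - x)).
    by rewrite (_ : z - (1 * z + (y - x)) = x - y); [lra|ring].
  by rewrite (_ : 1 * x + (y - x) = y); [|ring].
move=> x y; have := H x y; have := H y x; rewrite (distrC y) => a b.
by rewrite ler_norml; apply/andP; split; lra.
Qed.

End Bounds.

Lemma smoothing_contract (lam c : R) (v w v' w' : R -> R) : 0 < lam -> Cb2 w -> Cb2 w' ->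
  (forall x, w x - lam * D2 w x = v x) -> (forall x, w' x - lam * D2 w' x = v' x) ->
  (forall x, `|v x - v' x| <= c) -> forall x, `|w x - w' x| <= c.
Proof.
move=> lam0 bw bw' E E' H x.
have a : w x <= w' x + c.
  by apply: (smoothing_le lam0 bw bw') => y; rewrite E E'; have /ler_normlP[] := H y; lra.
have b : w' x <= w x + c.
  by apply: (smoothing_le lam0 bw' bw) => y; rewrite E E'; have /ler_normlP[] := H y; lra.
by rewrite ler_norml; apply/andP; split; lra.
Qed.

Variables (G : R -> R) (s1 s2 : R).
Hypothesis s1_ge0 : 0 <= s1.
Hypothesis s12 : s1 <= s2.
Hypothesis GE : forall a, G a = Num.max (s1 * a) (s2 * a).

(* By convexity of [G], smoothing a scheme yields a supersolution. *)
Lemma smoothing_supersol (lam h e M : R) (v w : nat -> R -> R) (k : nat) : 0 < lam ->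
  scheme G h e v -> (forall x, `|D2 (v 0) x| <= M) -> (forall k, Cb2 (w k)) ->
  (forall k x, w k x - lam * D2 (w k) x = v k x) ->
  forall x, w k x + h * G (D2 (w k.+1) x) - h * (e * M) <= w k.+1 x.
Proof.
move=> lam0 sv vM bw wv x; have [h0 e0 bv step] := sv.
have vkM := scheme_D2 s1_ge0 s12 GE sv vM.
(* [G] is the larger of two lines lying below it, and linear inequalities commute with the
   resolvent; each line is treated separately. *)
have key s : (forall a, s * a <= G a) ->
    w k x + h * (s * D2 (w k.+1) x) <= w k.+1 x + h * (e * M).
  move=> sG; have [b1 E1] := Cb2_sub (bw k.+1) (bv k.+1).
  (* The function compared is [w k + h s D2 (w k.+1)]; writing [D2 (w k.+1)] as
     [(w k.+1 - v k.+1) / lam] shows that it is bounded C^2. *)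
  have [b2 _ E2] := C2_op 1 (h * s / lam) (bw k) b1.
  have : 1 * w k x + h * s / lam * (w k.+1 x - v k.+1 x) <= w k.+1 x + h * (e * M).
    apply: (smoothing_le lam0 b2 (bw k.+1)) => z; rewrite E2 E1 wv.
    have -> : 1 * w k z + h * s / lam * (w k.+1 z - v k.+1 z) -
        lam * (1 * D2 (w k) z + h * s / lam * (D2 (w k.+1) z - D2 (v k.+1) z)) =
        v k z + h * (s * D2 (v k.+1) z).
      rewrite -(wv k z) -(wv k.+1 z); field; by rewrite gt_eqF.
    rewrite -(step k z) (_ : _ + _ = v k.+1 z + h * (s * D2 (v k.+1) z - G (D2 (v k.+1) z) - e * D2 (v k.+1) z)); last by ring.
    rewrite lerD2l ler_pM2l//.
    have := sG (D2 (v k.+1) z); have /ler_normlP[a _] := vkM k.+1 z.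
    have := ler_wpM2l (ltW e0) a; lra.
  rewrite mul1r (smoothing_D2E lam0 (wv k.+1)); apply: le_trans.
  rewrite le_eqVlt; apply/orP; left; apply/eqP; congr (_ + _); field; by rewrite gt_eqF.
rewrite lerBlDr GE; set a := D2 (w k.+1) x.
by case: (leP (s1 * a) (s2 * a)) => _; apply: key => b; rewrite GE le_max lexx ?orbT.
Qed.

End Smoothing.

Lemma lipschitz_D1_bound (R : realType) (f : R -> R) (L M : R) : Cb2 f ->
  (forall x y, `|f x - f y| <= L * `|x - y|) -> (forall x, `|D2 f x| <= M) ->
  forall x, `|D1 f x| <= L + M.
Proof.
move=> bf fL fM x; have [d1 d2 _] := Cb2D bf.
have [c [cx E]] := mvt x (x + 1) d1; move: cx E.
rewrite (_ : x + 1 - x = 1); last by ring.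
rewrite normr1 mulr1 => cx E.
have h1 : `|D1 f c| <= L.
  rewrite -E (le_trans (fL _ _))// (_ : x + 1 - x = 1); last by ring.
  by rewrite normr1 mulr1.
have M0 : 0 <= M := le_trans (normr_ge0 _) (fM 0).
have h2 := lipschitz_of_derive d2 fM x c.
have h3 := ler_wpM2l M0 cx.
have -> : D1 f x = D1 f c + (D1 f x - D1 f c) by ring.
by rewrite (le_trans (ler_normD _ _))// lerD// (le_trans h2)// distrC (le_trans h3)// mulr1.
Qed.

(** Here [i] is [1 / r] and [D] the decrease of the radius. Since [h i / 2 = D - D^2 i / 2], the
    Stein inequality divided by [r^2] cancels [D * E1] to first order, leaving a term in [eta] and
    one in [D^2]. *)
Lemma dilation_step_arith (R : realType) (h D r i c E1 E2 K m eta : R) : 0 <= D -> 0 < h -> 0 <= c -> 0 <= eta ->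
  0 <= i -> i * r = 1 -> i <= 2 * c -> h = D * (2 * r - D) -> D <= h * c ->
  `|E1| <= K * m -> - eta <= r ^+ 2 * E2 - r / 2 * E1 ->
  - (D * E1) + h * E2 >= - (h * (4 * c ^+ 2 * eta + K * m * h * c ^+ 3)).
Proof.
move=> D0 h0 c0 eta0 i0 ir ic hD Dc HE HG.
have h1 : h * E2 >= h * i * E1 / 2 - h * eta * i ^+ 2.
  have := ler_wpM2l (mulr_ge0 (ltW h0) (sqr_ge0 i)) HG.
  rewrite (_ : h * i ^+ 2 * (r ^+ 2 * E2 - r / 2 * E1) = h * E2 * (i * r) ^+ 2 - h * i * E1 / 2 * (i * r)); last by field.
  by rewrite ir expr1n !mulr1; lra.
have h2 : h * i * E1 / 2 = D * E1 - D ^+ 2 * i * E1 / 2.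
  rewrite [in LHS]hD (_ : D * (2 * r - D) * i * E1 / 2 = D * E1 * (i * r) - D ^+ 2 * i * E1 / 2); last by field.
  by rewrite ir mulr1.
have Km : 0 <= K * m := le_trans (normr_ge0 _) HE.
have h3 : i ^+ 2 <= 4 * c ^+ 2.
  by rewrite (_ : 4 * c ^+ 2 = (2 * c) ^+ 2); [rewrite ler_sqr ?nnegrE// mulr_ge0|ring].
have h4 : D ^+ 2 <= h ^+ 2 * c ^+ 2.
  by rewrite -exprMn ler_sqr ?nnegrE// mulr_ge0// ltW.
have h5 : D ^+ 2 * i <= h ^+ 2 * c ^+ 2 * (2 * c) by rewrite ler_pM// sqr_ge0.
have h6 : D ^+ 2 * i * E1 <= h ^+ 2 * c ^+ 2 * (2 * c) * (K * m).
  apply: le_trans (ler_norm _) _; rewrite normrM ger0_norm ?mulr_ge0 ?sqr_ge0//.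
  by rewrite ler_pM// mulr_ge0 ?sqr_ge0.
have h7 := ler_wpM2l (mulr_ge0 (ltW h0) eta0) h3.
move: h1 h2 h6 h7; clear; nra.
Qed.

(** * Upper bound: following the characteristics *)

Section UpperBound.
Variable R : realType.
Variable Theta : set (probability R R).
Hypothesis UI : unif_integrable Theta.
Hypothesis Theta0 : Theta !=set0.
Variables (G : R -> R) (s1 s2 : R).
Hypothesis s1_ge0 : 0 <= s1.
Hypothesis s12 : s1 <= s2.
Hypothesis GE : forall a, G a = Num.max (s1 * a) (s2 * a).
Hypothesis stein_ge : forall V eta, Cb2 V -> 0 < eta -> exists2 mu, Theta mu &
  Ex mu V = Nr Theta V /\ - eta <= Ex mu (gen G V).

(** A measure optimal for [f (r0 .)] is tested on [g (r1 .)]. Taylor expansion in the radius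
    produces [- D * E1], the supersolution inequality produces [h * E2] once [D2 g (r1 y)] is
    replaced by [D2 f (r0 y)], and the Stein inequality balances the two. The factor [c] enters
    through [r0 + r1 >= 2 * rho], which gives [r0 - r1 <= h * c]. *)
Lemma upper_step (f g : R -> R) (h b r0 r1 rho K m eta eps A1 A2 : R) :
  let c := (2 * rho)^-1 in
  Cb2 f -> Cb2 g -> (forall x, `|D1 f x| <= K) -> (forall x, `|D2 f x| <= K) ->
  (forall x, f x + h * G (D2 g x) - h * b <= g x) ->
  (forall x y, `|D2 g x - D2 f y| <= h * A1 + A2 * `|x - y|) -> 0 <= A2 ->
  0 < rho -> rho <= r1 -> r1 <= r0 -> r0 ^+ 2 = r1 ^+ 2 + h -> 0 < h ->
  (forall mu, Theta mu -> Ex mu (fun x : R => `|x|) <= m) ->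
  (forall mu d, Theta mu -> `|d| <= h * c -> Ex mu (rm d) <= eps) -> 0 <= eps -> 0 < eta ->
  Nr Theta (fun y => f (r0 * y)) <= Nr Theta (fun y => g (r1 * y)) +
    h * (b + 4 * c ^+ 2 * eta + 2 * c * K * eps + s2 * (h * A1 + A2 * h * c * m) + K * m * h * c ^+ 3).
Proof.
move=> c bf bg f1 f2 fg fg2 A20 rho0 rr1 r10 E h0 Hm Hrm eps0 eta0.
have s2_ge0 : 0 <= s2 := le_trans s1_ge0 s12.
have r1p : 0 < r1 by exact: lt_le_trans rr1.
have r0p : 0 < r0 by exact: lt_le_trans r10.
have [bfr _ _] := Cb2_dilate r0 bf; have [bgr _ _] := Cb2_dilate r1 bg.
have [mu Tmu [opt genge]] := stein_ge bfr eta0.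
have K0 : 0 <= K := le_trans (normr_ge0 _) (f1 0).
pose D := r0 - r1.
have D0 : 0 <= D by rewrite subr_ge0.
have c0 : 0 < c by rewrite invr_gt0 mulr_gt0.
have hD : h = D * (2 * r0 - D) by rewrite (_ : _ * _ = r0 ^+ 2 - r1 ^+ 2); [rewrite E; ring|rewrite /D; ring].
have Dc : D <= h * c.
  rewrite /c ler_pdivlMr ?mulr_gt0// hD ler_wpM2l//; rewrite /D; move: rr1 r10; clear -UI Theta0 s1_ge0 s12 GE stein_ge; lra.
have bG := bcont_dilate r0 (bcont_GD2 s1_ge0 s12 GE bf).
have lG := lingrowth_bcont bG.
have lY := lingrowth_idM (bcont_dilate r0 (bcont_D1 bf)).
have ln := @lingrowth_norm R.
have lr := lingrowth_rm (- D).
set E1 := Ex mu (fun y => y * D1 f (r0 * y)).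
set E2 := Ex mu (fun y => G (D2 f (r0 * y))).
have genE : Ex mu (gen G (fun y => f (r0 * y))) = r0 ^+ 2 * E2 + - (r0 / 2) * E1.
  rewrite -(ExZ UI _ Tmu lG) -(ExZ UI _ Tmu lY) -(ExD UI Tmu (lingrowthZ _ lG) (lingrowthZ _ lY)).
  congr Ex; apply/funext => y; rewrite (gen_dilate GE)//; ring.
have HE1 : `|E1| <= K * m.
  have a := Ex_le UI Tmu lY (lingrowthZ K ln).
  have b' := Ex_le UI Tmu (lingrowthZ (- K) ln) lY.
  rewrite (ExZ UI _ Tmu ln) in a; rewrite (ExZ UI _ Tmu ln) in b'.
  have h1 := ler_wpM2l K0 (Hm mu Tmu).
  have pt y : `|y * D1 f (r0 * y)| <= K * `|y| by rewrite normrM mulrC ler_wpM2r.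
  have a' : E1 <= K * Ex mu (fun x : R => `|x|) by apply: a => y; have /ler_normlP[] := pt y; lra.
  have b'' : - K * Ex mu (fun x : R => `|x|) <= E1 by apply: b' => y; have /ler_normlP[] := pt y; lra.
  by rewrite ler_norml; apply/andP; split; lra.
have i0 : 0 < r0^-1 by rewrite invr_gt0.
have ic : r0^-1 <= 2 * c.
  rewrite /c invfM mulrA divff// mul1r lef_pV2 ?posrE//; exact: le_trans r10.
have HG : - eta <= r0 ^+ 2 * E2 - r0 / 2 * E1 by rewrite genE in genge; move: genge; clear -UI Theta0 s1_ge0 s12 GE stein_ge; lra.
have ar := dilation_step_arith D0 h0 (ltW c0) (ltW eta0) (ltW i0) (mulVf (lt0r_neq0 r0p)) ic hD Dc HE1 HG.
pose k0 := - (h * b) - h * s2 * (h * A1).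
have lk := lingrowth_bcont (Cb2_bcont (proj1 (Cb2_cst k0))).
have lf := lingrowth_bcont (Cb2_bcont bfr).
have lY' := lingrowthZ (- D) lY; have lG' := lingrowthZ h lG.
have lr' := lingrowthZ (- (2 * K * D)) lr; have ln' := lingrowthZ (- (h * s2 * A2 * D)) ln.
have l1 := lingrowthD lr' (lingrowthD ln' lk); have l2 := lingrowthD lG' l1.
have l3 := lingrowthD lY' l2; have l4 := lingrowthD lf l3.
have := Ex_le UI Tmu l4 (lingrowth_bcont (Cb2_bcont bgr)).
rewrite (ExD UI Tmu lf l3) (ExD UI Tmu lY' l2) (ExD UI Tmu lG' l1) (ExD UI Tmu lr' (lingrowthD ln' lk)).
rewrite (ExD UI Tmu ln' lk) Ex_cst (ExZ UI _ Tmu lY) (ExZ UI _ Tmu lG) (ExZ UI _ Tmu lr) (ExZ UI _ Tmu ln).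
rewrite -/E1 -/E2 opt => main.
have nD : `|- D| = D by rewrite normrN ger0_norm.
have {}main : Nr Theta (fun y => f (r0 * y)) + (- D * E1 + (h * E2 + (- (2 * K * D) * Ex mu (rm (- D)) +
   (- (h * s2 * A2 * D) * Ex mu (fun x : R => `|x|) + k0)))) <= Ex mu (fun y => g (r1 * y)).
  apply: main => y; rewrite /k0.
  have t1 := fg (r1 * y).
  have t2 := taylor_rm (r0 * y) y (- D) bf f1 f2.
  rewrite nD -mulrDl (_ : r0 + - D = r1) in t2; last by rewrite /D; ring.
  have t3 := G_lip s1_ge0 s12 GE (D2 g (r1 * y)) (D2 f (r0 * y)).
  have t4 := fg2 (r1 * y) (r0 * y).
  have t5 : `|r1 * y - r0 * y| = D * `|y|.
    by rewrite (_ : r1 * y - r0 * y = - D * y); [rewrite normrM nD|rewrite /D; ring].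
  rewrite t5 in t4; have {}t4 := ler_wpM2l s2_ge0 t4.
  have {}t3 := le_trans t3 t4.
  have /ler_normlP[{}t3 _] := t3; have {}t3 := ler_wpM2l (ltW h0) t3.
  have /ler_normlP[{}t2 _] := t2.
  move: t1 t2 t3; clear -UI Theta0 s1_ge0 s12 GE stein_ge; lra.
have n1 := Nr_ge UI Theta0 Tmu (Cb2_bcont bgr).
have n2 : 2 * K * D * Ex mu (rm (- D)) <= 2 * K * (h * c) * eps.
  have e1 : Ex mu (rm (- D)) <= eps by apply: Hrm => //; rewrite nD.
  apply: (@le_trans _ _ (2 * K * D * eps)); first by rewrite ler_wpM2l// !mulr_ge0.
  by rewrite ler_wpM2r// ler_wpM2l// mulr_ge0.
have n3 : h * s2 * A2 * D * Ex mu (fun x : R => `|x|) <= h * s2 * A2 * (h * c) * m.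
  have q0 : 0 <= h * s2 * A2 by rewrite !mulr_ge0// ltW.
  have m0 : 0 <= m.
    by apply: (le_trans _ (Hm mu Tmu)); rewrite -(Ex_cst mu 0) (Ex_le UI Tmu)//; exact: lingrowth_bcont (Cb2_bcont (proj1 (Cb2_cst 0))).
  apply: (@le_trans _ _ (h * s2 * A2 * D * m)); first by rewrite ler_wpM2l ?Hm// mulr_ge0.
  by rewrite ler_wpM2r// ler_wpM2l.
move: main ar n1 n2 n3; rewrite /k0; clear -UI Theta0 s1_ge0 s12 GE stein_ge; lra.
Qed.

(** The one-step estimates are summed along [r k = sqrt (1 - k h)]. The speed of this radius blows
    up at [0], so the walk stops while the radius is at least [rho]; the Lipschitz bound covers the
    rest. *)
Lemma stein_upper_scheme (h e M L m lam rho eta eps : R) (v : nat -> R -> R) (n : nat) :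
  let c := (2 * rho)^-1 in
  scheme G h e v ->
  (forall x, `|D2 (v 0) x| <= M) -> 0 <= L -> (forall x y, `|v 0 x - v 0 y| <= L * `|x - y|) ->
  (forall mu, Theta mu -> Ex mu (fun x : R => `|x|) <= m) -> 0 < lam -> 0 < rho ->
  (forall mu d, Theta mu -> `|d| <= h * c -> Ex mu (rm d) <= eps) -> 0 <= eps -> 0 < eta ->
  n%:R * h <= 1 - rho ^+ 2 ->
  Nr Theta (v 0) <= v n 0 + 2 * (lam * M) + L * m * Num.sqrt (1 - n%:R * h) +
    n%:R * h * (e * M + 4 * c ^+ 2 * eta + 2 * c * (L + M) * eps +
     s2 * (h * (2 * ((s2 + e) * M) / lam) + 2 * L / lam * h * c * m) + (L + M) * m * h * c ^+ 3).
Proof.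
move=> c sv vM L0 vL Hm lam0 rho0 Hrm eps0 eta0 nh.
have [h0 e0 bv step] := sv.
have /choice[w Hw] : forall k, exists w, Cb2 w /\ forall x, w x - lam * D2 w x = v k x.
  by move=> k; have [w bw Ew] := smoothing_exists lam0 (Cb2_bcont (bv k)); exists w.
have bw k : Cb2 (w k) := proj1 (Hw k).
have wv k x : w k x - lam * D2 (w k) x = v k x := proj2 (Hw k) x.
have vkM := scheme_D2 s1_ge0 s12 GE sv vM.
have vkL := scheme_lipschitz s1_ge0 s12 GE sv vL.
have vinc := scheme_increment s1_ge0 s12 GE sv vM.
have wM k := smoothing_D2 lam0 (bv k) (bw k) (wv k) (vkM k).
have wL k := smoothing_lipschitz lam0 (bw k) (wv k) (vkL k).
have w1 k := lipschitz_D1_bound (bw k) (wL k) (wM k).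
have M0 : 0 <= M := le_trans (normr_ge0 _) (vM 0).
have w2 k x : `|D2 (w k) x| <= L + M by rewrite (le_trans (wM k x))// lerDr.
have winc k := smoothing_contract lam0 (bw k.+1) (bw k) (wv k.+1) (wv k) (vinc k).
have wvM k x : `|w k x - v k x| <= lam * M.
  by rewrite -(wv k x) opprB addrCA subrr addr0 normrM gtr0_norm// ler_pM2l.
pose C := (s2 + e) * M.
have dd k x y : `|D2 (w k.+1) x - D2 (w k) y| <= h * (2 * C / lam) + 2 * L / lam * `|x - y|.
  rewrite (smoothing_D2E lam0 (wv k.+1)) (smoothing_D2E lam0 (wv k)).
  rewrite (_ : _ - _ = ((w k.+1 x - w k x) + (w k x - w k y) - (v k.+1 x - v k x) - (v k x - v k y)) / lam); last by ring.
  rewrite normrM normfV (gtr0_norm lam0) ler_pdivrMr//.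
  rewrite (_ : (_ + _) * lam = 2 * (h * C) + 2 * (L * `|x - y|)); last by field; rewrite gt_eqF.
  have /ler_normlP[a1 a2] := winc k x; have /ler_normlP[a3 a4] := wL k x y.
  have /ler_normlP[a5 a6] := vinc k x; have /ler_normlP[a7 a8] := vkL k x y.
  rewrite ler_norml; apply/andP; move: a1 a2 a3 a4 a5 a6 a7 a8; rewrite -/C; clear -UI Theta0 s1_ge0 s12 GE stein_ge; split; lra.
pose r k := Num.sqrt (1 - k%:R * h).
have rE k : (k <= n)%N -> r k ^+ 2 = 1 - k%:R * h.
  move=> kn; rewrite /r sqr_sqrtr//.
  have : k%:R * h <= n%:R * h by rewrite ler_pM2r// ler_nat.
  have := sqr_ge0 rho; lra.
have r_rho k : (k <= n)%N -> rho <= r k.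
  move=> kn; rewrite -(ger0_norm (ltW rho0)) -sqrtr_sqr ler_wsqrtr//.
  have : k%:R * h <= n%:R * h by rewrite ler_pM2r// ler_nat.
  lra.
pose a k := Nr Theta (fun y => w k (r k * y)).
set err := (X in n%:R * h * X).
have a_step k : (k < n)%N -> a k <= a k.+1 + h * err.
  move=> kn; have US := @upper_step (w k) (w k.+1) h (e * M) (r k) (r k.+1) rho (L + M) m eta eps (2 * C / lam) (2 * L / lam).
  apply: US => //.
  - exact: (smoothing_supersol s1_ge0 s12 GE k lam0 sv vM bw wv).
  - by rewrite mulr_ge0 ?invr_ge0 ?(ltW lam0)// mulr_ge0.
  - exact: r_rho.
  - by rewrite ler_wsqrtr// lerB// ler_pM2r// ler_nat.
  - by rewrite rE ?(ltnW kn)// rE// -(natr1 k); ring.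
clearbody err.
have a_sum k : (k <= n)%N -> a 0 <= a k + k%:R * h * err.
  elim: k => [|k IH] kn; first by rewrite mul0r mul0r addr0.
  apply: (le_trans (IH (ltnW kn))); rewrite -(natr1 k) !mulrDl mul1r addrCA addrC lerD2r.
  exact: a_step.
have a0 : a 0 = Nr Theta (w 0).
  by congr Nr; apply/funext => y; rewrite /r mul0r subr0 sqrtr1 mul1r.
have i1 : Nr Theta (v 0) <= Nr Theta (w 0) + lam * M.
  apply: (Nr_shift UI Theta0 (Cb2_bcont (bv 0)) (Cb2_bcont (bw 0))) => x.
  by have /ler_normlP[] := wvM 0 x; lra.
have i2 := Nr_dilate_lip UI Theta0 (r n) 0 (Cb2_bcont (bw n)) L0 (wL n) Hm.
have E0 : (fun y : R => w n (0 * y)) = (fun=> w n 0) by apply/funext => y; rewrite mul0r.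
rewrite E0 (Nr_cst UI Theta0) subr0 (ger0_norm (sqrtr_ge0 _)) -/(a n) in i2.
have i3 := a_sum n (leqnn n); rewrite a0 in i3.
have /ler_normlP[_ i4] := wvM n 0.
move: i1 i2 i3 i4; rewrite /r; set S := Num.sqrt _; clear -UI Theta0 s1_ge0 s12 GE stein_ge; lra.
Qed.

End UpperBound.

Lemma ler_eps1 (R : realType) (A B C : R) : (forall b, 0 < b -> b <= 1 -> A <= B + b * C) -> A <= B.
Proof.
move=> H; apply: (@ler_eps _ _ _ `|C|) => b b0.
pose d := Num.min b 1.
have d0 : 0 < d by rewrite lt_min b0 ltr01.
have d1 : d <= 1 by rewrite /d ge_min lexx orbT.
have db : d <= b by rewrite /d ge_min lexx.
apply: (le_trans (H d d0 d1)); rewrite lerD2l.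
apply: (@le_trans _ _ (d * `|C|)); first by rewrite ler_pM2l// ler_norm.
by rewrite ler_wpM2r.
Qed.

(** A single [b] serves as regularisation, as [eta] in [scheme_visc] and as bound on the missing
    time; with [h <= b ^+ 2] every error becomes O(b). *)
Lemma scheme_visc_one (R : realType) (G : R -> R) (s1 s2 : R) (phi : R -> R) (u : R -> R -> R)
    (h b M c x : R) (v : nat -> R -> R) (k : nat) :
  0 <= s1 -> s1 <= s2 -> (forall a, G a = Num.max (s1 * a) (s2 * a)) ->
  visc_sol G phi u -> scheme G h b v -> (forall y, `|D2 (v 0) y| <= M) ->
  (forall y, `|phi y - v 0 y| <= c) -> b <= 1 -> h <= b ^+ 2 ->
  k%:R * h <= 1 -> 1 - k%:R * h <= b ->
  `|u 1 x - v k x| <= c + b * (1 + ((s2 + 1) * M + 1) ^+ 2 / 2 + M).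
Proof.
move=> s1_ge0 s12 GE vu sv vM pv b1 hb; have [h0 b0 _ _] := sv.
have s2_ge0 : 0 <= s2 := le_trans s1_ge0 s12.
have M0 : 0 <= M := le_trans (normr_ge0 _) (vM 0).
set C := (s2 + 1) * M + 1.
have C0 : 0 < C by rewrite ltr_wpDl// mulr_ge0// addr_ge0.
have MC : (s2 + b) * M <= C.
  by rewrite /C (@le_trans _ _ ((s2 + 1) * M))// ?lerDl// ler_wpM2r// lerD2l.
have := scheme_visc s1_ge0 s12 GE vu sv vM pv MC C0 b0 k x ler01.
have : 0 <= k%:R * h by rewrite mulr_ge0// ltW.
rewrite (expr2 h) (mulrA k%:R h h); generalize (k%:R * h) => T T0 vis T1 Tb.
apply: (le_trans vis).
have q1 : C ^+ 2 / (4 * b) * ((1 - T) ^+ 2 + T * h) <= b * (C ^+ 2 / 2).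
  apply: (@le_trans _ _ (C ^+ 2 / (4 * b) * (2 * b ^+ 2))).
    apply: ler_wpM2l; first by rewrite divr_ge0 ?sqr_ge0// mulr_ge0// ltW.
    rewrite mulr2n mulrDl mul1r lerD//; first by rewrite ler_sqr ?nnegrE ?subr_ge0// ltW.
    by rewrite (le_trans _ hb)// ler_piMl// ltW.
  by rewrite le_eqVlt; apply/orP; left; apply/eqP; field; rewrite gt_eqF.
have q2 : T * (b * M) <= b * M by rewrite ler_piMl// mulr_ge0// ltW.
move: q1 q2; clearbody C; clear; lra.
Qed.

(** * Choice of parameters in the two bounds *)

Section Sufficient.
Variable R : realType.
Variable Theta : set (probability R R).
Hypothesis UI : unif_integrable Theta.
Hypothesis Theta0 : Theta !=set0.
Variables (G : R -> R) (s1 s2 : R).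
Hypothesis s1_ge0 : 0 <= s1.
Hypothesis s12 : s1 <= s2.
Hypothesis GE : forall a, G a = Num.max (s1 * a) (s2 * a).

Lemma stein_sufficient_lower (f phi : R -> R) (u : R -> R -> R) (L M c : R) :
  (forall V, Cb2 V -> exists2 mu, Theta mu & Ex mu V = Nr Theta V /\ Ex mu (gen G V) <= 0) ->
  Cb2 f -> 0 <= L -> (forall x y, `|f x - f y| <= L * `|x - y|) -> (forall x, `|D2 f x| <= M) ->
  visc_sol G phi u -> (forall x, `|phi x - f x| <= c) -> u 1 0 <= Nr Theta f + c.
Proof.
move=> stein_le bf L0 fL fM vu fc.
have s2_ge0 : 0 <= s2 := le_trans s1_ge0 s12.
have M0 : 0 <= M := le_trans (normr_ge0 _) (fM 0).
have [m m0 Hm] := Ex_norm_le UI.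
apply: (@ler_eps1 _ _ _ (3 + (L * m) ^+ 2 / 4 + ((s2 + 1) * M + 1) ^+ 2 / 2 + 2 * M)) => b b0 b1.
have b2 : 0 < b ^+ 2 by rewrite exprn_gt0.
have [n Hn] := inv_nat_small b2.
have h0 : 0 < n.+1%:R^-1 :> R by rewrite invr_gt0.
have [v sv v0] := scheme_exists s1_ge0 s12 GE h0 b0 bf.
rewrite -v0 in fL fM fc.
(* The least coefficient allowed by Young's inequality with [eta = b], plus [1] to stay positive
   when [L * m = 0]. It is of order [1 / b], hence the step at most [b ^+ 2]. *)
pose beta := (L * m) ^+ 2 / (4 * b) + 1.
have beta0 : 0 < beta by rewrite ltr_wpDl// divr_ge0 ?sqr_ge0// mulr_ge0// ltW.
have hb : (L * m) ^+ 2 <= 4 * b * beta.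
  rewrite /beta mulrDr mulrCA divff ?mulr1 ?lerDl ?mulr_ge0// ?(ltW b0)//.
  by rewrite mulf_neq0 ?gt_eqF.
have low := stein_lower UI Theta0 s1_ge0 s12 GE stein_le sv fM L0 fL Hm m0 b0 beta0 hb.
have n0 : n.+1%:R != 0 :> R by rewrite pnatr_eq0.
have vis : `|u 1 0 - v n.+1 0| <= c + b * (1 + ((s2 + 1) * M + 1) ^+ 2 / 2 + M).
  apply: (scheme_visc_one (k := n.+1) 0 s1_ge0 s12 GE vu sv fM fc b1 Hn).
    by rewrite divff.
  by rewrite divff// subrr ltW.
rewrite v0 in low; have /ler_normlP[_ {}vis] := vis.
have e1 : beta / n.+1%:R <= b * ((L * m) ^+ 2 / 4 + 1).
  apply: (@le_trans _ _ (beta * b ^+ 2)); first by rewrite ler_pM2l.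
  rewrite (_ : beta * b ^+ 2 = b * ((L * m) ^+ 2 / 4 + b)); last by rewrite /beta; field; rewrite gt_eqF.
  by rewrite ler_pM2l// lerD2l.
move: low vis e1; set A := beta / _; set B := _ ^+ 2 / 2; set D := Nr _ _.
clearbody A B D; clear -UI Theta0 s1_ge0 s12 GE; lra.
Qed.

(** The order of the choices matters: [rho] fixes the amplification [cc], against which [eta] and
    [eps] are tuned; [eps] fixes the admissible dilation [d0]; the time step comes last and makes
    [h * X] small. *)
Lemma stein_sufficient_upper (f phi : R -> R) (u : R -> R -> R) (L M c : R) :
  (forall V eta, Cb2 V -> 0 < eta -> exists2 mu, Theta mu &
    Ex mu V = Nr Theta V /\ - eta <= Ex mu (gen G V)) ->
  Cb2 f -> 0 <= L -> (forall x y, `|f x - f y| <= L * `|x - y|) -> (forall x, `|D2 f x| <= M) ->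
  visc_sol G phi u -> (forall x, `|phi x - f x| <= c) -> Nr Theta f <= u 1 0 + c.
Proof.
move=> stein_ge bf L0 fL fM vu fc.
have s2_ge0 : 0 <= s2 := le_trans s1_ge0 s12.
have M0 : 0 <= M := le_trans (normr_ge0 _) (fM 0).
have [m m0 Hm] := Ex_norm_le UI.
pose C := (s2 + 1) * M + 1.
have C0 : 0 < C by rewrite ltr_wpDl// mulr_ge0// addr_ge0.
apply: (@ler_eps1 _ _ _ (4 * M + 3 + L * m + L + M + C ^+ 2 / 2)) => b b0 b1.
have b2 : 0 < b ^+ 2 by rewrite exprn_gt0.
have [p Hp] := inv_nat_small b2.
have p0 : 0 < p.+1%:R^-1 :> R by rewrite invr_gt0.
pose rho : R := Num.sqrt p.+1%:R^-1.
have rho0 : 0 < rho by rewrite sqrtr_gt0.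
have rho2 : rho ^+ 2 = p.+1%:R^-1 by rewrite sqr_sqrtr// ltW.
have rhob : rho <= b by rewrite -ler_sqr ?nnegrE ?(ltW rho0) ?(ltW b0)// rho2.
pose cc : R := (2 * rho)^-1.
have cc0 : 0 < cc by rewrite invr_gt0 mulr_gt0.
pose eta := b / (4 * cc ^+ 2).
have eta0 : 0 < eta by rewrite divr_gt0// mulr_gt0// exprn_gt0.
pose eps := b / (2 * cc).
have eps0 : 0 < eps by rewrite divr_gt0// mulr_gt0.
have [d0 d00 Hd0] := Ex_min_sqr_le UI eps0.
pose X := s2 * (2 * C / b + 2 * L / b * cc * m) + (L + M) * m * cc ^+ 3.
have X0 : 0 <= X.
  rewrite /X addr_ge0//; last by rewrite !mulr_ge0 ?exprn_ge0 ?addr_ge0// ltW.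
  have bi0 : 0 <= b^-1 by rewrite invr_ge0 ltW.
  have C0' := ltW C0; have cc0' := ltW cc0.
  by apply: mulr_ge0 => //; apply: addr_ge0; repeat (apply: mulr_ge0 => //).
pose t := Num.min (d0 / cc) (Num.min (b ^+ 2) (b / (X + 1))).
have t0 : 0 < t by rewrite !lt_min b2 !divr_gt0// ltr_wpDl.
have [q Hq] := inv_nat_small t0.
(* A multiple of [p.+1] in the denominator lets [n = p * q.+1] steps end exactly at time
   [1 - rho ^+ 2]. *)
pose h : R := (p.+1%:R * q.+1%:R)^-1.
have h0 : 0 < h by rewrite invr_gt0 mulr_gt0.
have hq : h <= q.+1%:R^-1.
  by rewrite /h invfM ler_piMl ?invr_ge0// invf_le1// ler1n.
have ht := le_trans hq Hq.
have hd : h * cc <= d0 by rewrite -ler_pdivlMr// (le_trans ht)// /t ge_min lexx.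
have hb : h <= b ^+ 2 by rewrite (le_trans ht)// /t !ge_min lexx !orbT.
have hX : h * X <= b.
  have : h <= b / (X + 1) by rewrite (le_trans ht)// /t !ge_min lexx !orbT.
  rewrite ler_pdivlMr ?ltr_wpDl// => h1; move: h1 (ltW h0); rewrite mulrDr mulr1; lra.
pose n := (p * q.+1)%N.
have pn0 : p.+1%:R != 0 :> R by rewrite pnatr_eq0.
have qn0 : q.+1%:R != 0 :> R by rewrite pnatr_eq0.
have nh : n%:R * h = 1 - p.+1%:R^-1.
  have -> : n%:R = (p.+1%:R - 1) * q.+1%:R :> R by rewrite -(natr1 p) addrK -natrM.
  by rewrite /h invfM mulrACA divff// mulr1 mulrBl divff// mul1r.
have [v sv v0] := scheme_exists s1_ge0 s12 GE h0 b0 bf.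
rewrite -v0 in fL fM fc.
have Hrm mu d : Theta mu -> `|d| <= h * cc -> Ex mu (rm d) <= eps.
  move=> Tmu dh; apply: (Hd0 mu `|d| _ Tmu) => //; last exact: lingrowth_rm.
  by rewrite normr_ge0 (le_trans dh).
have nhr : n%:R * h <= 1 - rho ^+ 2 by rewrite nh rho2.
have upp := stein_upper_scheme UI Theta0 s1_ge0 s12 GE stein_ge sv fM L0 fL Hm b0 rho0 Hrm (ltW eps0) eta0 nhr.
have nh1 : n%:R * h <= 1 by rewrite nh gerBl ltW.
have nh0 : 0 <= n%:R * h by rewrite mulr_ge0// ltW.
have z1 : 4 * cc ^+ 2 * eta = b by rewrite /eta; field; rewrite gt_eqF.
have z2 : 2 * cc * (L + M) * eps = b * (L + M) by rewrite /eps; field; rewrite gt_eqF.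
have z3 : s2 * (h * (2 * ((s2 + b) * M) / b) + 2 * L / b * h * cc * m) + (L + M) * m * h * cc ^+ 3 <= b.
  apply: le_trans hX; rewrite (_ : h * X = s2 * (h * (2 * C / b) + 2 * L / b * h * cc * m) + (L + M) * m * h * cc ^+ 3); last by rewrite /X; ring.
  rewrite lerD2r ler_wpM2l// lerD2r ler_pM2l// ler_pM2r ?invr_gt0// ler_pM2l//.
  by rewrite /C (@le_trans _ _ ((s2 + 1) * M))// ?lerDl// ler_wpM2r// lerD2l.
have z4 : Num.sqrt (1 - n%:R * h) = rho by rewrite nh opprB addrCA subrr addr0.
rewrite -/cc z4 v0 in upp.
have vis : `|u 1 0 - v n 0| <= c + b * (1 + C ^+ 2 / 2 + M).
  apply: (scheme_visc_one (k := n) 0 s1_ge0 s12 GE vu sv fM fc b1 hb nh1).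
  by rewrite nh opprB addrCA subrr addr0 (le_trans Hp)// expr2 ler_piMr// ltW.
have /ler_normlP[{}vis _] := vis.
have bM : 0 <= b * M by rewrite mulr_ge0// ltW.
have z8 := ler_wpM2l (mulr_ge0 L0 m0) rhob.
rewrite z1 z2 -!addrA in upp.
have z9 : n%:R * h * (b * M + (b + (b * (L + M) + (s2 * (h * (2 * ((s2 + b) * M) / b) + 2 * L / b * h * cc * m) +
  (L + M) * m * h * cc ^+ 3)))) <= b * M + (b + (b * (L + M) + b)).
  set Z := s2 * _ + _ in z3 *.
  have bLM : 0 <= b * (L + M) by rewrite mulr_ge0 ?addr_ge0// ltW.
  apply: (@le_trans _ _ (n%:R * h * (b * M + (b + (b * (L + M) + b))))).
    by rewrite ler_wpM2l// !lerD2l.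
  by rewrite ler_piMl// !addr_ge0// ltW.
move: upp vis z8 z9.
set Z := n%:R * h * (_ + (_ + _)); set D := Nr _ _.
clearbody Z D C rho; clear -UI Theta0 s1_ge0 s12 GE; lra.
Qed.

End Sufficient.

(** * G-normality implies the Stein condition *)

Section QuarticBarrier.
Variable R : realType.

Lemma C2_pow (x0 : R) (n : nat) : C2 (fun x : R => (x - x0) ^+ n.+2)
  (fun x => n.+2%:R * (x - x0) ^+ n.+1) (fun x => n.+2%:R * (n.+1%:R * (x - x0) ^+ n)).
Proof.
have da (x : R) : is_derive x 1 (fun x => x - x0) 1.
  by have := @is_deriveB _ _ _ id (cst x0) x 1 1 0; rewrite subr0; apply.
have dp m (x : R) : is_derive x 1 (fun x => (x - x0) ^+ m.+1) (m.+1%:R * (x - x0) ^+ m).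
  have := @is_deriveX R _ (fun x => x - x0) m.+1 x 1 1 (da x).
  by rewrite exprfctE /GRing.scale/= mulr1.
split; first by move=> x; exact: dp.
  move=> x; have := @is_deriveZ _ _ _ (fun x => (x - x0) ^+ n.+1) n.+2%:R x 1 _ (dp n x).
  by rewrite /GRing.scale/=.
move=> x; apply: cvgM; first exact: cvg_cst.
apply: cvgM; first exact: cvg_cst.
apply: (@cvg_comp _ _ _ (fun x => x - x0) (fun z => z ^+ n)); last exact: exprn_continuous.
by apply: cvgB; [exact: cvg_id|exact: cvg_cst].
Qed.

Definition quartic (x0 A B c K : R) (x : R) : R :=
  A + B * (x - x0) + c * (x - x0) ^+ 2 + K * (x - x0) ^+ 4.

Lemma quartic_C2 (x0 A B c K : R) : exists f1, C2 (quartic x0 A B c K) f1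
  (fun x => 2 * c + 12 * K * (x - x0) ^+ 2).
Proof.
have la := linear_C2.
have h := C2_add (C2_add (C2_aff 1 (- x0) (la R A B)) (C2_scale c (C2_sqr x0))) (C2_scale K (C2_pow x0 2)).
eexists; move: h; congr C2; apply/funext => x; rewrite /quartic; ring.
Qed.

Lemma quartic_touch (F : R -> R) (x0 A B c K : R) : 0 < K -> Cb2 F ->
  exists2 z, forall x, F x - quartic x0 A B c K x <= F z - quartic x0 A B c K z &
    D2 F z <= 2 * c + 12 * K * (z - x0) ^+ 2.
Proof.
move=> K0 bF; have [f1 q2] := quartic_C2 x0 A B c K; set g := quartic x0 A B c K in q2 *.
have cF := Cb2D bF.
have [M M0 FM] := Cb2_bound bF.
have [d1 d2 _] := C2_add cF (C2_scale (-1) q2).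
have E x : F x + -1 * g x = F x - g x by ring.
(* For [|y| >= T >= 1] the factor [K * y ^+ 2] exceeds [|B| + |c| + 2 * M], so the quartic term
   beats the other terms and the oscillation of [F]. *)
pose T := 1 + (`|B| + `|c| + 2 * M) / K.
have T1 : 1 <= T by rewrite lerDl divr_ge0 ?(ltW K0)// addr_ge0 ?addr_ge0 ?mulr_ge0// ltW.
have far x : T <= `|x - x0| -> F x + -1 * g x <= F x0 + -1 * g x0.
  move=> Tx; rewrite /g /quartic; set y := x - x0 in Tx *.
  have -> : x0 - x0 = 0 by rewrite subrr.
  rewrite mulr0 !expr0n/= !mulr0 !addr0.
  have y1 : 1 <= `|y| := le_trans T1 Tx.
  have y2 : y ^+ 2 = `|y| ^+ 2 by rewrite real_normK ?num_real.
  have y4 : y ^+ 4 = `|y| ^+ 2 * `|y| ^+ 2 by rewrite -!y2; ring.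
  have yy : `|y| <= `|y| ^+ 2 by rewrite expr2 ler_peMr.
  have hT : `|B| + `|c| + 2 * M <= K * `|y| ^+ 2.
    apply: (@le_trans _ _ (K * T)); last by rewrite ler_pM2l// (le_trans Tx).
    rewrite /T mulrDr mulr1 mulrCA divff ?gt_eqF// mulr1 lerDr ltW//.
  have y0 : 0 <= `|y| ^+ 2 by rewrite exprn_ge0.
  have k4 := ler_wpM2r y0 hT.
  have kB : - (`|B| * `|y| ^+ 2) <= B * y.
    have := ler_norm (- (B * y)); rewrite normrN normrM => h.
    have := ler_wpM2l (normr_ge0 B) yy; lra.
  have kc : - (`|c| * `|y| ^+ 2) <= c * `|y| ^+ 2.
    rewrite -mulNr ler_wpM2r//; have := ler_norm (- c); rewrite normrN; lra.
  have kM : 2 * M <= 2 * M * `|y| ^+ 2 by rewrite ler_peMr ?mulr_ge0 ?(ltW M0)// (le_trans y1).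
  have [/ler_normlP[a1 a2] _] := FM x; have [/ler_normlP[a3 a4] _] := FM x0.
  rewrite y2 y4; move: k4 kB kc kM a1 a2 a3 a4; clear; lra.
have lo : x0 - T <= x0 + T by move: T1; clear; lra.
have cf : continuous (fun x => F x + -1 * g x) by exact: is_derive_continuous d1.
have [z zT Hz] := EVT_max lo (@continuous_subspaceT _ _ `[x0 - T, x0 + T]%classic _ cf).
have x0T : x0 \in `[x0 - T, x0 + T] by rewrite in_itv/=; apply/andP; move: T1; clear; split; lra.
have mx x : F x + -1 * g x <= F z + -1 * g z.
  have [xT|/ltW xT] := leP `|x - x0| T; last exact: le_trans (far x xT) (Hz _ x0T).
  apply: Hz; rewrite in_itv/=; move: xT => /ler_normlP[a b]; apply/andP; split; lra.
exists z; first by move=> x; have := mx x; rewrite !E.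
have := max_second_derivative (ltr01 : 0 < 1 :> R) d1 (d2 z) (fun y _ => mx y).
lra.
Qed.

(* [y^4 + 12 sb t y^2 + 24 sb^2 t^2] is a supersolution, for the scheme, of the
   heat equation with diffusivity [sb]; it absorbs the error of the quadratic
   expansion of [v 0] away from [x0]. *)
Lemma quartic_barrier (H : R -> R) (sb h A B a K x0 : R) (v : nat -> R -> R) :
  elliptic H sb -> 0 < h -> 0 <= sb -> 0 < K -> (forall k, Cb2 (v k)) ->
  (forall k x, v k.+1 x - h * H (D2 (v k.+1) x) = v k x) ->
  (forall x, v 0 x <= quartic x0 A B (a / 2) K x) ->
  forall k, v k x0 <= A + k%:R * h * H a + 24 * K * sb ^+ 2 * (k%:R * h) ^+ 2.
Proof.
move=> eH h0 sb0 K0 bv step v0.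
pose g k := quartic x0 (A + k%:R * h * H a + 24 * K * sb ^+ 2 * (k%:R * h) ^+ 2) B
  (a / 2 + 12 * K * sb * (k%:R * h)) K.
have key k : forall x, v k x <= g k x.
  elim: k => [|k IH] x.
    by rewrite /g !mul0r expr0n/= !mulr0 !addr0.
  have [z Hz D2z] := @quartic_touch (v k.+1) x0 (A + k.+1%:R * h * H a + 24 * K * sb ^+ 2 * (k.+1%:R * h) ^+ 2) B
     (a / 2 + 12 * K * sb * (k.+1%:R * h)) K K0 (bv k.+1).
  have := Hz x; rewrite -/(g k.+1).
  suff : v k.+1 z <= g k.+1 z by lra.
  have := step k z; have := IH z.
  move: D2z; set b := D2 (v k.+1) z; set y := z - x0.
  set t := k%:R * h; have tE : k.+1%:R * h = t + h by rewrite -(natr1 k) mulrDl mul1r.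
  rewrite tE => D2z.
  have t0 : 0 <= t by rewrite mulr_ge0// ltW.
  have P0 : 0 <= K * (12 * y ^+ 2 + 24 * sb * (t + h)).
    apply: mulr_ge0; first exact: ltW.
    apply: addr_ge0; first by rewrite mulr_ge0 ?sqr_ge0.
    by apply: mulr_ge0; [rewrite mulr_ge0|rewrite addr_ge0// ltW].
  have h1 : H b <= H a + sb * (K * (12 * y ^+ 2 + 24 * sb * (t + h))).
    have b1 : b <= a + K * (12 * y ^+ 2 + 24 * sb * (t + h)) by lra.
    have [q1 _] := eH _ _ b1.
    have b2 : a <= a + K * (12 * y ^+ 2 + 24 * sb * (t + h)) by rewrite lerDl.
    have [_ q2] := eH _ _ b2.
    rewrite addrAC subrr add0r in q2; lra.
  rewrite /g /quartic -/y tE -/t.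
  have h2 := ler_wpM2l (ltW h0) h1.
  have h3 : 0 <= 24 * K * sb ^+ 2 * (h * t) by rewrite !mulr_ge0 ?sqr_ge0// ltW.
  move: h2 h3; clear -h0; lra.
move=> k; have := key k x0; rewrite /g /quartic subrr expr0n/= expr0n/= !mulr0 !addr0; lra.
Qed.

End QuarticBarrier.

(** * Short-time expansion of the scheme *)

Section LocalExpansion.
Variable R : realType.

(** Only [y] is confined to the compact interval; [z] may leave it, so the radius is extracted from
    a covering by neighbourhoods in the whole line. *)
Lemma locally_uniform_continuity (g : R -> R) (N eta : R) : continuous g -> 0 < eta ->
  exists2 d, 0 < d & forall y z, `|y| <= N -> `|z - y| <= d -> `|g z - g y| <= eta.
Proof.
move=> cg eta0.
have cK := @segment_compact R (- N) N.
move/compact_near_coveringP : cK => nc.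
pose P (d y : R) := forall z, `|z - y| <= d -> `|g z - g y| <= eta.
have : \forall d \near (0 : R)^'+, `[- N, N]%classic `<=` P d.
  apply: (nc R (at_right (0 : R)) P) => x _.
  have e2 : 0 < eta / 2 by rewrite divr_gt0.
  have /cvgrPdist_lt/(_ _ e2)/nbhs_ballP[d /= d0 Hd] := cg x.
  near=> y c => z /= zy.
  have yx : `|x - y| < d / 2 by near: y; apply: cvgr_dist_lt => //; rewrite divr_gt0.
  have cd : c < d / 2 by near: c; apply: nbhs_right_lt; rewrite divr_gt0.
  have h1 : `|g x - g y| < eta / 2 by apply: Hd; rewrite /ball/=; lra.
  have h2 : `|g x - g z| < eta / 2.
    apply: Hd; rewrite /ball/= (_ : x - z = (x - y) - (z - y)); last by ring.
    by rewrite (le_lt_trans (ler_normB _ _))//; lra.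
  rewrite (_ : g z - g y = (g x - g y) - (g x - g z)); last by ring.
  by rewrite (le_trans (ler_normB _ _))//; lra.
move=> H; have [d [d0 Hd]] : exists d, 0 < d /\ `[- N, N]%classic `<=` P d.
  near ((0 : R)^'+) => d; exists d; split; last by near: d.
  by near: d; apply: nbhs_right_gt.
exists d => // y z yN; apply: Hd; rewrite /= in_itv/=.
by rewrite -ler_norml.
Unshelve. all: by end_near. Qed.

(** The mean value theorem is applied twice to [f] minus its affine part and [b / 2 (x - x0)^2]; the
    second intermediate point stays in the segment from [x0] to [x], where [D2 f <= b]. *)
Lemma taylor_quadratic (f : R -> R) (b x0 x : R) : Cb2 f ->
  (forall z, `|z - x0| <= `|x - x0| -> D2 f z <= b) ->
  f x <= f x0 + D1 f x0 * (x - x0) + b / 2 * (x - x0) ^+ 2.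
Proof.
move=> bf fb; have [d1 d2 _] := Cb2D bf.
have c2 := C2_add (C2_add (Cb2D bf) (C2_aff 1 (- x0) (linear_C2 0 (- D1 f x0)))) (C2_scale (- (b / 2)) (C2_sqr x0)).
have [e1 e2 _] := c2.
have [t /andP[t0 t1] E] := mvt01 x0 x e1.
have [s /andP[sg0 sg1] E'] := mvt01 x0 (x0 + t * (x - x0)) e2.
set y := x - x0 in E E' fb *.
have le : D2 f (x0 + s * (x0 + t * y - x0)) <= b.
  apply: fb; rewrite (_ : _ - x0 = s * t * y); last by ring.
  rewrite normrM ler_piMl// ger0_norm ?mulr_ge0//.
  by rewrite mulr_ile1.
have ty : 0 <= t * y ^+ 2 by rewrite mulr_ge0// sqr_ge0.
have := ler_wpM2r ty le.
move: E E'; rewrite (_ : x0 + t * y - x0 = t * y); last by ring.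
set p := D2 f _; set q := D1 f (x0 + t * y); set y0 := D1 f x0.
have E2 : 1 * x + - x0 = y by rewrite /y; ring.
have E3 : 1 * x0 + - x0 = 0 by ring.
rewrite !subrr E2 E3 => E E' h.
have W : q + 1 * - y0 + - (b / 2) * (2 * (t * y)) = (p - b) * (t * y) by move: E'; lra.
by move: E; rewrite W; lra.
Qed.

(** Within distance [d] the quadratic part already dominates. Beyond it the quartic coefficient
    gives at least [(M + 1) * y ^+ 2], which covers the gap between the crude bound [M / 2] and
    [(a + eta) / 2], as [a >= - M]. *)
Lemma quartic_majorant (f : R -> R) (a M d eta x0 : R) : Cb2 f -> (forall x, D2 f x <= M) ->
  0 < d -> 0 <= eta -> `|a| <= M -> (forall z, `|z - x0| <= d -> D2 f z <= a + eta) ->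
  forall x, f x <= quartic x0 (f x0) (D1 f x0) ((a + eta) / 2) ((M + 1) / d ^+ 2) x.
Proof.
move=> bf fM d0 eta0 aM fa x; rewrite /quartic.
have M0 : 0 <= M := le_trans (normr_ge0 _) aM.
have d2 : 0 < d ^+ 2 by rewrite exprn_gt0.
set y := x - x0.
have y4 : 0 <= (M + 1) / d ^+ 2 * y ^+ 4.
  rewrite mulr_ge0 ?divr_ge0 ?addr_ge0 ?(ltW d2)//.
  by rewrite (_ : y ^+ 4 = (y ^+ 2) ^+ 2) ?sqr_ge0//; ring.
have [yd|dy] := leP `|y| d.
  have : f x <= f x0 + D1 f x0 * (x - x0) + (a + eta) / 2 * (x - x0) ^+ 2.
    by apply: taylor_quadratic bf _ => z zx; apply: fa; exact: le_trans yd.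
  rewrite -/y; lra.
have : f x <= f x0 + D1 f x0 * (x - x0) + M / 2 * (x - x0) ^+ 2.
  by apply: taylor_quadratic bf _ => z zx; apply: fM.
rewrite -/y.
have h1 : d ^+ 2 <= y ^+ 2.
  by rewrite -(real_normK (num_real y)) ler_sqr ?nnegrE// ltW.
have h2 : M + 1 <= (M + 1) / d ^+ 2 * y ^+ 2.
  by rewrite -mulrA ler_peMr ?addr_ge0// mulrC ler_pdivlMr// mul1r.
have h3 := ler_wpM2r (sqr_ge0 y) h2.
have h4 := mulr_ge0 eta0 (sqr_ge0 y).
have h5 : - M * y ^+ 2 <= a * y ^+ 2.
  by rewrite ler_wpM2r ?sqr_ge0//; have /ler_normlP[] := aM; lra.
rewrite (_ : (M + 1) / d ^+ 2 * y ^+ 4 = (M + 1) / d ^+ 2 * y ^+ 2 * y ^+ 2); last by ring.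
have := sqr_ge0 y; lra.
Qed.

Variables (G : R -> R) (s1 s2 : R).
Hypothesis s1_ge0 : 0 <= s1.
Hypothesis s12 : s1 <= s2.
Hypothesis GE : forall a, G a = Num.max (s1 * a) (s2 * a).

(** The datum is enclosed near [x0] between quartics of curvature [a + eta] and [a - eta]. The upper
    one evolves by [quartic_barrier]; the lower one is the same barrier for [- v] and the reflected
    nonlinearity. *)
Lemma scheme_local_expansion (h e M a d eta x0 : R) (v : nat -> R -> R) : scheme G h e v ->
  (forall x, `|D2 (v 0) x| <= M) -> 0 < d -> 0 <= eta -> `|a| <= M ->
  (forall z, `|z - x0| <= d -> `|D2 (v 0) z - a| <= eta) ->
  forall k, `|v k x0 - v 0 x0 - k%:R * h * G a| <= k%:R * h * (s2 * eta + e * (M + eta)) +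
    24 * ((M + 1) / d ^+ 2) * (s2 + e) ^+ 2 * (k%:R * h) ^+ 2.
Proof.
move=> sv vM d0 eta0 aM va k; have [h0 e0 bv step] := sv.
have s2_ge0 : 0 <= s2 := le_trans s1_ge0 s12.
have sb0 : 0 <= s2 + e by rewrite addr_ge0// ltW.
have M0 : 0 <= M := le_trans (normr_ge0 _) aM.
have K0 : 0 < (M + 1) / d ^+ 2 by rewrite divr_gt0 ?exprn_gt0// ltr_wpDl.
have eH := Heps_elliptic s1_ge0 s12 GE e0.
have kh : 0 <= k%:R * h by rewrite mulr_ge0// ltW.
have /ler_normlP[aM1 aM2] := aM.
have up : v k x0 <= v 0 x0 + k%:R * h * (G (a + eta) + e * (a + eta)) +
    24 * ((M + 1) / d ^+ 2) * (s2 + e) ^+ 2 * (k%:R * h) ^+ 2.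
  apply: (quartic_barrier (A := v 0 x0) (B := D1 (v 0) x0) (a := a + eta) (H := fun a => G a + e * a) eH h0 sb0 K0 bv step).
  apply: quartic_majorant (bv 0) _ d0 eta0 aM _.
    by move=> x; have /ler_normlP[] := vM x.
  by move=> z zd; have /ler_normlP[] := va z zd; lra.
have bN n := Cb2N (bv n).
have lo : - v k x0 <= - v 0 x0 + k%:R * h * (- (G (- (- a + eta)) + e * (- (- a + eta)))) +
    24 * ((M + 1) / d ^+ 2) * (s2 + e) ^+ 2 * (k%:R * h) ^+ 2.
  apply: (quartic_barrier (v := fun n x => - v n x) (A := - v 0 x0) (B := D1 (fun x => - v 0 x) x0) (a := - a + eta) (elliptic_opp eH) h0 sb0 K0 (fun n => (bN n).1)).
    by move=> n x; rewrite (bN n.+1).2 opprK -(step n x); ring.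
  have aM' : `|- a| <= M by rewrite normrN.
  apply: quartic_majorant (bN 0%N).1 _ d0 eta0 aM' _.
    by move=> x; rewrite (bN 0%N).2; have /ler_normlP[] := vM x.
  by move=> z zd; rewrite (bN 0%N).2; have /ler_normlP[] := va z zd; lra.
have g1 : G (a + eta) <= G a + s2 * eta.
  have := G_lip s1_ge0 s12 GE (a + eta) a; rewrite (_ : a + eta - a = eta); last by ring.
  by rewrite (ger0_norm eta0) => /ler_normlP[_]; lra.
have g2 : G a - s2 * eta <= G (- (- a + eta)).
  have := G_lip s1_ge0 s12 GE (- (- a + eta)) a; rewrite (_ : - (- a + eta) - a = - eta); last by ring.
  by rewrite normrN (ger0_norm eta0) => /ler_normlP[]; lra.
have e1 : e * (a + eta) <= e * (M + eta) by rewrite ler_pM2l// lerD2r.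
have e2 : - e * (- (- a + eta)) <= e * (M + eta).
  by rewrite mulNr -mulrN opprK ler_pM2l// lerD2r.
have u1 : k%:R * h * (G (a + eta) + e * (a + eta)) <= k%:R * h * (G a + s2 * eta + e * (M + eta)).
  by rewrite ler_wpM2l// lerD.
have l1 : k%:R * h * (- (G (- (- a + eta)) + e * (- (- a + eta)))) <=
   k%:R * h * (- G a + s2 * eta + e * (M + eta)).
  by rewrite ler_wpM2l//; lra.
move: up lo u1 l1; set Q := 24 * _ * _ * _; set U := k%:R * h * (G (a + eta) + _); set V := k%:R * h * (- _).
set T := k%:R * h; clearbody Q U V T => up lo u1 l1.
by rewrite ler_norml; apply/andP; split; lra.
Qed.

Lemma scheme_dilate (h e r : R) (v : nat -> R -> R) : scheme G h e v -> 0 < r ->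
  scheme G (h / r ^+ 2) e (fun k y => v k (r * y)).
Proof.
move=> [h0 e0 bv step] r0.
have r2 : 0 < r ^+ 2 by rewrite exprn_gt0.
split; [by rewrite divr_gt0|exact: e0|by move=> k; case: (Cb2_dilate r (bv k))|].
move=> k x; have [_ _ ->] := Cb2_dilate r (bv k.+1).
rewrite -(step k (r * x)) (G_homog GE) ?(ltW r2)//; congr (_ - _).
by field; rewrite gt_eqF.
Qed.

End LocalExpansion.

(** * Expansion of the dilated scheme under the expectations *)

Section Necessary.
Variable R : realType.
Variable Theta : set (probability R R).
Hypothesis UI : unif_integrable Theta.
Variables (G : R -> R) (s1 s2 : R).
Hypothesis s1_ge0 : 0 <= s1.
Hypothesis s12 : s1 <= s2.
Hypothesis GE : forall a, G a = Num.max (s1 * a) (s2 * a).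

Lemma Ex_dist_le mu (f g b : R -> R) : Theta mu -> lingrowth f -> lingrowth g -> lingrowth b ->
  (forall x, `|f x - g x| <= b x) -> `|Ex mu f - Ex mu g| <= Ex mu b.
Proof.
move=> Tmu lf lg lb fg.
have := Ex_le UI Tmu lf (lingrowthD lg lb); have := Ex_le UI Tmu lg (lingrowthD lf lb).
rewrite (ExD UI Tmu lf lb) (ExD UI Tmu lg lb) => h1 h2.
have {}h1 : Ex mu g <= Ex mu f + Ex mu b by apply: h1 => x; have /ler_normlP[+ _] := fg x; lra.
have {}h2 : Ex mu f <= Ex mu g + Ex mu b by apply: h2 => x; have /ler_normlP[_ +] := fg x; lra.
by rewrite ler_norml; apply/andP; split; lra.
Qed.

(** For [|y| <= N] the local expansion applies at [r * y]; for larger [y] the crude drift bound is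
    multiplied by [|y| / N >= 1], which is integrable and small. The drift term comes from
    [r = 1 - D] with [D = s / 2 + D^2 / 2]. *)
Lemma scheme_gen_pointwise (h e M N eta d r s : R) (v : nat -> R -> R) (k : nat) : scheme G h e v ->
  (forall x, `|D1 (v 0) x| <= M) -> (forall x, `|D2 (v 0) x| <= M) -> e <= 1 ->
  0 < N -> 0 < d -> 0 <= eta ->
  (forall y z, `|y| <= N -> `|z - y| <= 2 * d -> `|D2 (v 0) z - D2 (v 0) y| <= eta) ->
  0 <= r <= 1 -> r ^+ 2 = 1 - s -> k%:R * h = s -> s * N <= d ->
  forall y, `|v k (r * y) - (v 0 y + s * gen G (v 0) y)| <=
    s * (s2 * eta + e * (M + eta) + 24 * ((M + 1) / d ^+ 2) * (s2 + e) ^+ 2 * s +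
         (s * M / 2 + 2 * (s2 + 1) * M / N) * `|y| + 2 * M * rm (r - 1) y).
Proof.
move=> sv v1 v2 e1 N0 d0 eta0 uc /andP[r0 r1] rs khs sN y.
have [h0 e0 bv step] := sv.
have s2_ge0 : 0 <= s2 := le_trans s1_ge0 s12.
have M0 : 0 <= M := le_trans (normr_ge0 _) (v1 0).
have s0 : 0 <= s by rewrite -khs mulr_ge0// ltW.
pose D := 1 - r.
have D0 : 0 <= D by rewrite subr_ge0.
have sD : s = D * (1 + r) by rewrite /D; move: rs; rewrite expr2; lra.
have Ds : D <= s by rewrite sD ler_peMr// lerDl.
have D2s : D - s / 2 = D ^+ 2 / 2 by rewrite sD /D; field.
set a := D2 (v 0) y.
have t2 := taylor_rm y y (r - 1) (bv 0%N) v1 v2.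
have E1 : y + (r - 1) * y = r * y by ring.
have nD : `|r - 1| = D by rewrite distrC ger0_norm.
rewrite E1 nD in t2.
have t2' : 2 * M * (D * rm (r - 1) y) <= 2 * M * (s * rm (r - 1) y).
  by rewrite ler_wpM2l ?mulr_ge0// ler_wpM2r ?rm_ge0.
have t3 : `|D ^+ 2 / 2 * (y * D1 (v 0) y)| <= s * (s * M / 2) * `|y|.
  rewrite normrM ger0_norm ?divr_ge0 ?sqr_ge0// normrM.
  have q1 : D ^+ 2 <= s ^+ 2 by rewrite ler_sqr ?nnegrE.
  have q2 : `|y| * `|D1 (v 0) y| <= `|y| * M by rewrite ler_wpM2l.
  have q3 : D ^+ 2 * (`|y| * `|D1 (v 0) y|) <= s ^+ 2 * (`|y| * M).
    by rewrite ler_pM ?sqr_ge0// mulr_ge0.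
  by move: q3; lra.
pose Q := 24 * ((M + 1) / d ^+ 2) * (s2 + e) ^+ 2 * s.
have Q0 : 0 <= Q.
  apply: mulr_ge0 => //; apply: mulr_ge0; last exact: sqr_ge0.
  by apply: mulr_ge0 => //; rewrite divr_ge0 ?exprn_ge0 ?addr_ge0// ltW.
have P0 : 0 <= s2 * eta + e * (M + eta).
  by rewrite addr_ge0 ?mulr_ge0 ?addr_ge0// ltW.
have B0 : 0 <= 2 * (s2 + 1) * M / N.
  by apply: mulr_ge0; [rewrite !mulr_ge0 ?addr_ge0|rewrite invr_ge0 ltW].
have t1 : `|v k (r * y) - v 0 (r * y) - s * G a| <=
    s * (s2 * eta + e * (M + eta) + Q) + s * (2 * (s2 + 1) * M / N) * `|y|.
  have [yN|Ny] := leP `|y| N.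
    have loc z : `|z - r * y| <= d -> `|D2 (v 0) z - a| <= eta.
      move=> zd; apply: uc => //.
      have -> : z - y = (z - r * y) - D * y by rewrite /D; ring.
      apply: (le_trans (ler_normB _ _)); rewrite normrM (ger0_norm D0).
      have : D * `|y| <= s * N by rewrite ler_pM.
      lra.
    have := scheme_local_expansion s1_ge0 s12 GE sv v2 d0 eta0 (v2 y) loc k; rewrite khs.
    have := mulr_ge0 (mulr_ge0 s0 B0) (normr_ge0 y); rewrite /Q; lra.
  have dr := scheme_drift s1_ge0 s12 GE sv v2 k (r * y); rewrite khs in dr.
  have dr' : s * ((s2 + e) * M) <= s * ((s2 + 1) * M).
    by rewrite ler_wpM2l// ler_wpM2r// lerD2l.
  have ga : `|G a| <= s2 * M.
    have := G_lip s1_ge0 s12 GE a 0.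
    have -> : G 0 = 0 by rewrite GE !mulr0 maxxx.
    by rewrite !subr0 => h1; apply: (le_trans h1); rewrite ler_wpM2l// /a.
  have gs : `|s * G a| <= s * ((s2 + 1) * M).
    rewrite normrM (ger0_norm s0) ler_wpM2l// (le_trans ga)// ler_wpM2r// lerDl//.
  apply: (le_trans (ler_normB _ _)).
  have yN1 : 1 <= `|y| / N by rewrite ler_pdivlMr// mul1r ltW.
  have := ler_wpM2l (mulr_ge0 s0 (mulr_ge0 (addr_ge0 s2_ge0 ler01) M0)) yN1.
  have := mulr_ge0 s0 (addr_ge0 P0 Q0); lra.
have -> : v k (r * y) - (v 0 y + s * gen G (v 0) y) =
    (v k (r * y) - v 0 (r * y) - s * G a) + (v 0 (r * y) - v 0 y - (r - 1) * y * D1 (v 0) y)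
     - D ^+ 2 / 2 * (y * D1 (v 0) y).
  by rewrite -D2s /gen -/a /D; field.
apply: (le_trans (ler_normB _ _)); have h1 := ler_normD (v k (r * y) - v 0 (r * y) - s * G a)
   (v 0 (r * y) - v 0 y - (r - 1) * y * D1 (v 0) y).
rewrite -/Q; move: h1 t1 t2 t2' t3.
set n1 := `|_ + _|; set n2 := `|_ - _ - s * _|; set n3 := `|_ - _ - _ * _|; set n4 := `|_ * _|.
clearbody n1 n2 n3 n4 Q D a => h1 t1 t2 t2' t3.
lra.
Qed.

(** All errors are governed by one parameter [t], with spatial cutoff [1 / t], and [Z] collects
    their coefficients. Uniformity in [mu] comes from the common bound on first moments and from
    [Ex_min_sqr_le]. *)
Lemma scheme_gen_expansion (phi : R -> R) (tol : R) : Cb2 phi -> 0 < tol -> exists2 s0, 0 < s0 &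
  forall h e v k s mu, scheme G h e v -> v 0 = phi -> k%:R * h = s -> s <= s0 -> e <= s0 -> Theta mu ->
  `|Ex mu (fun y => v k (Num.sqrt (1 - s) * y)) - (Ex mu phi + s * Ex mu (gen G phi))| <= s * tol.
Proof.
move=> bphi tol0.
have s2_ge0 : 0 <= s2 := le_trans s1_ge0 s12.
have [M M0 HM] := Cb2_bound bphi.
have f1 x : `|D1 phi x| <= M by have [_ []] := HM x.
have f2 x : `|D2 phi x| <= M by have [_ []] := HM x.
have [m m0 Hm] := Ex_norm_le UI.
pose Z := s2 + (M + 1) + 1 + (M / 2 + 2 * (s2 + 1) * M) * m + 2 * M.
have Z0 : 0 < Z.
  have a1 : 0 <= (M / 2 + 2 * (s2 + 1) * M) * m.
    by rewrite mulr_ge0// addr_ge0// !mulr_ge0 ?addr_ge0 ?invr_ge0// ltW.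
  by rewrite /Z; lra.
pose t := Num.min 1 (tol / Z).
have t0 : 0 < t by rewrite lt_min ltr01 divr_gt0.
have t1 : t <= 1 by rewrite /t ge_min lexx.
have tZ : t * Z <= tol by rewrite -ler_pdivlMr// /t ge_min lexx orbT.
clearbody t.
have [_ _ c2] := Cb2D bphi.
have [d d0 Hd] := locally_uniform_continuity t^-1 c2 t0.
have [dd dd0 Hdd] := Ex_min_sqr_le UI t0.
pose X := 24 * ((M + 1) / (d / 2) ^+ 2) * (s2 + 1) ^+ 2.
have X0 : 0 <= X.
  apply: mulr_ge0; last exact: sqr_ge0.
  by apply: mulr_ge0 => //; rewrite divr_ge0 ?sqr_ge0 ?addr_ge0// ltW.
pose s0 := Num.min (Num.min t (t / (X + 1))) (Num.min (d / 2 * t) dd).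
have s0_gt0 : 0 < s0 by rewrite !lt_min t0 dd0 !(divr_gt0, mulr_gt0)// ltr_wpDl.
have s0t : s0 <= t by rewrite /s0 !ge_min lexx.
have s0X : s0 * X <= t.
  have : s0 <= t / (X + 1) by rewrite /s0 !ge_min lexx !orbT.
  by rewrite ler_pdivlMr ?ltr_wpDl// mulrDr mulr1; move: s0_gt0; lra.
have s0d : s0 <= d / 2 * t by rewrite /s0 !ge_min lexx !orbT.
have s0dd : s0 <= dd by rewrite /s0 !ge_min lexx !orbT.
clearbody s0; exists s0 => // h e v k s mu sv v0 khs ss0 es0 Tmu.
have [h0 e0 bv step] := sv.
have s_ge0 : 0 <= s by rewrite -khs mulr_ge0// ltW.
have s_le1 : s <= 1 by apply: (le_trans ss0); apply: (le_trans s0t).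
set r := Num.sqrt (1 - s).
have r0 : 0 <= r by exact: sqrtr_ge0.
have r2 : r ^+ 2 = 1 - s by rewrite sqr_sqrtr// subr_ge0.
have r1 : r <= 1 by rewrite -(@ler_sqr _ r 1) ?nnegrE// r2 expr1n gerBl.
have ti : 0 < t^-1 by rewrite invr_gt0.
have sN : s * t^-1 <= d / 2.
  by rewrite ler_pdivrMr// (le_trans ss0).
have e1 : e <= 1 by apply: (le_trans es0); apply: (le_trans s0t).
have d20 : 0 < d / 2 by rewrite divr_gt0.
rewrite -v0 in bphi f1 f2 Hd.
have uc y z : `|y| <= t^-1 -> `|z - y| <= 2 * (d / 2) -> `|D2 (v 0) z - D2 (v 0) y| <= t.
  by move=> yt; rewrite mulrC divfK//; exact: Hd.
have r01 : 0 <= r <= 1 by rewrite r0.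
have pt := scheme_gen_pointwise sv f1 f2 e1 ti d20 (ltW t0) uc r01 r2 khs sN.
rewrite -v0.
have lphi := lingrowth_bcont (Cb2_bcont bphi).
have lgen := lingrowth_gen s1_ge0 s12 GE bphi.
have lv : lingrowth (fun y => v k (r * y)) := lingrowth_bcont (bcont_dilate r (Cb2_bcont (bv k))).
set E0 := s2 * t + e * (M + t) + 24 * ((M + 1) / (d / 2) ^+ 2) * (s2 + e) ^+ 2 * s in pt.
set E1 := s * M / 2 + 2 * (s2 + 1) * M / t^-1 in pt.
have lc := lingrowth_bcont (Cb2_bcont (proj1 (Cb2_cst E0))).
have ln := @lingrowth_norm R.
have lr := lingrowth_rm (r - 1).
have lb := lingrowthD (lingrowthD lc (lingrowthZ E1 ln)) (lingrowthZ (2 * M) lr).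
have := Ex_dist_le Tmu lv (lingrowthD lphi (lingrowthZ s lgen)) (lingrowthZ s lb) pt.
rewrite (ExD UI Tmu lphi (lingrowthZ s lgen)) (ExZ UI s Tmu lgen) (ExZ UI s Tmu lb).
move/le_trans; apply; rewrite ler_wpM2l//.
rewrite (ExD UI Tmu (lingrowthD lc (lingrowthZ E1 ln)) (lingrowthZ (2 * M) lr)).
rewrite (ExD UI Tmu lc (lingrowthZ E1 ln)) Ex_cst (ExZ UI _ Tmu ln) (ExZ UI _ Tmu lr).
have st : s <= t := le_trans ss0 s0t.
have et : e <= t := le_trans es0 s0t.
have rme : Ex mu (rm (r - 1)) <= t.
  apply: (Hdd mu `|r - 1|) => //; rewrite normr_ge0/= (le_trans _ s0dd)// (le_trans _ ss0)//.
  rewrite distrC ger0_norm ?subr_ge0//.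
  have := ler_wpM2l r0 r1; rewrite mulr1 -expr2 r2; lra.
have E0t : E0 <= t * (s2 + (M + 1) + 1).
  have q1 : e * (M + t) <= t * (M + 1).
    by rewrite ler_pM ?(ltW e0)// ?lerD2l// addr_ge0// ltW.
  have q2 : 24 * ((M + 1) / (d / 2) ^+ 2) * (s2 + e) ^+ 2 * s <= t.
    apply: le_trans s0X; rewrite mulrC ler_pM//.
      apply: mulr_ge0; last exact: sqr_ge0.
      by apply: mulr_ge0 => //; rewrite divr_ge0 ?sqr_ge0 ?addr_ge0// ltW.
    rewrite /X ler_wpM2l//.
      by apply: mulr_ge0 => //; rewrite divr_ge0 ?sqr_ge0 ?addr_ge0// ltW.
    by rewrite ler_sqr ?nnegrE ?addr_ge0 ?(ltW e0)// lerD2l.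
  move: q1 q2; rewrite /E0; lra.
have E1t : E1 <= t * (M / 2 + 2 * (s2 + 1) * M).
  rewrite /E1 invrK; have := ler_wpM2r (ltW M0) st; lra.
have E10 : 0 <= E1.
  rewrite /E1 invrK; apply: addr_ge0; first by rewrite !mulr_ge0// ltW.
  by rewrite !mulr_ge0 ?addr_ge0// ltW.
have w1 : E1 * Ex mu (fun x : R => `|x|) <= t * (M / 2 + 2 * (s2 + 1) * M) * m.
  apply: (@le_trans _ _ (E1 * m)); first by rewrite ler_wpM2l// Hm.
  by rewrite ler_wpM2r.
have w2 := ler_wpM2l (mulr_ge0 (ler0n R 2) (ltW M0)) rme.
apply: le_trans tZ; rewrite /Z; move: E0t w1 w2.
set x1 := E1 * _; set x2 := 2 * M * Ex _ _; clearbody E0 x1 x2; clear -UI s1_ge0 s12 GE; lra.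
Qed.

End Necessary.

(** * Short-time self-similarity and the Stein condition *)

Section Necessity.
Variable R : realType.
Variable Theta : set (probability R R).
Hypothesis UI : unif_integrable Theta.
Hypothesis Theta0 : Theta !=set0.
Variables (G : R -> R) (s1 s2 : R).
Hypothesis s1_ge0 : 0 <= s1.
Hypothesis s12 : s1 <= s2.
Hypothesis GE : forall a, G a = Num.max (s1 * a) (s2 * a).

Hypothesis normal : forall f, Cb2 f -> exists2 u, visc_sol G f u & u 1 0 = Nr Theta f.

(* The dilated tail of a scheme is again a scheme, with the same value at time
   [1]: this is the self-similarity of the G-normal law. *)
Lemma normal_short_time (phi : R -> R) (p : nat) (tol e1 : R) : Cb2 phi -> 0 < tol -> 0 < e1 ->
  exists h e k v, [/\ scheme G h e v, v 0 = phi, k%:R * h = p.+2%:R^-1, e <= e1 &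
    `|Nr Theta phi - Nr Theta (fun y => v k (Num.sqrt (1 - p.+2%:R^-1) * y))| <= tol].
Proof.
move=> bphi tol0 e10.
have s2_ge0 : 0 <= s2 := le_trans s1_ge0 s12.
have [M M0 HM] := Cb2_bound bphi.
have f2 x : `|D2 phi x| <= M by have [_ []] := HM x.
set Z := 1 + ((s2 + 1) * M + 1) ^+ 2 / 2 + M.
have Z0 : 0 < Z by rewrite /Z; have := sqr_ge0 ((s2 + 1) * M + 1); lra.
pose b := Num.min (Num.min 1 e1) (tol / (2 * Z)).
have b0 : 0 < b by rewrite !lt_min ltr01 e10 divr_gt0// mulr_gt0.
have b1 : b <= 1 by rewrite /b !ge_min lexx.
have be : b <= e1 by rewrite /b !ge_min lexx !orbT.
have bZ : 2 * (b * Z) <= tol.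
  have : b <= tol / (2 * Z) by rewrite /b !ge_min lexx !orbT.
  by rewrite ler_pdivlMr ?mulr_gt0//; lra.
clearbody b.
have b2 : 0 < b ^+ 2 by rewrite exprn_gt0.
have [q Hq] := inv_nat_small b2.
pose P : R := p.+2%:R; pose Q : R := q.+1%:R.
have P2 : 2 <= P by rewrite /P ler_nat.
have P0 : 0 < P by rewrite /P ltr0n.
have Q0 : 0 < Q by rewrite /Q ltr0n.
have P1 : 0 < P - 1 by lra.
(* With this step both [1 / P] and [1] are grid times, and the dilated step
   [h / r ^+ 2 = 1 / ((P - 1) Q)] divides [1] as well; [P >= 2] keeps the dilation nonzero. *)
pose h := (P * Q)^-1.
have h0 : 0 < h by rewrite invr_gt0 mulr_gt0.
have hb : h <= b ^+ 2.
  by apply: le_trans Hq; rewrite /h invfM ler_piMl ?invr_ge0 ?(ltW Q0)// invf_le1//; lra.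
pose r := Num.sqrt (1 - P^-1).
have Pi : P^-1 < 1 by rewrite invf_lt1//; lra.
have r0 : 0 < r by rewrite sqrtr_gt0 subr_gt0.
have r2 : r ^+ 2 = 1 - P^-1 by rewrite sqr_sqrtr// subr_ge0 ltW.
have r2' : r ^+ 2 = (P - 1) / P by rewrite r2; field; rewrite gt_eqF.
have [v sv v0] := scheme_exists s1_ge0 s12 GE h0 b0 bphi.
have khs : q.+1%:R * h = P^-1 by rewrite -/Q /h; field; rewrite !gt_eqF.
exists h, b, q.+1, v; split => //.
have vM x : `|D2 (v 0) x| <= M by rewrite v0.
have vkM := scheme_D2 s1_ge0 s12 GE sv vM.
have [u vu uN] := normal bphi.
have N1 : (q.+1 + p.+1 * q.+1)%:R * h = 1.
  by rewrite -mulSn natrM -/P -/Q /h divff// mulf_neq0 ?gt_eqF.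
have pv y : `|phi y - v 0 y| <= 0 by rewrite v0 subrr normr0.
have a1 : `|u 1 0 - v (q.+1 + p.+1 * q.+1)%N 0| <= 0 + b * Z.
  by apply: (scheme_visc_one 0 s1_ge0 s12 GE vu sv vM pv b1 hb); rewrite N1// subrr ltW.
have sw := scheme_dilate GE (scheme_shift q.+1 sv) r0.
have [h0' _ bw _] := sw.
have [u' vu' uN'] := normal (bw 0%N).
have wM x : `|D2 (fun y => v (q.+1 + 0)%N (r * y)) x| <= M.
  have [_ _ ->] := Cb2_dilate r (let: And4 _ _ bv _ := sv in bv (q.+1 + 0)%N).
  rewrite normrM (ger0_norm (sqr_ge0 r)) (le_trans _ (vkM (q.+1 + 0)%N (r * x)))//.
  by rewrite ler_piMl// r2 gerBl invr_ge0 ltW.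
have h'E : h / r ^+ 2 = ((P - 1) * Q)^-1.
  by rewrite r2' /h; field; rewrite !gt_eqF.
have hb' : h / r ^+ 2 <= b ^+ 2.
  apply: le_trans Hq; rewrite h'E invfM ler_piMl ?invr_ge0 ?(ltW Q0)// invf_le1//; lra.
have N2 : (p.+1 * q.+1)%:R * (h / r ^+ 2) = 1.
  rewrite h'E natrM -/Q (_ : p.+1%:R = P - 1) ?divff ?mulf_neq0 ?gt_eqF//.
  by rewrite /P -(natr1 p.+1) addrK.
have pv' y : `|v (q.+1 + 0)%N (r * y) - v (q.+1 + 0)%N (r * y)| <= 0 by rewrite subrr normr0.
have a2 : `|u' 1 0 - v (q.+1 + p.+1 * q.+1)%N (r * 0)| <= 0 + b * Z.
  by apply: (scheme_visc_one 0 s1_ge0 s12 GE vu' sw wM pv' b1 hb'); rewrite N2// subrr ltW.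
rewrite uN in a1; rewrite uN' mulr0 addn0 in a2.
rewrite -/P -/r.
set A := Nr _ _ in a1 *; set B := Nr _ _ in a2 *; set w := v _ 0 in a1 a2.
rewrite (_ : A - B = (A - w) - (B - w)); last by ring.
rewrite (le_trans (ler_normB _ _))//; move: a1 a2 bZ; rewrite -/Z; lra.
Qed.

(** For [V], the dilated scheme at time [s], the expectations [N V] and [N phi] agree up to [s * t],
    while [E V = E phi + s E (gen phi)] up to [s * t]. Optimality for [phi] thus bounds
    [E (gen phi)] above, and a near maximiser of [V] has it almost nonnegative; the uniform upper
    bound [B] then makes that measure nearly optimal for [phi] too. *)
Lemma normal_gen_near (phi : R -> R) (tol : R) : Cb2 phi -> 0 < tol ->
  (forall mu, Theta mu -> Ex mu phi = Nr Theta phi -> Ex mu (gen G phi) <= tol) /\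
  exists2 mu, Theta mu & Nr Theta phi - tol <= Ex mu phi /\ - tol <= Ex mu (gen G phi).
Proof.
move=> bphi tol0.
have s2_ge0 : 0 <= s2 := le_trans s1_ge0 s12.
have lgen := lingrowth_gen s1_ge0 s12 GE bphi.
have [B HB] : exists B, forall mu, Theta mu -> Ex mu (gen G phi) <= B.
  have [m m0 Hm] := Ex_norm_le UI.
  have [_ [C HC]] := lgen; exists (C * (1 + m)) => mu Tmu.
  have C0 : 0 <= C by have := HC 0; rewrite normr0 addr0 mulr1; apply: le_trans.
  have l1 := lingrowth_bcont (Cb2_bcont (proj1 (Cb2_cst (1 : R)))).
  have ln := @lingrowth_norm R.
  apply: (@le_trans _ _ (Ex mu (fun x => C * (1 + `|x|)))).
    apply: (Ex_le UI Tmu lgen (lingrowthZ C (lingrowthD l1 ln))) => x.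
    by apply: le_trans (HC x); exact: ler_norm.
  rewrite (ExZ UI _ Tmu (lingrowthD l1 ln)) (ExD UI Tmu l1 ln) Ex_cst ler_wpM2l// lerD2l.
  exact: Hm.
pose t := tol / (3 + `|B|).
have B3 : 0 < 3 + `|B| by rewrite ltr_wpDr.
have t0 : 0 < t by rewrite divr_gt0.
have tB : t * (3 + `|B|) = tol by rewrite /t divfK// gt_eqF.
clearbody t.
have [s0 s00 Hs0] := scheme_gen_expansion UI s1_ge0 s12 GE bphi t0.
have st0 : 0 < Num.min s0 t by rewrite lt_min s00.
have [p Hp] := inv_nat_small st0.
set s : R := p.+2%:R^-1.
have sp : s <= p.+1%:R^-1 by rewrite /s lef_pV2 ?posrE ?ltr0n// ler_nat.
have ss0 : s <= s0 by rewrite (le_trans sp)// (le_trans Hp)// ge_min lexx.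
have stt : s <= t by rewrite (le_trans sp)// (le_trans Hp)// ge_min lexx orbT.
have s_gt0 : 0 < s by rewrite invr_gt0 ltr0n.
have s_le1 : s <= 1 by rewrite /s invf_le1 ?ler1n// ltr0n.
have [h [e [k [v [sv v0 khs es close]]]]] := normal_short_time p bphi (mulr_gt0 s_gt0 t0) s00.
rewrite -/s in khs close.
set V := fun y => v k (Num.sqrt (1 - s) * y) in close.
have bV : bcont V := bcont_dilate _ (Cb2_bcont (let: And4 _ _ bv _ := sv in bv k)).
have exp mu (Tmu : Theta mu) := Hs0 h e v k s mu sv v0 khs ss0 es Tmu.
rewrite -/V in exp.
have /ler_normlP[c1 c2] := close.
have tB0 := normr_ge0 B.
have t3 : t * 3 <= tol by rewrite -tB ler_pM2l// lerDl.
split.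
  move=> mu Tmu opt; have /ler_normlP[x1 x2] := exp mu Tmu.
  rewrite opt in x1 x2; have n1 := Nr_ge UI Theta0 Tmu bV; rewrite -(ler_pM2l s_gt0).
  have := ler_wpM2l (ltW s_gt0) t3; have := mulr_gt0 s_gt0 t0.
  move: x1 x2 n1 c1 c2; set X := Ex _ _; set Y := Ex _ _; lra.
have [mu Tmu nV] := Nr_approx UI Theta0 bV (mulr_gt0 s_gt0 t0).
exists mu; first exact: Tmu.
have /ler_normlP[x1 x2] := exp mu Tmu.
have n1 := Nr_ge UI Theta0 Tmu (Cb2_bcont bphi).
have n2 := HB mu Tmu.
have sB : s * Ex mu (gen G phi) <= t * `|B|.
  apply: (@le_trans _ _ (s * `|B|)); last by rewrite ler_wpM2r.
  by rewrite ler_pM2l// (le_trans n2)// ler_norm.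
have stt' : s * t <= t by rewrite ler_piMl// ltW.
split.
  move: x1 x2 n1 c1 c2 nV sB stt' tB; set X := Ex _ _; set Y := Ex _ _; lra.
rewrite -(ler_pM2l s_gt0).
have := ler_wpM2l (ltW s_gt0) t3.
move: x1 x2 n1 c1 c2 nV; set X := Ex _ _; set Y := Ex _ _; lra.
Qed.

Lemma normal_gen (phi : R -> R) : weakly_compact Theta -> Cb2 phi ->
  (forall mu, Theta mu -> Ex mu phi = Nr Theta phi -> Ex mu (gen G phi) <= 0) /\
  exists2 mu, Theta mu & Ex mu phi = Nr Theta phi /\ 0 <= Ex mu (gen G phi).
Proof.
move=> WC bphi; split.
  move=> mu Tmu opt; apply: (@ler_eps _ _ _ 1) => b b0; rewrite add0r mulr1.
  by have [H _] := normal_gen_near bphi b0; exact: H.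
have bc := Cb2_bcont bphi.
have [|mu Tmu [a b]] := weakly_compact_attain UI (a := Nr Theta phi) (b := 0) WC
    (lingrowth_bcont bc) (lingrowth_gen s1_ge0 s12 GE bphi).
  by move=> e e0; rewrite sub0r; have [_] := normal_gen_near bphi e0.
exists mu => //; split => //; apply/eqP; rewrite eq_le a andbT.
exact: Nr_ge.
Qed.

End Necessity.

(** * The equivalence *)

Section GNormal.
Variable R : realType.

(** The link with the analysis above, which sees [G] only as a maximum of two lines, with [s1] and
    [s2] half the squared volatilities. *)
Lemma Gfun_max (slo sup a : R) : 0 <= slo -> slo <= sup ->
  Gfun slo sup a = Num.max (slo ^+ 2 / 2 * a) (sup ^+ 2 / 2 * a).
Proof.
move=> slo0 ss; rewrite /Gfun.
have s12 : slo ^+ 2 / 2 <= sup ^+ 2 / 2.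
  by rewrite ler_pM2r ?invr_gt0// ler_sqr ?nnegrE// (le_trans slo0).
have [a0|a0] := leP 0 a.
  have -> : Num.max (- a) 0 = 0 by apply/max_idPr; rewrite oppr_le0.
  have -> : Num.max (slo ^+ 2 / 2 * a) (sup ^+ 2 / 2 * a) = sup ^+ 2 / 2 * a.
    by apply/max_idPr; rewrite ler_wpM2r.
  ring.
have aN : 0 <= - a by rewrite oppr_ge0 ltW.
have -> : Num.max (- a) 0 = - a by apply/max_idPl.
have -> : Num.max (slo ^+ 2 / 2 * a) (sup ^+ 2 / 2 * a) = slo ^+ 2 / 2 * a.
  by apply/max_idPl; have := ler_wpM2r aN s12; lra.
ring.
Qed.

Lemma visc_solE (slo sup : R) (phi : R -> R) (u : R -> R -> R) :
  is_G_visc_sol slo sup phi u <-> visc_sol (Gfun slo sup) phi u.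
Proof. by split=> [[a [b [c [d e]]]]|[a b c d e]]. Qed.

Lemma Cb2_CbLip (f : R -> R) : Cb2 f -> CbLip f.
Proof.
move=> bf; have [M _ HM] := Cb2_bound bf; have [d1 _ _] := Cb2D bf; split; exists M.
  by move=> x; have [] := HM x.
by apply: lipschitz_of_derive d1 _ => x; have [_ []] := HM x.
Qed.

Lemma CbLip_bcont (f : R -> R) : CbLip f -> bcont f.
Proof.
move=> [bf [L fL]]; split=> // x; apply/cvgrPdist_lt => e e0; near=> y.
apply: (le_lt_trans (fL x y)); apply: (@le_lt_trans _ _ ((`|L| + 1) * `|x - y|)).
  by rewrite ler_wpM2r// (le_trans (ler_norm L))// lerDl.
rewrite -ltr_pdivlMl ?ltr_wpDl// mulrC; near: y.
by apply: cvgr_dist_lt => //; rewrite divr_gt0// ltr_wpDl.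
Unshelve. all: by end_near. Qed.

(** [uG] is a choice, meaningful only when the set of solutions is inhabited: this is where
    existence enters. *)
Lemma NG_spec (slo sup : R) (phi : R -> R) : 0 <= slo -> slo <= sup -> CbLip phi ->
  visc_sol (Gfun slo sup) phi (uG slo sup phi).
Proof.
move=> slo0 ss [[B fB] [L fL]]; apply/visc_solE.
apply: (@getPex _ [set u | is_G_visc_sol slo sup phi u]).
have s12 : slo ^+ 2 / 2 <= sup ^+ 2 / 2.
  by rewrite ler_pM2r ?invr_gt0// ler_sqr ?nnegrE// (le_trans slo0).
have s1 : 0 <= slo ^+ 2 / 2 by rewrite divr_ge0 ?sqr_ge0.
have [u vu] := visc_exists s1 s12 (fun a => Gfun_max a slo0 ss) fB fL.
by exists u; apply/visc_solE.
Qed.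

Lemma stein_integrand (slo sup : R) (mu : probability R R) (phi : R -> R) :
  (\int[mu]_x (Gfun slo sup (derive1 (derive1 phi) x) - x / 2 * derive1 phi x)%:E)%E =
  mint mu (gen (Gfun slo sup) phi).
Proof. by rewrite /mint /gen D1.unlock D2.unlock. Qed.

End GNormal.

Unset Implicit Arguments.

Theorem theorem1p5 (R : realType) (slo sup : R) (Theta : set (probability R R)) :
  0 <= slo -> slo <= sup ->
  weakly_compact Theta ->
  unif_integrable Theta ->
  (forall phi : R -> R, CbLip phi -> sublinN Theta phi = (NG slo sup phi)%:E)
  <->
  (forall phi : R -> R, Cb2 phi ->
     ereal_sup [set (\int[mu]_x
                      (Gfun slo sup (derive1 (derive1 phi) x)
                       - x / 2 * derive1 phi x)%:E)%E
               | mu in [set mu | Theta mu /\ mint mu phi = sublinN Theta phi]]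
     = 0%E).
Proof.
move=> slo0 ss WC UI.
have s12 : slo ^+ 2 / 2 <= sup ^+ 2 / 2.
  by rewrite ler_pM2r ?invr_gt0// ler_sqr ?nnegrE// (le_trans slo0).
have s1 : 0 <= slo ^+ 2 / 2 by rewrite divr_ge0 ?sqr_ge0.
have GE a := Gfun_max a slo0 ss.
set G := Gfun slo sup in GE *.
have lgen f (bf : Cb2 f) := lingrowth_gen s1 s12 GE bf.
have optE (Theta0 : Theta !=set0) mu f : Theta mu -> Cb2 f ->
    (mint mu f = sublinN Theta f) <-> (Ex mu f = Nr Theta f).
  move=> Tmu bf; rewrite (mint_Ex UI Tmu (lingrowth_bcont (Cb2_bcont bf))).
  by rewrite (sublinN_Nr UI Theta0 (Cb2_bcont bf)); split=> [[]|->].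
have c0 : Cb2 (fun=> 0 : R) := (Cb2_cst (0 : R)).1.
split.
  move=> HN phi bphi.
  (* Over an empty Theta the supremum is minus infinity, which is not the finite value prescribed
     for the zero function; the converse direction argues likewise. *)
  have Theta0 : Theta !=set0.
    apply/set0P/eqP => T0; have := HN _ (Cb2_CbLip c0).
    by rewrite /sublinN T0 image_set0 ereal_sup0.
  have normal f : Cb2 f -> exists2 u, visc_sol G f u & u 1 0 = Nr Theta f.
    move=> bf; exists (uG slo sup f); first exact: NG_spec slo0 ss (Cb2_CbLip bf).
    have := HN f (Cb2_CbLip bf); rewrite (sublinN_Nr UI Theta0 (Cb2_bcont bf)).
    by case=> ->.
  have [le0 [mu Tmu [opt ge0]]] := normal_gen UI Theta0 s1 s12 GE normal WC bphi.
  apply/eqP; rewrite eq_le; apply/andP; split.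
    apply: ge_ereal_sup => _ [nu [Tnu nuopt] <-].
    rewrite stein_integrand (mint_Ex UI Tnu (lgen _ bphi)) lee_fin; apply: le0 => //.
    by move/(optE Theta0 nu phi Tnu bphi): nuopt.
  apply: (@le_trans _ _ (mint mu (gen G phi))).
    by rewrite (mint_Ex UI Tmu (lgen _ bphi)) lee_fin.
  apply: ereal_sup_ubound; exists mu; last by rewrite stein_integrand.
  by split=> //; apply/(optE Theta0 mu phi Tmu bphi).
move=> HS phi Lphi.
have Theta0 : Theta !=set0.
  apply/set0P/eqP => T0; have := HS _ c0.
  rewrite (_ : [set mu | _] = set0) ?image_set0 ?ereal_sup0//.
  by rewrite -subset0 => mu [+ _]; rewrite T0.
have stein_ge V eta : Cb2 V -> 0 < eta -> exists2 mu, Theta mu &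
    Ex mu V = Nr Theta V /\ - eta <= Ex mu (gen G V).
  move=> bV eta0; have : ((- eta)%:E < 0 :> \bar R)%E by rewrite lte_fin oppr_lt0.
  rewrite -(HS V bV) => /ereal_sup_gt[_ [mu [Tmu opt] <-]].
  rewrite stein_integrand (mint_Ex UI Tmu (lgen _ bV)) lte_fin => /ltW h.
  by exists mu => //; split=> //; apply/(optE Theta0 mu V Tmu bV).
have stein_le V : Cb2 V -> exists2 mu, Theta mu & Ex mu V = Nr Theta V /\ Ex mu (gen G V) <= 0.
  (* The tolerance [1] is arbitrary: [stein_ge] only supplies an optimal measure, and the sign comes
     from the supremum being [0]. *)
  move=> bV; have [mu Tmu [opt _]] := stein_ge V 1 bV ltr01; exists mu => //; split=> //.
  have : ((Ex mu (gen G V))%:E <= 0)%E; last by rewrite lee_fin.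
  rewrite -(mint_Ex UI Tmu (lgen _ bV)) -(HS V bV).
  apply: ereal_sup_ubound; exists mu; last by rewrite stein_integrand.
  by split=> //; apply/(optE Theta0 mu V Tmu bV).
have bphi := CbLip_bcont Lphi.
have vu := NG_spec slo0 ss Lphi.
rewrite (sublinN_Nr UI Theta0 bphi); congr (_%:E); rewrite /NG.
have [Bphi [L fL]] := Lphi.
have L0 : 0 <= L by have := fL 0 1; rewrite sub0r normrN normr1 mulr1; apply: le_trans.
set Z := L ^+ 2 + 2 * (sup ^+ 2 / 2 + 1).
(* The two bounds concern C^2 data, so [phi] is replaced by a C^2 function at distance [r * Z]; this
   distance is paid once in the expectation and once in the viscosity solution. *)
have close r : 0 < r -> `|Nr Theta phi - uG slo sup phi 1 0| <= r * (2 * Z).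
  move=> r0; have [f [bf fphi f2 f1]] := CbLip_approx s1 s12 GE Bphi fL r0.
  rewrite -/Z in fphi f2; clearbody Z.
  have bc := Cb2_bcont bf.
  have fphi' x : `|phi x - f x| <= r * Z by rewrite distrC; exact: fphi.
  have lo := stein_sufficient_lower UI Theta0 s1 s12 GE stein_le bf L0 f1 f2 vu fphi'.
  have up := stein_sufficient_upper UI Theta0 s1 s12 GE stein_ge bf L0 f1 f2 vu fphi'.
  have n1 : Nr Theta phi <= Nr Theta f + r * Z.
    by apply: (Nr_shift UI Theta0 bphi bc) => x; have /ler_normlP[] := fphi x; lra.
  have n2 : Nr Theta f <= Nr Theta phi + r * Z.
    by apply: (Nr_shift UI Theta0 bc bphi) => x; have /ler_normlP[] := fphi x; lra.
  move: lo up n1 n2; set A := Nr _ _; set B := Nr _ _; set C := uG _ _ _ _ _ => lo up n1 n2.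
  by clearbody A B C; rewrite ler_norml; apply/andP; split; lra.
apply/eqP; rewrite -subr_eq0 -normr_le0.
by apply: (@ler_eps _ _ _ (2 * Z)) => r r0; rewrite add0r; exact: close.
Qed.
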